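(* Suppose the standing assumptions on $(X,Y,f,F)$ and the stochastic oracle assumption of the context hold. Let $\overline B\ge B$ be a known upper bound independent of $\varepsilon$ and $\tau$. Given $\varepsilon>0$, set $\tau=\min\{L,\varepsilon/(2D_Y)\}$, choose $h,\alpha,k,\beta$ as in the context for this $\tau$, and set $$T=\max\left\{1,\left\lceil\frac{256L\overline B}{\beta\varepsilon^2}\right\rceil\right\},\qquad m=\max\left\{1,\left\lceil\frac{76800\sigma^2}{\beta\varepsilon^2}\right\rceil\right\}.$$ Then the output $(x_{\rm out},y_{\rm out})=(x_{J+1},y_{J+1})$ of SPDE satisfies $\mathbb E[\mathcal R(x_{\rm out},y_{\rm out})^2]\le\varepsilon^2$. The number $N$ of SFO calls satisfies $$N\le3mT\le3\left(1+\frac{256L\overline B}{\beta\varepsilon^2}\right)\left(1+\frac{76800\sigma^2}{\beta\varepsilon^2}\right).$$ With $K_\varepsilon:=\max\{1,\sqrt{2LD_Y/\varepsilon}\}$, $$N=O\!\left(1+\frac{(L\overline B+\sigma^2)K_\varepsilon}{\varepsilon^2}+\frac{L\overline B\sigma^2K_\varepsilon^2}{\varepsilon^4}\right).$$ For a fixed problem, initialization, $\overline B$, and $\sigma>0$, as $\varepsilon\downarrow0$, the iteration count is $T=O(\varepsilon^{-5/2})$ and the batch size is $m=O(\varepsilon^{-5/2})$, so $N=O(\varepsilon^{-5})$.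
   Context: **Standing assumptions.** All norms are Euclidean. $X\subseteq\mathbb R^n$ is nonempty, closed, convex; $Y\subseteq\mathbb R^p$ is nonempty, compact, convex with $D_Y:=\max_{y\in Y}\|y\|>0$. $\omega\sim\mathcal D$ is random and $F(x,y)=\mathbb E_{\omega\sim\mathcal D}[f(x,y;\omega)]$. For almost every $\omega$, $f(\cdot,\cdot;\omega)$ is differentiable on a neighborhood of $X\times Y$. $F$ is continuously differentiable on a neighborhood of $X\times Y$ and $\nabla F$ is $L$-Lipschitz on $X\times Y$ for some $L>0$. For every $x\in X$, $F(x,\cdot)$ is concave on $Y$. $\phi(x):=\max_{y\in Y}F(x,y)$ and $\phi_{\inf}:=\inf_{x\in X}\phi(x)>-\infty$. $\Pi_C$ and $N_C$ denote Euclidean projection onto, and the normal cone of, a closed convex set $C$. **Stochastic oracle.** There is a constant $\sigma\ge0$ (independent of query point, iteration and $\tau$) such that for every sigma-algebra $\mathcal A$ of pre-query information and every $\mathcal A$-measurable $u\in X\times Y$, a fresh sample $\omega\sim\mathcal D$ independent of $\mathcal A$ satisfies $\mathbb E[\nabla f(u;\omega)\mid\mathcal A]=\nabla F(u)$ and $\mathbb E[\|\nabla f(u;\omega)-\nabla F(u)\|^2\mid\mathcal A]\le\sigma^2$. Samples within a batch are independent draws from $\mathcal D$, independent of all information available before the batch is queried. Each evaluation of $\nabla f(u;\omega)$ is one stochastic first-order oracle (SFO) call. **Residual.** For $(x,y)\in X\times Y$, $\mathcal R(x,y)^2:=\operatorname{dist}^2(0,\nabla_xF(x,y)+N_X(x))+\operatorname{dist}^2(0,-\nabla_yF(x,y)+N_Y(y))$.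 **SPDE.** Given deterministic $x_0\in X$, $y_0\in Y$, integers $m,T\ge1$, and parameters $\tau,h,\alpha,k,\beta$, set $z_0=x_0$, $\xi_0=0$, $n_0=v_0=0$. For $t=0,\dots,T-1$ (each estimate below is the average of $\nabla f(\cdot;\omega)$ over a fresh batch of $m$ samples at the indicated point, with components $\widehat g=(\widehat g_x,\widehat g_y)$): (1) $\widehat g^{(0)}_t$ at $(x_t,y_t)$; $\widetilde x_t=\Pi_X(x_t-h(\widehat g^{(0)}_{x,t}+2L(x_t-z_t)+\xi_t))$, $\widetilde y_t=\Pi_Y(y_t+h(\widehat g^{(0)}_{y,t}-\tau y_t-n_t+v_t))$. (2) $\widehat g^{(1)}_t$ at $(\widetilde x_t,\widetilde y_t)$; $\bar v_t=\alpha v_t+k(\widehat g^{(1)}_{y,t}-\tau\widetilde y_t)$; $x_{t+1}=\Pi_X(x_t-h(\widehat g^{(1)}_{x,t}+2L(\widetilde x_t-z_t)))$; $\xi_{t+1}=\frac{x_t-x_{t+1}}h-\widehat g^{(1)}_{x,t}-2L(\widetilde x_t-z_t)$; $y_{t+1}=\Pi_Y(y_t+h(\widehat g^{(1)}_{y,t}-\tau\widetilde y_t+\bar v_t))$; $n_{t+1}=\frac1{1+k}\left(\frac{y_t-y_{t+1}}h+\widehat g^{(1)}_{y,t}-\tau\widetilde y_t+\bar v_t\right)$. (3) $\widehat g^{(2)}_t$ at $(x_{t+1},y_{t+1})$; $v_{t+1}=\alpha v_t+k(\widehat g^{(2)}_{y,t}-\tau y_{t+1}-n_{t+1})$; $z_{t+1}=z_t+\beta(x_{t+1}-z_t)$.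 Finally $J\sim\operatorname{Unif}\{0,\dots,T-1\}$ is drawn independently of all oracle samples and the output is $(x_{J+1},y_{J+1})$. **Parameters.** $s=\sqrt{2L\tau}$, $h=\frac1{64(3L+\tau)}$, $\alpha=(1+hs/16)^{-1}$, $k=\frac{h(8L-s)}{16+hs}$, $\beta=\frac{hs}{4096}$. **Initial quantity.** $B:=\phi(x_0)-\phi_{\inf}+2D_Y\|\nabla_yF(x_0,y_0)\|+\frac{\|\nabla_xF(x_0,y_0)\|^2+2\|\nabla_yF(x_0,y_0)\|^2}{L}+\left(3+\frac1{64}\right)LD_Y^2$. **Asymptotic notation.** $O(\cdot)$ suppresses constants independent of $\varepsilon$ and of any parameters whose dependence is displayed explicitly. *)

(* Defs.v *)
From HB Require Import structures.
From mathcomp Require Import all_boot all_order all_algebra.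
From mathcomp Require Import all_classical all_reals all_analysis.
Set Implicit Arguments.
Unset Strict Implicit.
Unset Printing Implicit Defensive.
Import Order.TTheory GRing.Theory Num.Theory.
Import numFieldNormedType.Exports.
Local Open Scope classical_set_scope.
Local Open Scope ring_scope.

(* The library norm `|x| on matrices and on products is the sup norm (it induces
   the usual topology, hence the usual open/closed/compact sets and
   differentiability); the Euclidean norms are defined here. *)
Section Euclidean.
Context {R : realType}.

Definition edot n (u v : 'rV[R]_n) : R := \sum_i u 0 i * v 0 i.

Definition enorm n (u : 'rV[R]_n) : R := Num.sqrt (edot u u).

Definition enorm2 n p (z : 'rV[R]_n * 'rV[R]_p) : R :=
  Num.sqrt (enorm z.1 ^+ 2 + enorm z.2 ^+ 2).

(* The nearest point of C to u; it exists and is unique when C is nonempty,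
   closed and convex, which is the only case in which it is used. *)
Definition eproj n (C : set 'rV[R]_n) (u : 'rV[R]_n) : 'rV[R]_n :=
  xget 0 [set v | C v /\ forall c, C c -> enorm (u - v) <= enorm (u - c)].

(* Only used at points x of C. *)
Definition normal_cone n (C : set 'rV[R]_n) (x : 'rV[R]_n) : set 'rV[R]_n :=
  [set v | forall c, C c -> edot v (c - x) <= 0].

Definition dist0 n (S : set 'rV[R]_n) : R := inf [set enorm v | v in S].

Definition grad n p (F : 'rV[R]_n * 'rV[R]_p -> R) (z : 'rV[R]_n * 'rV[R]_p) :
    'rV[R]_n * 'rV[R]_p :=
  (\row_i 'D_(delta_mx 0 i, 0) F z, \row_j 'D_(0, delta_mx 0 j) F z).

End Euclidean.

Section Problem.
Context {R : realType} {n p : nat}.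
Local Notation E := ('rV[R]_n * 'rV[R]_p)%type.
Context {dW : measure_display} {W : measurableType dW}.
Variables (X : set 'rV[R]_n) (Y : set 'rV[R]_p).
Variables (D : probability W R) (f : E -> W -> R).

Definition meanF (z : E) : R := fine (\int[D]_w (f z w)%:E).

Definition sgrad (w : W) : E -> E := grad (fun z => f z w).

Definition max_norm : R := sup [set enorm y | y in Y].

Definition phi (x : 'rV[R]_n) : R := sup [set meanF (x, y) | y in Y].

Definition phi_inf : R := inf [set phi x | x in X].

Record standing_assumptions (L : R) : Prop := {
  X_nonempty : X !=set0;
  X_closed : closed X;
  X_convex : convex_set (X : set (convex_lmodType 'rV[R]_n));
  Y_nonempty : Y !=set0;
  Y_compact : compact Y;
  Y_convex : convex_set (Y : set (convex_lmodType 'rV[R]_p));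
  max_norm_gt0 : 0 < max_norm;
  f_differentiable : {ae D, forall w, exists U : set E,
    [/\ open U, X `*` Y `<=` U &
        forall z, U z -> differentiable (fun z' => f z' w) z]};
  F_C1 : exists U : set E,
    [/\ open U, X `*` Y `<=` U &
        forall z, U z -> [/\ D.-integrable setT (fun w => (f z w)%:E),
                            differentiable meanF z &
                            {for z, continuous (grad meanF)}]];
  L_gt0 : 0 < L;
  gradF_Lipschitz : forall z z', (X `*` Y) z -> (X `*` Y) z' ->
    enorm2 (grad meanF z - grad meanF z') <= L * enorm2 (z - z');
  F_concave : forall x, X x ->
    convex_function (Y : set (convex_lmodType 'rV[R]_p))
                    (fun y => - meanF (x, y));
  phi_bounded_below : has_lbound [set phi x | x in X] }.

Definition residual (z : E) : R :=
  Num.sqrt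
    (dist0 [set (grad meanF z).1 + v | v in normal_cone X z.1] ^+ 2 +
     dist0 [set - (grad meanF z).2 + v | v in normal_cone Y z.2] ^+ 2).

Definition initial_quantity (L : R) (x0 : 'rV[R]_n) (y0 : 'rV[R]_p) : R :=
  let g := grad meanF (x0, y0) in
  phi x0 - phi_inf + 2 * max_norm * enorm g.2
  + (enorm g.1 ^+ 2 + 2 * enorm g.2 ^+ 2) / L
  + (3 + 64^-1) * L * max_norm ^+ 2.

End Problem.

Section Probability.
Context {R : realType} {d : measure_display} {Om : measurableType d}.
Variable P : probability Om R.

Definition sub_sigma_algebra (G : set (set Om)) : Prop :=
  sigma_algebra setT G /\ G `<=` measurable.

(* Measurability of a map from (Om, G) to a topological space with its Borel
   sigma-algebra, when G is a sigma-algebra. *)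
Definition borel_measurable (T : topologicalType) (G : set (set Om))
    (h : Om -> T) : Prop :=
  forall U : set T, open U -> G (h @^-1` U).

Definition sigma_of d' (T : measurableType d') (Z : Om -> T) : set (set Om) :=
  preimage_set_system setT Z measurable.

Definition independent (G H : set (set Om)) : Prop :=
  forall A B, G A -> H B -> P (A `&` B) = (P A * P B)%E.

(* Taking A i = setT for some indices gives the product rule for subfamilies. *)
Definition mutually_independent d' (T : measurableType d') (I : finType)
    (Z : I -> Om -> T) : Prop :=
  forall A : I -> set T, (forall i, measurable (A i)) ->
    P (\bigcap_i (Z i @^-1` A i)) = (\prod_i P (Z i @^-1` A i))%E.

Definition has_law d' (T : measurableType d') (D : probability T R)
    (Z : {RV P >-> T}) : Prop :=
  forall A, measurable A -> distribution P Z A = D A.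

Definition cond_exp_ge0 (G : set (set Om)) (Z V : Om -> R) : Prop :=
  [/\ borel_measurable G V, (forall o, 0 <= V o) &
      forall A, G A -> (\int[P]_(o in A) (Z o)%:E = \int[P]_(o in A) (V o)%:E)%E].

(* V = E[Z | G] a.s., in the generalized sense E[Z^+ | G] - E[Z^- | G] with both
   terms finite; Z itself need not be integrable, since the gradient at a random
   point of an unbounded set may fail to be. *)
Definition cond_exp (G : set (set Om)) (Z V : Om -> R) : Prop :=
  measurable_fun setT Z /\
  exists Vp Vn, [/\ cond_exp_ge0 G Z^\+ Vp, cond_exp_ge0 G Z^\- Vn &
                    {ae P, forall o, V o = Vp o - Vn o}].

Context {n p : nat} {dW : measure_display} {W : measurableType dW}.
Local Notation E := ('rV[R]_n * 'rV[R]_p)%type.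

(* The first conclusion makes explicit that the oracle's answer is a random
   vector determined by the pre-query information and the fresh sample. *)
Definition stochastic_oracle (X : set 'rV[R]_n) (Y : set 'rV[R]_p)
    (D : probability W R) (f : E -> W -> R) (sigma : R) : Prop :=
  forall (G : set (set Om)) (u : Om -> E) (w : {RV P >-> W}),
    sub_sigma_algebra G ->
    borel_measurable G u -> (forall o, (X `*` Y) (u o)) ->
    has_law D w -> independent (sigma_of w) G ->
    let g := fun o => sgrad f (w o) (u o) in
    let gF := fun o => grad (meanF D f) (u o) in
    [/\ borel_measurable <<s G `|` sigma_of w >> g,
        forall i, cond_exp G (fun o => (g o).1 0 i) (fun o => (gF o).1 0 i),
        forall j, cond_exp G (fun o => (g o).2 0 j) (fun o => (gF o).2 0 j) &
        exists V, cond_exp G (fun o => enorm2 (g o - gF o) ^+ 2) V /\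
                  {ae P, forall o, V o <= sigma ^+ 2}].

(* w t j i is the i-th sample of the batch used for the estimate j of
   iteration t. *)
Definition fresh_samples (D : probability W R) (T m : nat)
    (w : nat -> nat -> nat -> {RV P >-> W}) : Prop :=
  (forall t j i, (t < T)%N -> (j < 3)%N -> (i < m)%N -> has_law D (w t j i)) /\
  mutually_independent
    (fun q : 'I_T * 'I_3 * 'I_m => w q.1.1 q.1.2 q.2 : Om -> W).

Definition uniform_index (T m : nat) (w : nat -> nat -> nat -> {RV P >-> W})
    (J : {RV P >-> nat}) : Prop :=
  (forall t, (t < T)%N -> P (J @^-1` [set t]) = (T%:R^-1)%:E) /\
  independent (sigma_of J)
    <<s \bigcup_(q : 'I_T * 'I_3 * 'I_m) sigma_of (w q.1.1 q.1.2 q.2) >>.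

End Probability.

Section SPDE.
Context {R : realType} {n p : nat} {W : Type}.
Local Notation E := ('rV[R]_n * 'rV[R]_p)%type.

Record spde_params := SpdeParams {
  p_tau : R; p_h : R; p_alpha : R; p_k : R; p_beta : R }.

Record spde_state := SpdeState {
  st_x : 'rV[R]_n; st_y : 'rV[R]_p; st_z : 'rV[R]_n;
  st_xi : 'rV[R]_n; st_n : 'rV[R]_p; st_v : 'rV[R]_p;
  st_calls : nat (* number of oracle calls made so far *) }.

Variables (X : set 'rV[R]_n) (Y : set 'rV[R]_p).
Variable g : W -> E -> E.
Variables (L : R) (pr : spde_params) (m : nat).

Definition sfo_call (u : E) (acc : E * nat) (w : W) : E * nat :=
  (acc.1 + g w u, acc.2.+1).

Definition batch (u : E) (ws : seq W) (calls : nat) : E * nat :=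
  let acc := foldl (sfo_call u) (0, calls) ws in
  ((size ws)%:R^-1 *: acc.1, acc.2).

Definition spde_step (w : nat -> nat -> W) (s : spde_state) : spde_state :=
  let: SpdeParams tau h alpha k beta := pr in
  let: SpdeState x y z xi nn v c := s in
  let: (g0x, g0y, c0) := batch (x, y) (mkseq (w 0) m) c in
  let xt := eproj X (x - h *: (g0x + (2 * L) *: (x - z) + xi)) in
  let yt := eproj Y (y + h *: (g0y - tau *: y - nn + v)) in
  let: (g1x, g1y, c1) := batch (xt, yt) (mkseq (w 1) m) c0 in
  let vbar := alpha *: v + k *: (g1y - tau *: yt) in
  let x' := eproj X (x - h *: (g1x + (2 * L) *: (xt - z))) in
  let xi' := h^-1 *: (x - x') - g1x - (2 * L) *: (xt - z) in
  let y' := eproj Y (y + h *: (g1y - tau *: yt + vbar)) in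
  let nn' := (1 + k)^-1 *: (h^-1 *: (y - y') + g1y - tau *: yt + vbar) in
  let: (g2x, g2y, c2) := batch (x', y') (mkseq (w 2) m) c1 in
  let v' := alpha *: v + k *: (g2y - tau *: y' - nn') in
  let z' := z + beta *: (x' - z) in
  SpdeState x' y' z' xi' nn' v' c2.

Fixpoint spde_run (x0 : 'rV[R]_n) (y0 : 'rV[R]_p) (w : nat -> nat -> nat -> W)
    (t : nat) : spde_state :=
  if t is t'.+1 then spde_step (w t') (spde_run x0 y0 w t')
  else SpdeState x0 y0 x0 0 0 0 0.

Definition spde_iterate x0 y0 w t : E :=
  let s := spde_run x0 y0 w t in (st_x s, st_y s).

Definition spde_calls x0 y0 w t : nat := st_calls (spde_run x0 y0 w t).

End SPDE.

Section Schedule.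
Context {R : realType}.

(* Large numerals are unary: 4096 is written 64 ^+ 2 and 76800 is 768 * 100. *)
Definition choose_params (L tau : R) : spde_params :=
  let s := Num.sqrt (2 * L * tau) in
  let h := (64 * (3 * L + tau))^-1 in
  SpdeParams tau h (1 + h * s / 16)^-1
    (h * (8 * L - s) / (16 + h * s)) (h * s / 64 ^+ 2).

Definition eps_params (L DY eps : R) : spde_params :=
  choose_params L (Num.min L (eps / (2 * DY))).

Definition iter_ratio (L DY Bbar eps : R) : R :=
  256 * L * Bbar / (p_beta (eps_params L DY eps) * eps ^+ 2).

Definition batch_ratio (L DY sigma eps : R) : R :=
  (768 * 100) * sigma ^+ 2 / (p_beta (eps_params L DY eps) * eps ^+ 2).

Definition iter_count (L DY Bbar eps : R) : nat :=
  absz (Num.max 1 (Num.ceil (iter_ratio L DY Bbar eps))).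

Definition batch_size (L DY sigma eps : R) : nat :=
  absz (Num.max 1 (Num.ceil (batch_ratio L DY sigma eps))).

Definition K_eps (L DY eps : R) : R := Num.max 1 (Num.sqrt (2 * L * DY / eps)).

End Schedule.

(* Main.v *)
Require Import Defs.
From mathcomp Require Import all_boot all_order all_algebra.
From mathcomp Require Import all_classical all_reals all_analysis.
From mathcomp Require Import measurable_realfun.
From mathcomp Require Import ring lra.
Import Order.TTheory GRing.Theory Num.Theory.
Import numFieldNormedType.Exports.
(** Why the method works. Fix the regularization [tau]. For a centre [z], the game
    [reg z x y = F x y + L |x - z|^2 - tau/2 |y|^2] is strongly convex in [x] and
    strongly concave in [y], so it has a saddle point ([saddle_exists]), whose dual
    component is Lipschitz in [z] ([saddle_lipschitz]) and whose value changes slowly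
    with [z] ([saddle_value_ub]). One iteration is an extragradient step for this
    game: were the gradients of the corrector taken at the new point, the step
    would be implicit, and the gap between the predicted and the corrected points
    costs only a small fraction of the change of velocity, plus noise
    ([defect_bound_core]).

    Progress is measured by the potential [lyapunov]: the saddle value at the
    centre, the squared norms of the primal velocity [gx + 2L(x - z) + xi] and of the
    dual velocity [gy - tau y - n + v], the gap between the saddle value and the
    current value, and the squared norm of the momentum [v + gamma (y - y*(z))]. The
    squared velocities decrease by strong monotonicity ([velocity_monotone]). The dual
    variable has only the curvature [tau]; there the momentum, whose change is a
    multiple of the dual force [gy - tau y - n] ([momentumE]), yields a decrease
    proportional to the square of that force, and [force_to_saddle] controls what
    the momentum adds as long as [gamma^2] is a small multiple of [L tau]. This
    makes the rate [gamma], of the order of [sqrt(L tau)], instead of [tau]. The centre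
    moves with the step [beta = h gamma / 256], slowly enough for the displacement of
    the saddle point to be absorbed. By [lyapunov_core], an inequality between norms and
    inner products, this gives [one_step]: the potential decreases by [beta / 64] times a stationarity
    measure, up to the squared errors of the three gradient estimates and one term
    linear in the error of the last of them.

    In expectation the linear term vanishes, because it pairs that error with a
    vector determined by earlier samples ([past_independent], [condexp_orth]), and
    each squared error is at most [sigma^2 / m] ([batch_noise]). The potential is
    bounded below and its initial excess is at most [L] times the initial quantity
    ([lyapunov_lb], [lyapunov_init]), so the sum over the iterations bounds the average
    stationarity ([stationarity_sum]), which is its expectation at the random index
    ([uniform_expectation]). The multipliers [xi] and [n] lie in the normal cones, so the
    squared residual is at most the stationarity measure plus [2 (tau DY)^2]
    ([residual_bound]); the choices of [tau], [T] and [m] bring the total below [eps^2].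

    Each iteration makes [3 m] calls ([spde_callsE]), and the complexity follows from
    [1 / beta = O(K)] ([beta_K]): since [h L] is bounded below, [beta] is of the order of
    [sqrt(tau / L)]. *)

Set Implicit Arguments.
Unset Strict Implicit.
Unset Printing Implicit Defensive.
Local Open Scope classical_set_scope.
Local Open Scope ring_scope.

(** * The Euclidean inner product *)

Section Euclid.
Context {R : realType}.
Implicit Types (n : nat).

Lemma edotC n (u v : 'rV[R]_n) : edot u v = edot v u.
Proof. by apply: eq_bigr => i _; rewrite mulrC. Qed.

Lemma edotDl n (u v w : 'rV[R]_n) : edot (u + v) w = edot u w + edot v w.
Proof. by rewrite /edot -big_split; apply: eq_bigr => i _; rewrite mxE mulrDl. Qed.

Lemma edotDr n (u v w : 'rV[R]_n) : edot w (u + v) = edot w u + edot w v.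
Proof. by rewrite edotC edotDl !(edotC w). Qed.

Lemma edotZl n a (u w : 'rV[R]_n) : edot (a *: u) w = a * edot u w.
Proof. by rewrite /edot mulr_sumr; apply: eq_bigr => i _; rewrite mxE mulrA. Qed.

Lemma edotZr n a (u w : 'rV[R]_n) : edot w (a *: u) = a * edot w u.
Proof. by rewrite edotC edotZl edotC. Qed.

Lemma edotNl n (u w : 'rV[R]_n) : edot (- u) w = - edot u w.
Proof. by rewrite -scaleN1r edotZl mulN1r. Qed.

Lemma edotNr n (u w : 'rV[R]_n) : edot w (- u) = - edot w u.
Proof. by rewrite edotC edotNl edotC. Qed.

Lemma edot0l n (w : 'rV[R]_n) : edot 0 w = 0.
Proof. by rewrite -(scale0r 0) edotZl mul0r. Qed.

Lemma edot0r n (w : 'rV[R]_n) : edot w 0 = 0.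
Proof. by rewrite edotC edot0l. Qed.

Definition edotE := (edotDl, edotDr, edotNl, edotNr, edotZl, edotZr).

Lemma edot_ge0 n (u : 'rV[R]_n) : 0 <= edot u u.
Proof. by apply: sumr_ge0 => i _; rewrite -expr2 sqr_ge0. Qed.

Lemma edot_eq0 n (u : 'rV[R]_n) : edot u u = 0 -> u = 0.
Proof.
move=> /eqP; rewrite psumr_eq0; last by move=> i _; rewrite -expr2 sqr_ge0.
move=> /allP u0; apply/rowP => i; rewrite mxE.
by have := u0 i (mem_index_enum _); rewrite /= mulf_eq0 orbb => /eqP.
Qed.

Lemma enorm_ge0 n (u : 'rV[R]_n) : 0 <= enorm u.
Proof. exact: sqrtr_ge0. Qed.

Lemma enorm_sqr n (u : 'rV[R]_n) : enorm u ^+ 2 = edot u u.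
Proof. by rewrite sqr_sqrtr // edot_ge0. Qed.

Lemma enorm2_sqr n p (z : 'rV[R]_n * 'rV[R]_p) :
  enorm2 z ^+ 2 = edot z.1 z.1 + edot z.2 z.2.
Proof. by rewrite sqr_sqrtr ?enorm_sqr // addr_ge0 // edot_ge0. Qed.

Lemma ler_enorm n (u v : 'rV[R]_n) : (enorm u <= enorm v) = (edot u u <= edot v v).
Proof. by rewrite /enorm ler_sqrt // edot_ge0. Qed.

Lemma edot_young n (a : R) (u v : 'rV[R]_n) : 0 < a ->
  2 * edot u v <= a * edot u u + a^-1 * edot v v.
Proof.
move=> a0; have := edot_ge0 (a *: u - v); rewrite !edotE (edotC v u) => h.
have -> : a * edot u u + a^-1 * edot v v = a^-1 * (a * (a * edot u u) + edot v v).
  by field; rewrite gt_eqF.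
rewrite -(ler_pM2l a0) mulrA [leRHS]mulrA divff ?gt_eqF // mul1r; lra.
Qed.

Lemma edot_CS n (u v : 'rV[R]_n) : edot u v <= enorm u * enorm v.
Proof.
have [u0|u0] := eqVneq (enorm u) 0.
  have /edot_eq0 -> : edot u u = 0 by rewrite -enorm_sqr u0 expr0n.
  by rewrite edot0l mulr_ge0 ?enorm_ge0.
have [v0|v0] := eqVneq (enorm v) 0.
  have /edot_eq0 -> : edot v v = 0 by rewrite -enorm_sqr v0 expr0n.
  by rewrite edot0r mulr_ge0 ?enorm_ge0.
have up : 0 < enorm u by rewrite lt_def u0 enorm_ge0.
have vp : 0 < enorm v by rewrite lt_def v0 enorm_ge0.
have := edot_young u v (divr_gt0 vp up).
rewrite -!enorm_sqr.
have -> : enorm v / enorm u * enorm u ^+ 2 + (enorm v / enorm u)^-1 * enorm v ^+ 2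
  = 2 * (enorm u * enorm v) by field; rewrite u0 v0.
by rewrite ler_pM2l.
Qed.

(** The topology of row vectors comes from the sup norm [`|u|]; this bound and
    [edot_le_mx_norm] relate it to the Euclidean norm. *)
Lemma mx_norm_le_enorm n (u : 'rV[R]_n) : `|u| <= enorm u.
Proof.
rewrite [leLHS]/Num.norm /= mx_normrE; apply: bigmax_le => [|[i j] _ /=].
  exact: enorm_ge0.
rewrite (ord1 i) -ler_sqr ?nnegrE ?enorm_ge0 // enorm_sqr real_normK ?num_real //.
rewrite /edot (bigD1 j) //= expr2 lerDl; apply: sumr_ge0 => l _.
by rewrite -expr2 sqr_ge0.
Qed.

Lemma coord_le_norm n (u : 'rV[R]_n) i : `|u 0 i| <= `|u|.
Proof.
rewrite [leRHS]/Num.norm /= mx_normrE.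
by rewrite (le_bigmax _ (fun k : 'I_1 * 'I_n => `|u k.1 k.2|) (0, i)).
Qed.

Lemma edot_le_mx_norm n (u : 'rV[R]_n) : edot u u <= n%:R * `|u| ^+ 2.
Proof.
apply: (@le_trans _ _ (\sum_(i < n) `|u| ^+ 2)).
  apply: ler_sum => i _; rewrite -expr2 -(real_normK (num_real (u 0 i))).
  by rewrite ler_sqr ?nnegrE // coord_le_norm.
by rewrite sumr_const card_ord mulr_natl.
Qed.

End Euclid.

(** * Minimization of strongly convex functions *)

Section StrongConvexity.
Context {R : realType} {n : nat}.
Implicit Types (C : set 'rV[R]_n) (phi : 'rV[R]_n -> R) (mu : R).

Definition segment_closed C := forall x y t, C x -> C y -> 0 <= t <= 1 ->
  C (y + t *: (x - y)).

(** Strong convexity by quadratic minorants instead of derivatives: a supremum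
    of such functions, as it occurs in [saddle_exists], inherits the minorant of
    a function that attains it. *)
Definition strongly_supported C phi mu := forall x, C x -> exists g,
  forall x', C x' ->
    phi x + edot g (x' - x) + mu / 2 * edot (x' - x) (x' - x) <= phi x'.

(** The average of the minorant based at the intermediate point. *)
Lemma strongly_supported_segment C phi mu x y t : segment_closed C ->
  strongly_supported C phi mu -> C x -> C y -> 0 <= t <= 1 ->
  phi (y + t *: (x - y)) + mu / 2 * (t * (1 - t)) * edot (x - y) (x - y)
    <= t * phi x + (1 - t) * phi y.
Proof.
move=> Cc Hs Cx Cy /andP[t0 t1].
have Cz : C (y + t *: (x - y)) by apply: Cc => //; rewrite t0 t1.
have [g Hg] := Hs _ Cz; have := Hg _ Cx; have := Hg _ Cy.
have -> : y - (y + t *: (x - y)) = (- t) *: (x - y).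
  by rewrite opprD addrA subrr add0r scaleNr.
have -> : x - (y + t *: (x - y)) = (1 - t) *: (x - y).
  by rewrite opprD addrA scalerBl scale1r.
rewrite !edotZl !edotZr; set d := edot _ (x - y); set q := edot _ (x - y).
set f0 := phi _ => h1 h2.
have h1' := ler_wpM2l (_ : 0 <= 1 - t) h1.
have h2' := ler_wpM2l t0 h2.
have := h1' _; have := h2'; rewrite subr_ge0 => H1 /(_ t1) H2.
nra.
Qed.

(** The strong convexity inequality between [x] and the minimizer, at a parameter
    that tends to 0. *)
Lemma growth_at_min C phi mu xs x : segment_closed C ->
  strongly_supported C phi mu -> 0 <= mu ->
  C xs -> (forall y, C y -> phi xs <= phi y) -> C x ->
  phi xs + mu / 2 * edot (x - xs) (x - xs) <= phi x.
Proof.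
move=> Cc Hs mu0 Cxs mn Cx.
set b := mu / 2 * _.
have b0 : 0 <= b by rewrite mulr_ge0 ?edot_ge0 // divr_ge0.
suff H t : 0 < t -> t < 1 -> b * (1 - t) <= phi x - phi xs.
  rewrite leNgt; apply/negP => lt.
  have bp : 0 < b.
    by rewrite lt_def b0 andbT; apply/eqP => be; have := mn _ Cx; lra.
  have ax : 0 <= phi x - phi xs by rewrite subr_ge0 mn.
  (* halfway to the parameter where the inequality becomes an equality *)
  pose t := (1 - (phi x - phi xs) / b) / 2.
  have q1 : (phi x - phi xs) / b < 1 by rewrite ltr_pdivrMr //; lra.
  have q0 : 0 <= (phi x - phi xs) / b by rewrite divr_ge0 // ltW.
  have bb : b * ((phi x - phi xs) / b) = phi x - phi xs.
    by rewrite mulrC divfK // gt_eqF.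
  have := H t; rewrite /t; set q := _ / b in q1 q0 bb *.
  by move=> /(_ ltac:(lra) ltac:(lra)); nra.
move=> t0 t1.
have := strongly_supported_segment Cc Hs Cx Cxs (t := t).
have /(mn _) : C (xs + t *: (x - xs)) by apply: Cc => //; rewrite !ltW.
move=> h1 /(_ ltac:(by rewrite !ltW)) h2.
rewrite -(ler_pM2l t0).
by rewrite /b; nra.
Qed.

Lemma strongly_supported_bounded C phi mu : C !=set0 -> 0 < mu ->
  strongly_supported C phi mu -> has_inf (phi @` C).
Proof.
move=> [x0 Cx0] mu0 Hs; split; first by exists (phi x0); exists x0.
have [g Hg] := Hs _ Cx0.
exists (phi x0 - mu^-1 * edot g g) => _ [x Cx <-]; apply: le_trans (Hg _ Cx).
have := @edot_young _ _ (mu^-1 * 2) g (- (x - x0)).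
rewrite mulr_gt0 ?invr_gt0 // => /(_ isT).
rewrite !edotE opprK invfM invrK.
have : 0 <= mu * edot (x - x0) (x - x0) by rewrite mulr_ge0 ?edot_ge0 ?ltW.
by rewrite !edotE => h1 h2; lra.
Qed.

(** The midpoint of two almost minimizers is not below the infimum, so they are
    close: minimizing sequences are Cauchy. At the limit, the minorant gives
    lower semicontinuity. *)
Lemma argmin_exists C phi mu : closed C -> segment_closed C -> C !=set0 ->
  0 < mu -> strongly_supported C phi mu ->
  exists2 xs, C xs & forall x, C x ->
    phi xs + mu / 2 * edot (x - xs) (x - xs) <= phi x.
Proof.
move=> clC Cc C0 mu0 Hs.
suff [xs Cxs mn] : exists2 xs, C xs & forall x, C x -> phi xs <= phi x.
  by exists xs => // x Cx; exact: (growth_at_min Cc Hs (ltW mu0) Cxs mn Cx).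
have hi := strongly_supported_bounded C0 mu0 Hs.
set I := inf (phi @` C).
have lbI x : C x -> I <= phi x by move=> Cx; apply: ge_inf; [case: hi|exists x].
have hk k : exists x, C x /\ phi x < I + k.+1%:R^-1.
  have k0 : (0 : R) < k.+1%:R^-1 by rewrite invr_gt0.
  by have [_ [x Cx <-] lt] := inf_adherent k0 hi; exists x.
have [u Hu] := choice hk.
have half (x y : 'rV[R]_n) : C x -> C y ->
    edot (x - y) (x - y) <= 4 / mu * ((phi x - I) + (phi y - I)).
  move=> Cx Cy.
  have h : 0 <= (2^-1 : R) <= 1 by apply/andP; split; lra.
  have h1 := strongly_supported_segment Cc Hs Cx Cy h.
  have h2 := lbI _ (Cc _ _ _ Cx Cy h).
  rewrite mulrAC ler_pdivlMr //.
  move: h1 h2; set q := edot _ _; set f := phi (y + _); move=> h1 h2.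
  have E : mu / 2 * (2^-1 * (1 - 2^-1)) * q = q * mu / 8 by field.
  by rewrite E in h1; lra.
have cu : cauchy (u @ \oo).
  apply/cauchy_ballP => e; move: (e : R) => {}e e0; rewrite near_simpl.
  have e1 : 0 < mu * e ^+ 2 / 8 by rewrite divr_gt0 // mulr_gt0 // exprn_gt0.
  have : \forall k \near \oo, (k.+1%:R^-1 : R) < mu * e ^+ 2 / 8.
    exact: near_infty_natSinv_lt (PosNum e1).
  move=> H; near=> xy; rewrite -ball_normE /ball_ /=.
  have [h1 h2] : phi (u xy.1) - I < mu * e ^+ 2 / 8 /\
                 phi (u xy.2) - I < mu * e ^+ 2 / 8.
    near: xy.
    have H' : \forall k \near \oo, phi (u k) - I < mu * e ^+ 2 / 8.
      move: H; apply: filterS => k /= lt2; have [_ lt1] := Hu k.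
      by rewrite ltrBlDl (lt_trans lt1) // ltrD2l.
    pose S : set nat := [set k | phi (u k) - I < mu * e ^+ 2 / 8].
    by exists (S, S).
  have [c1 _] := Hu xy.1; have [c2 _] := Hu xy.2.
  rewrite -ltr_sqr ?nnegrE // ?(ltW e0) //.
  have : `|u xy.1 - u xy.2| ^+ 2 <= edot (u xy.1 - u xy.2) (u xy.1 - u xy.2).
    by rewrite -enorm_sqr ler_sqr ?nnegrE ?enorm_ge0 // mx_norm_le_enorm.
  move/le_lt_trans; apply; apply: le_lt_trans (half _ _ c1 c2) _.
  rewrite mulrAC ltr_pdivrMr //; nra.
have /cauchy_cvg cv := cu.
exists (lim (u @ \oo)) => [|x Cx].
  apply: (closed_cvg C clC) cv; apply: nearW => k; by case: (Hu k).
have Cl : C (lim (u @ \oo)).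
  apply: (closed_cvg C clC) cv; apply: nearW => k; by case: (Hu k).
apply: le_trans (lbI _ Cx).
have [g Hg] := Hs _ Cl.
set l := lim _ in cv Cl Hg *.
suff H (e : R) : 0 < e -> phi l <= I + e * (1 + enorm g).
  rewrite leNgt; apply/negP => lt.
  have g1 : 0 < 1 + enorm g by have := enorm_ge0 g; lra.
  have : 0 < (phi l - I) / (1 + enorm g) / 2 by rewrite !divr_gt0 // subr_gt0.
  by move=> /H; rewrite mulrAC divfK ?gt_eqF //; lra.
move=> e0.
have n1 : (0 : R) < n.+1%:R by [].
have e1 : 0 < e / n.+1%:R by rewrite divr_gt0.
have : \forall k \near \oo, (k.+1%:R^-1 : R) < e.
  exact: near_infty_natSinv_lt (PosNum e0).
have : \forall k \near \oo, `|l - u k| < e / n.+1%:R.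
  by move/cvgrPdist_lt: cv => /(_ _ e1).
move=> H1 H2; have [k [lt1 lt2]] := @filter_ex _ _ _ _ (filterI H1 H2).
have [ck ltk] := Hu k.
have := Hg _ ck.
have := edot_CS g (- (u k - l)); rewrite edotNr opprB.
have : enorm (l - u k) <= e.
  rewrite -ler_sqr ?nnegrE ?enorm_ge0 ?(ltW e0) // enorm_sqr.
  apply: le_trans (edot_le_mx_norm _) _.
  have : `|l - u k| ^+ 2 <= (e / n.+1%:R) ^+ 2.
    by rewrite ler_sqr ?nnegrE ?(ltW lt1) // ltW.
  rewrite expr_div_n ler_pdivlMr ?exprn_gt0 // => h.
  apply: le_trans _ h; rewrite mulrC ler_wpM2l ?sqr_ge0 // -natrX ler_nat.
  by rewrite (leq_trans (leqnSn n)) // leq_pmulr.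
have := edot_ge0 (u k - l); have := enorm_ge0 g.
set q := edot (u k - l) _; set d := edot g _; set a := enorm g; set b := enorm (l - _).
move=> a0 q0 be dab ph.
have : 0 <= mu / 2 * q by rewrite mulr_ge0 // divr_ge0 // ltW.
have : a * b <= a * e by rewrite ler_wpM2l.
move: ltk lt2 ph dab; set r := _^-1 => ltk lt2 ph dab h1 h2.
by rewrite mulrDr mulr1 (mulrC e a); lra.
Unshelve. all: by end_near.
Qed.

End StrongConvexity.

(** * Projections *)

Section Projection.
Context {R : realType} {n : nat}.
Variable C : set 'rV[R]_n.
Hypotheses (clC : closed C) (cvC : segment_closed C) (C0 : C !=set0).

(** Half the squared distance to [u] is 1-strongly convex, and its growth at the
    minimizer is the obtuse angle inequality. *)
Lemma eproj_spec u : C (eproj C u) /\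
  forall c, C c -> edot (u - eproj C u) (c - eproj C u) <= 0.
Proof.
pose phi (x : 'rV[R]_n) : R := 2^-1 * edot (u - x) (u - x).
have Hs : strongly_supported C phi 1.
  move=> x Cx; exists (x - u) => x' Cx'; rewrite /phi !edotE.
  rewrite (edotC x' x) (edotC u x) (edotC u x'); lra.
have [xs Cxs mn] := argmin_exists clC cvC C0 ltr01 Hs.
have near_xs c : C c -> edot (u - xs) (u - xs) <= edot (u - c) (u - c).
  by move=> /mn; rewrite /phi; have := edot_ge0 (c - xs); lra.
have -> : eproj C u = xs.
  apply: xget_unique => [|v [Cv Hv]].
    by split=> // c Cc; rewrite ler_enorm near_xs.
  have := Hv _ Cxs; rewrite ler_enorm => h.
  have := mn _ Cv; rewrite /phi; have := edot_ge0 (v - xs) => h1 h2.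
  by apply/subr0_eq/edot_eq0; lra.
split=> // c /mn; rewrite /phi => h.
move: h; rewrite !edotE (edotC c u) (edotC c xs) (edotC u xs); lra.
Qed.

Lemma eproj_in u : C (eproj C u).
Proof. by case: (eproj_spec u). Qed.

Lemma eproj_var u c : C c -> edot (u - eproj C u) (c - eproj C u) <= 0.
Proof. by case: (eproj_spec u) => _; apply. Qed.

Lemma eproj_normal u : normal_cone C (eproj C u) (u - eproj C u).
Proof. by move=> c Cc; apply: eproj_var. Qed.

Lemma eproj_contraction u v :
  edot (eproj C u - eproj C v) (eproj C u - eproj C v) <= edot (u - v) (u - v).
Proof.
have h1 := eproj_var u (eproj_in v); have h2 := eproj_var v (eproj_in u).
have h3 := edot_ge0 ((u - v) - (eproj C u - eproj C v)).
move: h1 h2 h3; set a := eproj C u; set b := eproj C v.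
rewrite !edotE (edotC v u) (edotC a u) (edotC b u) (edotC a v) (edotC b v) (edotC b a).
lra.
Qed.

Lemma eproj_dist u c : C c ->
  edot (eproj C u - c) (eproj C u - c) <= edot (u - c) (u - c).
Proof.
move=> Cc; have h1 := eproj_var u Cc; have h2 := edot_ge0 (u - eproj C u).
move: h1 h2; set a := eproj C u.
rewrite !edotE (edotC c u) (edotC a u) (edotC c a); lra.
Qed.

End Projection.

(** * Saddle points of the regularized game *)

Section Saddle.
Context {R : realType} {n p : nat}.
Variables (X : set 'rV[R]_n) (Y : set 'rV[R]_p).
Variables (F : 'rV[R]_n -> 'rV[R]_p -> R).
Variables (gx : 'rV[R]_n -> 'rV[R]_p -> 'rV[R]_n).
Variables (gy : 'rV[R]_n -> 'rV[R]_p -> 'rV[R]_p) (L : R).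

(** The properties of the objective on [X * Y] that the analysis of the method
    uses; [game_weak] is the quadratic lower bound that an
    [L]-Lipschitz gradient provides. *)
Record smooth_game : Prop := {
  game_X_nonempty : X !=set0;
  game_X_closed : closed X;
  game_X_convex : segment_closed X;
  game_Y_nonempty : Y !=set0;
  game_Y_closed : closed Y;
  game_Y_convex : segment_closed Y;
  game_L_gt0 : 0 < L;
  game_weak : forall x x' y, X x -> X x' -> Y y ->
    F x y + edot (gx x y) (x' - x) - L / 2 * edot (x' - x) (x' - x) <= F x' y;
  game_concave : forall x y y', X x -> Y y -> Y y' ->
    F x y' <= F x y + edot (gy x y) (y' - y);
  game_lip : forall x y x' y', X x -> Y y -> X x' -> Y y' ->
    edot (gx x y - gx x' y') (gx x y - gx x' y') +
    edot (gy x y - gy x' y') (gy x y - gy x' y') <=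
    L ^+ 2 * (edot (x - x') (x - x') + edot (y - y') (y - y')) }.

Variable tau : R.

(** The proximal term turns weak convexity in [x] into strong convexity of
    modulus [L]; the term in [tau] makes the game strongly concave in [y]. *)
Definition reg z x y := F x y + L * edot (x - z) (x - z) - tau / 2 * edot y y.
Definition regx z x y := gx x y + (2 * L) *: (x - z).
Definition regy x y := gy x y - tau *: y.

(** The two quadratic terms are the growth that strong convexity and strong
    concavity give at a saddle point. *)
Definition is_saddle z (w : 'rV[R]_n * 'rV[R]_p) := [/\ X w.1, Y w.2,
  forall x, X x ->
    reg z w.1 w.2 + L / 2 * edot (x - w.1) (x - w.1) <= reg z x w.2 &
  forall y, Y y ->
    reg z w.1 y + tau / 2 * edot (y - w.2) (y - w.2) <= reg z w.1 w.2].

Hypotheses (game : smooth_game) (tau0 : 0 < tau).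
Let L0 : 0 < L := game_L_gt0 game.

Lemma reg_strong_x z x x' y : X x -> X x' -> Y y ->
  reg z x y + edot (regx z x y) (x' - x) + L / 2 * edot (x' - x) (x' - x)
    <= reg z x' y.
Proof.
move=> Xx Xx' Yy; have := game_weak game Xx Xx' Yy; rewrite /reg /regx.
rewrite [edot (gx x y + _) _]edotDl; set q := edot (gx x y) _.
rewrite !edotE (edotC x' x) (edotC z x) (edotC z x'); lra.
Qed.

Lemma reg_strong_y z x y y' : X x -> Y y -> Y y' ->
  reg z x y' + tau / 2 * edot (y' - y) (y' - y)
    <= reg z x y + edot (regy x y) (y' - y).
Proof.
move=> Xx Yy Yy'; have := game_concave game Xx Yy Yy'; rewrite /reg /regy.
rewrite [edot (gy x y - _) _]edotDl; set q := edot (gy x y) _.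
rewrite !edotE (edotC y' y); lra.
Qed.

(** Take the maximizer [ys] of the marginal [y |-> min_x reg z x y] and the best
    response [xs] to it. If some [y] improved on [ys] against [xs] by [e], moving
    [ys] by a fraction [t] towards [y] would gain about [t * e] in the marginal,
    up to an effect of the displacement of the best response, whose square is of
    order [t]; this contradicts maximality for small [t]. *)
Lemma saddle_exists z : exists w, is_saddle z w.
Proof.
have Kx y : Y y -> strongly_supported X (fun x => reg z x y) L.
  move=> Yy x Xx; exists (regx z x y) => x' Xx'; exact: reg_strong_x.
have Ky x : X x -> strongly_supported Y (fun y => - reg z x y) tau.
  move=> Xx y Yy; exists (- regy x y) => y' Yy'.
  by rewrite edotNl; have := reg_strong_y z Xx Yy Yy'; lra.
have [x0 Xx0] := game_X_nonempty game.
have best_response y : exists b, Y y -> X b /\ forall x, X x ->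
    reg z b y + L / 2 * edot (x - b) (x - b) <= reg z x y.
  have [Yy|nYy] := pselect (Y y); last by exists x0.
  have [b Xb Hb] := argmin_exists (game_X_closed game) (game_X_convex game)
    (game_X_nonempty game) L0 (Kx _ Yy).
  by exists b.
have [best Hb] := choice best_response.
have Xb y : Y y -> X (best y) by case/Hb.
have bmin y x : Y y -> X x -> reg z (best y) y <= reg z x y.
  move=> Yy Xx; have [_ /(_ _ Xx)] := Hb _ Yy; apply: le_trans.
  by rewrite lerDl mulr_ge0 ?edot_ge0 // divr_ge0 // ltW.
have psi_s : strongly_supported Y (fun y => - reg z (best y) y) tau.
  move=> y Yy; exists (- regy (best y) y) => y' Yy'.
  rewrite edotNl; have := reg_strong_y z (Xb _ Yy) Yy Yy'.
  have := bmin _ _ Yy' (Xb _ Yy); lra.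
have [ys Yys Hys] := argmin_exists (game_Y_closed game) (game_Y_convex game)
    (game_Y_nonempty game) tau0 psi_s.
have Xxs := Xb _ Yys; set xs := best ys in Xxs.
have psi_max y : Y y -> reg z (best y) y <= reg z xs ys.
  move=> Yy; have := Hys _ Yy; rewrite -/xs.
  have : 0 <= tau / 2 * edot (y - ys) (y - ys).
    by rewrite mulr_ge0 ?edot_ge0 // divr_ge0 // ltW.
  lra.
suff sad y : Y y -> reg z xs y <= reg z xs ys.
  exists (xs, ys); split => //=; first by case: (Hb _ Yys).
  move=> y Yy; have mn y' : Y y' -> - reg z xs ys <= - reg z xs y'.
    by move=> /sad; rewrite lerN2.
  have := growth_at_min (game_Y_convex game) (Ky _ Xxs) (ltW tau0) Yys mn Yy.
  lra.
move=> Yy; rewrite leNgt; apply/negP => lt.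
set P := reg z xs ys in lt psi_max *.
set g := regx z xs y.
pose M := P - reg z (best y) y.
have M0 : 0 <= M by rewrite subr_ge0 psi_max.
pose e := reg z xs y - P.
have e0 : 0 < e by rewrite subr_gt0.
pose yt t := ys + t *: (y - ys).
have Yt t : 0 < t -> t <= 2^-1 -> Y (yt t).
  move=> t0 t1; apply: (game_Y_convex game) => //; apply/andP; split; lra.
have key t : 0 < t -> t <= 2^-1 -> e ^+ 2 <= edot g g * (4 * t * M / L).
  move=> t0 t1; have Yyt := Yt _ t0 t1; have Xbt := Xb _ Yyt.
  set d := edot (best (yt t) - xs) (best (yt t) - xs).
  have d0 : 0 <= d by exact: edot_ge0.
  have h1 : P + L / 2 * d <= reg z (best (yt t)) ys by case: (Hb _ Yys) => _; apply.
  have tt : 0 <= t <= 1 by apply/andP; split; lra.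
  have h2 : t * reg z (best (yt t)) y + (1 - t) * reg z (best (yt t)) ys <= P.
    have := strongly_supported_segment (game_Y_convex game) (Ky _ Xbt) Yy Yys tt.
    have := psi_max _ Yyt; rewrite /yt.
    have : 0 <= tau / 2 * (t * (1 - t)) * edot (y - ys) (y - ys).
      rewrite mulr_ge0 ?edot_ge0 // mulr_ge0 ?divr_ge0 ?(ltW tau0) //.
      by rewrite mulr_ge0 ?subr_ge0; lra.
    lra.
  have h3 : reg z xs y + edot g (best (yt t) - xs) <= reg z (best (yt t)) y.
    have := reg_strong_x z Xxs Xbt Yy; rewrite -/g -/d.
    have : 0 <= L / 2 * d by rewrite mulr_ge0 // divr_ge0 // ltW.
    lra.
  have h4 : reg z (best y) y <= reg z (best (yt t)) y by exact: bmin.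
  have h5 : d <= 4 * t * M / L.
    rewrite ler_pdivlMr // /M.
    have a1 := ler_wpM2l (_ : 0 <= 1 - t) h1.
    have a2 := ler_wpM2l (ltW t0) h4.
    have a3 : 0 <= (2^-1 - t) * (L * d).
      by rewrite mulr_ge0 ?subr_ge0 // mulr_ge0 // ltW.
    have {}a1 := a1 ltac:(lra).
    by clear -a1 a2 a3 h2; lra.
  have h6 : e <= - edot g (best (yt t) - xs).
    rewrite /e; have : 0 <= L / 2 * d by rewrite mulr_ge0 // divr_ge0 // ltW.
    nra.
  have h7 := edot_CS g (- (best (yt t) - xs)).
  rewrite edotNr in h7; have h8 := le_trans h6 h7.
  have : e ^+ 2 <= (enorm g * enorm (- (best (yt t) - xs))) ^+ 2.
    by rewrite ler_sqr ?nnegrE ?(ltW e0) // mulr_ge0 ?enorm_ge0.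
  move/le_trans; apply.
  rewrite exprMn !enorm_sqr; apply: ler_wpM2l; first exact: edot_ge0.
  by rewrite edotNl edotNr opprK.
pose c := edot g g * (4 * M / L).
have c0 : 0 <= c.
  by rewrite mulr_ge0 ?edot_ge0 // divr_ge0 ?mulr_ge0 ?(ltW L0).
pose t := Num.min 2^-1 (e ^+ 2 / (2 * (c + 1))).
have e2 : 0 < e ^+ 2 by rewrite exprn_gt0.
have c1 : 0 < 2 * (c + 1) by lra.
have t0 : 0 < t by rewrite lt_min invr_gt0 ltr0n divr_gt0.
have t1 : t <= 2^-1 by rewrite ge_min lexx.
have t2 : t * (2 * (c + 1)) <= e ^+ 2 by rewrite -ler_pdivlMr // ge_min lexx orbT.
have := key _ t0 t1.
have -> : edot g g * (4 * t * M / L) = t * c by rewrite /c; field; rewrite gt_eqF.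
nra.
Qed.

(** In the sum of the four growth inequalities of the two saddle points, the
    primal distances complete a square, and only the centres and the dual
    distance remain. *)
Lemma saddle_lipschitz z z' w w' : is_saddle z w -> is_saddle z' w' ->
  tau * edot (w.2 - w'.2) (w.2 - w'.2) <= L * edot (z - z') (z - z').
Proof.
move=> [Xw Yw hx hy] [Xw' Yw' hx' hy'].
have := hx _ Xw'; have := hy _ Yw'; have := hx' _ Xw; have := hy' _ Yw.
have := edot_ge0 ((w.1 - w'.1) - (z - z')).
rewrite /reg.
have -> : edot (w'.1 - w.1) (w'.1 - w.1) = edot (w.1 - w'.1) (w.1 - w'.1).
  by rewrite -[w'.1 - _]opprB edotNl edotNr opprK.
have -> : edot (w'.2 - w.2) (w'.2 - w.2) = edot (w.2 - w'.2) (w.2 - w'.2).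
  by rewrite -[w'.2 - _]opprB edotNl edotNr opprK.
set q := edot (w.2 - w'.2) _.
rewrite !edotE (edotC w'.1 w.1) (edotC z w.1) (edotC z w'.1) (edotC z' w.1)
  (edotC z' w'.1) (edotC z' z).
move=> h0 h1 h2 h3 h4.
have := mulr_ge0 (ltW L0) h0; lra.
Qed.

(** Both values are compared with the value at the crossed pair [(w.1, w'.2)]. *)
Lemma saddle_value_ub z z' w w' : is_saddle z w -> is_saddle z' w' ->
  reg z' w'.1 w'.2 <= reg z w.1 w.2
    + L * (edot (w.1 - z') (w.1 - z') - edot (w.1 - z) (w.1 - z)).
Proof.
move=> [Xw Yw hx hy] [Xw' Yw' hx' hy'].
have := hy _ Yw'; have := hx' _ Xw; rewrite /reg.
have : 0 <= L / 2 * edot (w.1 - w'.1) (w.1 - w'.1).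
  by rewrite mulr_ge0 ?edot_ge0 // divr_ge0 // ltW.
have : 0 <= tau / 2 * edot (w'.2 - w.2) (w'.2 - w.2).
  by rewrite mulr_ge0 ?edot_ge0 // divr_ge0 // ltW.
lra.
Qed.

(** Weak convexity costs [L] in the primal part, and concavity makes the dual
    part monotone. *)
Lemma game_monotone x y x' y' : X x -> Y y -> X x' -> Y y' ->
  - L * edot (x' - x) (x' - x) <=
  edot (gx x' y' - gx x y) (x' - x) - edot (gy x' y' - gy x y) (y' - y).
Proof.
move=> Xx Yy Xx' Yy'.
have := game_weak game Xx Xx' Yy; have := game_weak game Xx' Xx Yy'.
have := game_concave game Xx Yy Yy'; have := game_concave game Xx' Yy' Yy.
rewrite -(opprB x' x) -(opprB y' y) !edotNr !edotNl opprK.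
rewrite [edot (gx x' y' - _) _]edotDl [edot (gy x' y' - _) _]edotDl !edotNl; lra.
Qed.

End Saddle.

(** * Smooth concave objectives are smooth games *)

Section Calculus.
Context {R : realType} {n p : nat}.
Local Notation E := ('rV[R]_n * 'rV[R]_p)%type.
Implicit Types (F : E -> R) (z v : E).

Lemma derive_grad F z v : differentiable F z ->
  'D_v F z = edot (grad F z).1 v.1 + edot (grad F z).2 v.2.
Proof.
move=> dF; rewrite deriveE //.
have ev : v = \sum_i v.1 0 i *: ((delta_mx 0 i, 0) : E)
            + \sum_j v.2 0 j *: ((0, delta_mx 0 j) : E).
  case: v => a b /=; apply/pair_equal_spec; split.
    rewrite /= [LHS]row_sum_delta.
    rewrite (raddf_sum (@fst _ _)) (raddf_sum (@fst _ _)) /=.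
    by rewrite [X in _ + X]big1 ?addr0 // => j _; rewrite scaler0.
  rewrite /= [LHS]row_sum_delta.
  rewrite (raddf_sum (@snd _ _)) (raddf_sum (@snd _ _)) /=.
  by rewrite [X in X + _]big1 ?add0r // => j _; rewrite scaler0.
rewrite [in LHS]ev linearD !linear_sum /= /edot.
by congr (_ + _); apply: eq_bigr => i _;
  rewrite linearZ /= mxE deriveE // mulrC.
Qed.

Lemma is_derive_line F z v (t : R) : differentiable F (z + t *: v) ->
  is_derive t (1 : R) (fun s : R => F (z + s *: v)) ('D_v F (z + t *: v)).
Proof.
move=> dF.
have d1 : is_diff t (fun s : R => z + s *: v) (fun s : R => s *: v).
  have := is_diffD (is_diff_cst z t) (is_diff_scalel t v).
  by rewrite add0r.
have dF' : is_diff (z + t *: v) F ('d F (z + t *: v)) by exact: DiffDef.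
have dc := is_diff_comp d1 dF'.
have dd : differentiable (F \o (fun s : R => z + s *: v)) t by case: dc.
apply: DeriveDef; first exact: diff_derivable.
by rewrite deriveE // diff_val /= scale1r deriveE.
Qed.

(** The correction [a * s ^+ 2] yields the sharp constant [L / 2] in [game_weak],
    where the mean value theorem for [F] alone would give [L]. *)
Lemma segment_MVT F z v (a t : R) : 0 < t ->
  (forall s, 0 <= s <= t -> differentiable F (z + s *: v)) ->
  exists2 c, 0 < c < t &
    F (z + t *: v) - F z + a * t ^+ 2 = ('D_v F (z + c *: v) + 2 * a * c) * t.
Proof.
move=> t0 dF.
pose phi (s : R) : R := F (z + s *: v) + a * s ^+ 2.
have dphi s : 0 <= s <= t -> is_derive s (1 : R) phi ('D_v F (z + s *: v) + 2 * a * s).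
  move=> /dF /is_derive_line h.
  have h2 : is_derive s (1 : R) (fun s : R => a * s ^+ 2) (2 * a * s).
    apply: is_derive_eq.
    by rewrite /= /GRing.scale /=; ring.
  exact: is_deriveD h h2.
have [] := @MVT R phi (fun s => 'D_v F (z + s *: v) + 2 * a * s) 0 t t0.
- by move=> s; rewrite in_itv /= => /andP[s0 st]; apply: dphi; rewrite !ltW.
- apply: derivable_within_continuous => s; rewrite in_itv /= => /dphi.
  by case.
move=> c; rewrite in_itv /= => c0t.
rewrite /phi scale0r addr0 subr0 expr0n mulr0 addr0 => h.
by exists c => //; rewrite -h; ring.
Qed.

End Calculus.

Section Game.
Context {R : realType} {n p : nat}.
Local Notation E := ('rV[R]_n * 'rV[R]_p)%type.
Context {dW : measure_display} {W : measurableType dW}.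
Variables (X : set 'rV[R]_n) (Y : set 'rV[R]_p).
Variables (D : probability W R) (f : E -> W -> R) (L : R).
Hypothesis SA : standing_assumptions X Y D f L.
Local Notation F := (meanF D f).
Local Notation g := (grad (meanF D f)).

Lemma convex_segment m (C : set 'rV[R]_m) :
  convex_set (C : set (convex_lmodType 'rV[R]_m)) -> segment_closed C.
Proof.
move=> cvC x y t Cx Cy /andP[t0 t1].
have /set_mem := cvC x y (Itv01 t0 t1) (mem_set Cx) (mem_set Cy).
rewrite /conv /= /unstable.onem scalerBl scale1r.
by rewrite addrCA -scalerBr.
Qed.

Lemma meanF_differentiable z : (X `*` Y) z -> differentiable F z.
Proof. by have [U [_ XYU HU]] := F_C1 SA; move=> /XYU /HU []. Qed.

Lemma grad_lip_edot z z' : (X `*` Y) z -> (X `*` Y) z' ->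
  edot ((g z).1 - (g z').1) ((g z).1 - (g z').1) +
  edot ((g z).2 - (g z').2) ((g z).2 - (g z').2) <=
  L ^+ 2 * (edot (z.1 - z'.1) (z.1 - z'.1) + edot (z.2 - z'.2) (z.2 - z'.2)).
Proof.
move=> XYz XYz'; have := gradF_Lipschitz SA XYz XYz'.
have L0 := L_gt0 SA.
rewrite -ler_sqr ?nnegrE; first by rewrite exprMn !enorm2_sqr.
  exact: sqrtr_ge0.
by rewrite mulr_ge0 ?(ltW L0) // sqrtr_ge0.
Qed.

Lemma grad_lip_x x x' y u : X x -> X x' -> Y y ->
  `|edot ((g (x', y)).1 - (g (x, y)).1) u| <= L * enorm (x' - x) * enorm u.
Proof.
move=> Xx Xx' Yy; have L0 := L_gt0 SA.
have := @grad_lip_edot (x', y) (x, y) (conj Xx' Yy) (conj Xx Yy) => /=.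
rewrite (subrr y) edot0l addr0 => h.
have h1 : enorm ((g (x', y)).1 - (g (x, y)).1) <= L * enorm (x' - x).
  rewrite -ler_sqr ?nnegrE ?enorm_ge0 ?mulr_ge0 ?enorm_ge0 ?(ltW L0) //.
  rewrite exprMn !enorm_sqr; apply: le_trans h; rewrite lerDl; exact: edot_ge0.
have h2 v : edot ((g (x', y)).1 - (g (x, y)).1) v <= L * enorm (x' - x) * enorm v.
  by apply: le_trans (edot_CS _ _) _; rewrite ler_wpM2r ?enorm_ge0.
rewrite ler_norml h2 andbT lerNl -edotNr; apply: le_trans (h2 _) _.
by rewrite /enorm edotNl edotNr opprK.
Qed.

Lemma grad_lip_y x y y' u : X x -> Y y -> Y y' ->
  `|edot ((g (x, y')).2 - (g (x, y)).2) u| <= L * enorm (y' - y) * enorm u.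
Proof.
move=> Xx Yy Yy'; have L0 := L_gt0 SA.
have := @grad_lip_edot (x, y') (x, y) (conj Xx Yy') (conj Xx Yy) => /=.
rewrite (subrr x) edot0l add0r => h.
have h1 : enorm ((g (x, y')).2 - (g (x, y)).2) <= L * enorm (y' - y).
  rewrite -ler_sqr ?nnegrE ?enorm_ge0 ?mulr_ge0 ?enorm_ge0 ?(ltW L0) //.
  rewrite exprMn !enorm_sqr; apply: le_trans h; rewrite lerDr; exact: edot_ge0.
have h2 v : edot ((g (x, y')).2 - (g (x, y)).2) v <= L * enorm (y' - y) * enorm v.
  by apply: le_trans (edot_CS _ _) _; rewrite ler_wpM2r ?enorm_ge0.
rewrite ler_norml h2 andbT lerNl -edotNr; apply: le_trans (h2 _) _.
by rewrite /enorm edotNl edotNr opprK.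
Qed.

Lemma enormZ m (c : R) (u : 'rV[R]_m) : 0 <= c -> enorm (c *: u) = c * enorm u.
Proof.
move=> c0; rewrite /enorm edotZl edotZr mulrA -expr2 sqrtrM ?sqr_ge0 //.
by rewrite sqrtr_sqr ger0_norm.
Qed.

(** Mean value theorem along segments, the Lipschitz bound controlling the
    gradient at the intermediate point. For the concave part, concavity allows to
    shorten the segment by a factor [t], and the error of order [t] vanishes in
    the limit. *)
Lemma meanF_smooth_game :
  smooth_game X Y (fun x y => F (x, y)) (fun x y => (g (x, y)).1)
    (fun x y => (g (x, y)).2) L.
Proof.
have L0 := L_gt0 SA.
have sX := convex_segment (X_convex SA).
have sY := convex_segment (Y_convex SA).
split => //.
- exact: X_nonempty SA.
- exact: X_closed SA.
- exact: Y_nonempty SA.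
- exact: compact_closed (@norm_hausdorff _ _) (Y_compact SA).
- move=> x x' y Xx Xx' Yy.
  pose v : E := (x' - x, 0).
  have Xs s : 0 <= s <= 1 -> X (x + s *: (x' - x)) by exact: sX.
  have Es s : (x, y) + s *: v = (x + s *: (x' - x), y).
    by apply/pair_equal_spec; split; rewrite //= scaler0 addr0.
  have [|c /andP[c0 c1]] := @segment_MVT R n p F (x, y) v (L / 2 * edot (x' - x) (x' - x)) 1 ltr01.
    by move=> s s01; apply: meanF_differentiable; rewrite Es; split => //; apply: Xs.
  have Xc : X (x + c *: (x' - x)) by apply: Xs; rewrite !ltW.
  rewrite !Es derive_grad; last by apply: meanF_differentiable.
  rewrite scale1r (addrC x) subrK expr1n !mulr1 /= edot0r addr0 => h.
  have := @grad_lip_x x (x + c *: (x' - x)) y (x' - x) Xx Xc Yy.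
  have -> : x + c *: (x' - x) - x = c *: (x' - x) by rewrite addrAC subrr add0r.
  rewrite (enormZ _ (ltW c0)) ler_norml => /andP[+ _].
  rewrite edotDl edotNl.
  have -> : L * (c * enorm (x' - x)) * enorm (x' - x) = L * c * edot (x' - x) (x' - x).
    by rewrite -enorm_sqr; ring.
  move: h; set q := edot (x' - x) _; set d1 := edot _ (x' - x); set d0 := edot _ (x' - x).
  lra.
- move=> x y y' Xx Yy Yy'.
  pose v : E := (0, y' - y).
  have Ys s : 0 <= s <= 1 -> Y (y + s *: (y' - y)) by exact: sY.
  have Es s : (x, y) + s *: v = (x, y + s *: (y' - y)).
    by apply/pair_equal_spec; split; rewrite //= scaler0 addr0.
  set q := edot (y' - y) (y' - y).
  have q0 : 0 <= q by exact: edot_ge0.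
  suff H t : 0 < t -> t <= 1 ->
      F (x, y') - F (x, y) - edot (g (x, y)).2 (y' - y) <= L * q * t.
    rewrite -subr_le0 opprD addrA leNgt; apply/negP => lt.
    set e := (X in 0 < X) in lt.
    have Lq : 0 <= L * q by rewrite mulr_ge0 // ltW.
    pose t := Num.min 1 (e / (L * q + 1) / 2).
    have c0 : 0 < L * q + 1 by lra.
    have t0 : 0 < t by rewrite lt_min ltr01 !divr_gt0.
    have t1 : t <= 1 by rewrite ge_min lexx.
    have t2 : t * (L * q + 1) * 2 <= e.
      by rewrite -ler_pdivlMr // -ler_pdivlMr // mulrAC ge_min lexx orbT.
    have := H t t0 t1; rewrite -/e; nra.
  move=> t0 t1.
  have [|c /andP[c0 ct]] := @segment_MVT R n p F (x, y) v 0 t t0.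
    move=> s /andP[s0 s1]; apply: meanF_differentiable; rewrite Es; split => //.
    by apply: Ys; rewrite s0 (le_trans s1).
  have Yc : Y (y + c *: (y' - y)) by apply: Ys; rewrite ltW //= ltW // (lt_le_trans ct).
  rewrite !Es derive_grad; last by apply: meanF_differentiable.
  rewrite mul0r addr0 mulr0 mul0r addr0 /= edot0r add0r => h.
  have := @grad_lip_y x y (y + c *: (y' - y)) (y' - y) Xx Yy Yc.
  have -> : y + c *: (y' - y) - y = c *: (y' - y) by rewrite addrAC subrr add0r.
  rewrite (enormZ _ (ltW c0)) ler_norml => /andP[_].
  rewrite edotDl edotNl.
  have -> : L * (c * enorm (y' - y)) * enorm (y' - y) = L * c * q.
    by rewrite /q -enorm_sqr; ring.
  move=> h2.
  have h3 : t * (F (x, y') - F (x, y)) <= F (x, y + t *: (y' - y)) - F (x, y).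
    have tI : 0 <= t <= 1 by rewrite ltW.
    have := F_concave SA Xx (Itv01 (ltW t0) t1) (mem_set Yy') (mem_set Yy).
    rewrite /conv /= /unstable.onem.
    have -> : t *: y' + (1 - t) *: y = y + t *: (y' - y).
      by rewrite scalerBl scale1r addrCA -scalerBr.
    move=> h3; have {}h3 : - F (x, y + t *: (y' - y)) <= t * - F (x, y') + (1 - t) * - F (x, y) := h3.
    lra.
  rewrite h in h3.
  have h4 : F (x, y') - F (x, y) <= edot (g (x, y + c *: (y' - y))).2 (y' - y).
    by rewrite -(ler_pM2l t0) (le_trans h3) // mulrC.
  have : L * c * q <= L * q * t.
    by rewrite mulrAC ler_wpM2l ?mulr_ge0 ?(ltW ct) // ltW.
  lra.
move=> x y x' y' Xx Yy Xx' Yy'; exact: (@grad_lip_edot (x,y) (x',y')).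
Qed.

End Game.

(** * The inequality behind the decrease of the potential *)

Section Core.
Context {R : realType}.

Lemma dot_young n (s t : R) (u v : 'rV[R]_n) : 0 < s -> 1 <= 4 * s * t ->
  edot u v <= s * edot u u + t * edot v v.
Proof.
move=> s0 st.
have := edot_ge0 ((2 * s) *: u - v); rewrite !edotE (edotC v u) => h.
have hv := mulr_ge0 (_ : 0 <= 4 * s * t - 1) (edot_ge0 v).
have {}hv := hv ltac:(lra).
rewrite -(ler_pM2l (_ : 0 < 4 * s)); last by lra.
move: h hv; set a := edot u v; set b := edot u u; set c := edot v v; lra.
Qed.

Lemma dot_youngN n (s t : R) (u v : 'rV[R]_n) : 0 < s -> 1 <= 4 * s * t ->
  - edot u v <= s * edot u u + t * edot v v.
Proof.
move=> s0 st; have := dot_young (- u) v s0 st.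
by rewrite !edotNl edotNr opprK.
Qed.

Lemma norm_sqD2 n (u v : 'rV[R]_n) :
  edot (u + v) (u + v) <= 2 * (edot u u + edot v v).
Proof. by have := edot_ge0 (u - v); rewrite !edotE (edotC v u); lra. Qed.

Lemma norm_sqB2 n (u v : 'rV[R]_n) :
  edot (u - v) (u - v) <= 2 * (edot u u + edot v v).
Proof. by have := edot_ge0 (u + v); rewrite !edotE (edotC v u); lra. Qed.

Lemma norm_sqB n (u v : 'rV[R]_n) :
  edot (u - v) (u - v) = edot u u - 2 * edot u v + edot v v.
Proof. by rewrite !edotE (edotC v u); lra. Qed.

Lemma norm_sqD n (u v : 'rV[R]_n) :
  edot (u + v) (u + v) = edot u u + 2 * edot u v + edot v v.
Proof. by rewrite !edotE (edotC v u); lra. Qed.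

(** One iteration in scaled variables. [X] and [Y] are the displacements of the
    corrector divided by the step size [h]; [Dx], [Dy] and [ex], [e] are their
    differences to the velocities before and after the iteration, the latter
    being the defects of the scheme with respect to an implicit step; [G] is the
    new dual force, [pp] the new momentum before the last noise [N] and the motion
    [zeta] of the saddle point enter; [r], [c] and [q] are scaled vectors to the
    corrected point from the centre and from the saddle point; [pi] and [kappa] are
    [L] times the increases of the saddle value and of the saddle function. Also [a = h * L],
    [g = h * gamma] and [b = beta].

    The kinetic energies lose half the squares of [Dx] and [Dy], and also [a |X|^2]
    by strong monotonicity and [g |Y|^2] by friction; the momentum loses
    [a / 4 * |G|^2], which the velocities alone do not provide since the game is
    nearly flat in the dual variable. These losses pay for every cross term by
    Young's inequality. *)
Lemma lyapunov_core n p (X Dx ex c r : 'rV[R]_n)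
    (Y Dy e G N q zeta pp : 'rV[R]_p) (a g b k kappa pi n0 n1 : R) :
  0 < a -> a <= 192^-1 -> 0 < g -> g <= a / 10 -> b = g / 256 ->
  0 <= k -> k <= a / 2 -> k * (1 + g) = a / 2 - g ->
  0 <= n0 -> 0 <= n1 ->
  (* strong monotonicity; the dual part is the increment of the force *)
  edot X (Dx - ex) + edot Y (Dy - e + k *: N
     - (- g *: (Y - e + k *: N) + (a / 2) *: G + (a / 2 - g) *: N))
    <= - a * edot X X ->
  a * (edot G Y - edot (X - Dx) X) <= kappa ->
  a * edot G q <=
    g * (edot (X - ex) (X - ex) / 2 - edot c c / 2 - 64 * edot q q) ->
  pi <= 2 * b * edot (c - r) r + b ^+ 2 * edot r r ->
  edot zeta zeta <= b ^+ 2 / 128 * edot r r ->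
  edot ex ex + edot e e <=
    (edot Dx Dx + edot Dy Dy) / 1000 + n0 / 1000 + 3 * n1 ->
  pp = Y - e - G + q ->
  pi + edot (X - ex - (2 * b) *: r) (X - ex - (2 * b) *: r) / 2
     - edot (X - Dx) (X - Dx) / 2
     + edot (Y - e + k *: N) (Y - e + k *: N) / 2 - edot (Y - Dy) (Y - Dy) / 2
     + 3 / 4 * (pi - kappa + (2 * b - b ^+ 2) * edot r r)
     + edot (pp + k *: N - zeta) (pp + k *: N - zeta) / 4
     - edot (pp - g *: e - (a / 2) *: G) (pp - g *: e - (a / 2) *: G) / 4
  <= - (b / 64) * (edot (X - ex - 2 *: r) (X - ex - 2 *: r) + 2 * edot G G)
     + 10 * (n0 + n1 + edot N N) + edot N (k *: Y + (k / 2) *: pp).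
Proof.
move=> a0 a1 g0 g1 bE k0 k1 kE n00 n10 F1 F2 F3 F4 F6 F5 ppE.
have b0 : 0 < b by rewrite bE; clear -g0; lra.
set Ap := X - ex in F3 *.
have hAp : edot Ap Ap <= 2 * (edot X X + edot ex ex) by exact: norm_sqB2.
have hpp : edot pp pp <= 4 * (edot Y Y + edot e e + edot G G + edot q q).
  have h1 := norm_sqD2 (Y - e - G) q; have h2 := norm_sqB2 (Y - e) G.
  have h3 := norm_sqB2 Y e; rewrite -ppE in h1.
  have h4 := norm_sqD2 (Y - e) (q - G); have h5 := norm_sqB2 q G.
  have e1 : (Y - e) + (q - G) = pp by rewrite ppE addrA addrAC.
  by rewrite e1 in h4; clear -h3 h4 h5; lra.
have hres : edot (Ap - 2 *: r) (Ap - 2 *: r) <= 2 * edot Ap Ap + 8 * edot r r.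
  by clear; have := norm_sqB2 Ap (2 *: r); rewrite edotZl edotZr; lra.
have I1 : edot Ap Ap / 2 - edot (X - Dx) (X - Dx) / 2
   = edot X (Dx - ex) - edot Dx Dx / 2 + edot ex ex / 2.
  by clear; rewrite /Ap !norm_sqB edotDr edotNr; lra.
have I2 : edot (Y - e + k *: N) (Y - e + k *: N) / 2 - edot (Y - Dy) (Y - Dy) / 2
   = edot Y (Dy - e + k *: N) - edot Dy Dy / 2 + edot (e - k *: N) (e - k *: N) / 2.
  clear; rewrite (_ : Y - e + k *: N = Y - (e - k *: N)); last by rewrite opprB addrA addrAC.
  rewrite !norm_sqB !edotDr !edotNr; lra.
have I3 : edot (e - k *: N) (e - k *: N) = edot e e - 2 * k * edot e N + k ^+ 2 * edot N N.
  by clear; rewrite norm_sqB !edotZr edotZl; lra.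
have I4 : edot (Ap - (2 * b) *: r) (Ap - (2 * b) *: r)
  = edot Ap Ap - 4 * b * edot Ap r + 4 * b ^+ 2 * edot r r.
  by clear; rewrite norm_sqB !edotZr edotZl; lra.
have I5 : edot (pp + k *: N - zeta) (pp + k *: N - zeta) =
   edot pp pp + 2 * k * edot N pp + k ^+ 2 * edot N N - 2 * edot pp zeta
   - 2 * k * edot N zeta + edot zeta zeta.
  by clear; rewrite norm_sqB norm_sqD edotDl !edotZr !edotZl (edotC pp N); lra.
have I6 : edot (pp - g *: e - (a / 2) *: G) (pp - g *: e - (a / 2) *: G) =
   edot pp pp - 2 * g * edot pp e - a * edot pp G
   + edot (g *: e + (a / 2) *: G) (g *: e + (a / 2) *: G).
  by clear; rewrite -addrA -opprD norm_sqB edotDr !edotZr; lra.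
have I7 := edot_ge0 (g *: e + (a / 2) *: G).
have I8 : edot pp G = edot G Y - edot e G - edot G G + edot G q.
  by clear -ppE; rewrite ppE !edotDl !edotNl (edotC q G) (edotC Y G).
have I9 : edot N (k *: Y + (k / 2) *: pp) = k * edot Y N + k / 2 * edot N pp.
  by rewrite edotDr !edotZr (edotC N Y).
move: F1; rewrite [edot Y (_ - (_ + _))]edotDr edotNr.
have -> : edot Y (- g *: (Y - e + k *: N) + (a / 2) *: G + (a / 2 - g) *: N)
  = - g * edot Y Y + g * edot Y e + a / 2 * edot G Y + k * edot Y N.
  by rewrite !edotDr !edotZr !edotDr edotNr edotZr (edotC Y G) -kE; clear; lra.
move=> F1.
(* Young's inequality on the cross terms; the weights keep the total coefficient of
   each square below its dissipation *)
have Y1 : - (a * edot Dx X) <= edot Dx Dx / 6 + 3 / 2 * (a ^+ 2 * edot X X).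
  clear; have := @dot_youngN _ (6^-1) (3 / 2) Dx (a *: X).
  by rewrite !edotZr !edotZl => /(_ ltac:(lra) ltac:(lra)); lra.
have Y2 : g * edot Y e <= g * (edot Y Y / 8 + 2 * edot e e).
  rewrite ler_pM2l //; clear; have := @dot_young _ (8^-1) 2 Y e ltac:(lra) ltac:(lra); lra.
have Y3 : - (k * edot e N) <= edot e e / 2 + k ^+ 2 * edot N N / 2.
  clear; have := @dot_youngN _ (2^-1) (2^-1) e (k *: N) ltac:(lra) ltac:(lra).
  by rewrite !edotZr !edotZl; lra.
have Y4 : a * - edot e G <= a * (2 * edot e e + edot G G / 8).
  rewrite ler_pM2l //; clear; have := @dot_youngN _ 2 (8^-1) e G ltac:(lra) ltac:(lra); lra.
have Y5 : g * edot pp e <= g * (edot pp pp / 16 + 4 * edot e e).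
  rewrite ler_pM2l //; clear; have := @dot_young _ (16^-1) 4 pp e ltac:(lra) ltac:(lra); lra.
have Y6 : - edot pp zeta <= g / 16 * edot pp pp + b / 8192 * edot r r.
  apply: le_trans (@dot_youngN _ (g / 16) (4 / g) pp zeta _ _) _.
  - by rewrite divr_gt0.
  - by rewrite (_ : 4 * (g / 16) * (4 / g) = 1) //; field; rewrite gt_eqF.
  rewrite lerD2l.
  have g4 : 0 <= 4 / g by rewrite divr_ge0 // ltW.
  apply: le_trans (ler_wpM2l g4 F6) _.
  rewrite le_eqVlt; apply/orP; left; apply/eqP; rewrite bE; field.
  by rewrite gt_eqF.
have Y7 : - (k * edot N zeta) <= k ^+ 2 * edot N N / 2 + edot zeta zeta / 2.
  clear; have := @dot_youngN _ (2^-1) (2^-1) (k *: N) zeta ltac:(lra) ltac:(lra).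
  by rewrite !edotZl edotZr; lra.
have Y8 : b * - edot Ap r <= b * (edot Ap Ap + edot r r / 4).
  rewrite ler_pM2l //; clear; have := @dot_youngN _ 1 (4^-1) Ap r ltac:(lra) ltac:(lra); lra.
have Y9 : b * edot c r <= b * (2 * edot c c + edot r r / 8).
  rewrite ler_pM2l //; clear; have := @dot_young _ 2 (8^-1) c r ltac:(lra) ltac:(lra); lra.
have F4' : pi <= 2 * b * edot c r - 2 * b * edot r r + b ^+ 2 * edot r r.
  by move: F4; clear; rewrite edotDl edotNl; lra.
have F2' : a * (edot G Y - edot X X + edot Dx X) <= kappa.
  by move: F2; clear; rewrite edotDl edotNl; lra.
rewrite I4 I5 I6 I8 I9.
have := I1; have := I2; rewrite I3.
move: (edot_ge0 X) (edot_ge0 Dx) (edot_ge0 ex) (edot_ge0 c) (edot_ge0 r).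
move: (edot_ge0 Y) (edot_ge0 Dy) (edot_ge0 e) (edot_ge0 G) (edot_ge0 N).
move: (edot_ge0 q) (edot_ge0 zeta) (edot_ge0 Ap) (edot_ge0 pp).
clear F2 F4 I1 I2 I3 I4 I5 I6 I8 I9.
move: F1 F2' F3 F4' F5 F6 Y1 Y2 Y3 Y4 Y5 Y6 Y7 Y8 Y9 hAp hpp hres I7.
set z := edot (g *: e + _) _.
set res := edot (Ap - 2 *: r) _.
set XX := edot X X; set DD := edot Dx Dx; set EX := edot ex ex; set CC := edot c c.
set RR := edot r r; set YY := edot Y Y; set DY := edot Dy Dy; set EE := edot e e.
set GG := edot G G; set NN := edot N N; set QQ := edot q q; set ZZ := edot zeta zeta.
set AA := edot Ap Ap; set PP := edot pp pp.
set vY := edot (Y - e + _) _; set vY' := edot (Y - Dy) _; set vX := edot (X - Dx) _.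
set c1 := edot X (Dx - ex); set c2 := edot Y (Dy - e + _).
set c3 := edot Y e; set c4 := edot G Y; set c5 := edot Y N; set c6 := edot Dx X.
set c7 := edot e N; set c8 := edot e G; set c9 := edot pp e; set c10 := edot pp zeta.
set c11 := edot N zeta; set c12 := edot Ap r; set c13 := edot c r; set c14 := edot N pp.
set c15 := edot G q.
clearbody z res XX DD EX CC RR YY DY EE GG NN QQ ZZ AA PP vY vY' vX c1 c2 c3 c4 c5
 c6 c7 c8 c9 c10 c11 c12 c13 c14 c15.
clear ppE; clear Ap pp zeta N X Dx ex c r Y Dy e G q.
move=> F1 F2 F3 F4 F5 F6 Y1 Y2 Y3 Y4 Y5 Y6 Y7 Y8 Y9 hAp hpp hres z0.
move=> qq zz aa ppp yy dy ee gg nn xx dd exx cc rr J2 J1.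
have M1 : a ^+ 2 * XX <= a * XX / 192.
  have := ler_wpM2r (mulr_ge0 (ltW a0) xx) a1; rewrite expr2; clear; lra.
have M2 : g * XX <= a * XX / 10 by have := ler_wpM2r xx g1; clear; lra.
have M3 : g * GG <= a * GG / 10 by have := ler_wpM2r gg g1; clear; lra.
have g2 : g <= 1920^-1 by clear -g1 a1; lra.
have M4 : g * EE <= EE / 1920 by have := ler_wpM2r ee g2; clear; lra.
have M5 : g * EX <= EX / 1920 by have := ler_wpM2r exx g2; clear; lra.
have M6 : a * EE <= EE / 192 by have := ler_wpM2r ee a1; clear; lra.
have M7 : k ^+ 2 * NN <= NN.
  have : k ^+ 2 <= 1 by rewrite expr_le1 //; clear -k1 a1; lra.
  by move/(ler_wpM2r nn); rewrite mul1r.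
have b1 : b <= 1000^-1 by rewrite bE; clear -g2; lra.
have M8 : b ^+ 2 * RR <= b * RR / 1000.
  have := ler_wpM2r (mulr_ge0 (ltW b0) rr) b1; rewrite expr2; clear; lra.
have M9 : g * AA <= 2 * (g * XX + g * EX).
  by have := ler_wpM2l (ltW g0) hAp; clear; lra.
have M10 : g * PP <= 4 * (g * YY + g * EE + g * GG + g * QQ).
  by have := ler_wpM2l (ltW g0) hpp; clear; lra.
have M11 : b * res <= b * (2 * AA + 8 * RR) by rewrite ler_wpM2l // ltW.
have P1 := mulr_ge0 (ltW g0) yy; have P2 := mulr_ge0 (ltW g0) qq.
have P3 := mulr_ge0 (ltW g0) cc; have P4 := mulr_ge0 (ltW a0) xx.
have P5 := mulr_ge0 (ltW a0) gg; have P6 := mulr_ge0 (ltW b0) rr.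
have P7 := mulr_ge0 (ltW g0) xx; have P8 := mulr_ge0 (ltW g0) gg.
have P9 := mulr_ge0 (ltW g0) exx; have P10 := mulr_ge0 (ltW g0) ee.
have bA : b * AA = g * AA / 256 by rewrite bE; clear; lra.
have bC : b * CC = g * CC / 256 by rewrite bE; clear; lra.
have bG : b * GG = g * GG / 256 by rewrite bE; clear; lra.
clear hAp hpp hres a0 g0 g1 g2 b0 b1 a1 k0 k1 aa ppp qq cc zz xx gg rr bE kE.
lra.
Qed.

End Core.

(** * Algebraic identities for one iteration *)

Section Algebra.
Context {R : realType}.

(** With the gradient taken at the new point the corrector would be an implicit
    step; the defect only involves the gap between the predicted and the corrected
    points, and the noise. *)
Lemma primal_defectE m (V gw gt w wt z g1 : 'rV[R]_m) (l : R) :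
  V - (gw + l *: (w - z) + (V - g1 - l *: (wt - z)))
  = (gt - gw) + l *: (wt - w) + (g1 - gt).
Proof. by apply/rowP => i; rewrite !mxE; ring. Qed.

Lemma dual_defectE m (V gw gt w wt v g1 : 'rV[R]_m) (tau al k : R) : 1 + k != 0 ->
  let n' := (1 + k)^-1 *: (- V + g1 - tau *: wt + (al *: v + k *: (g1 - tau *: wt))) in
  V - (gw - tau *: w - n') - (al *: v + k *: (gw - tau *: w - n'))
  = (1 + k) *: ((gt - gw) - tau *: (wt - w) + (g1 - gt)).
Proof. by move=> k0 /=; apply/rowP => i; rewrite !mxE; field. Qed.

Lemma primal_predictorE m (x z xi gw g0 w : 'rV[R]_m) (h l : R) : h != 0 ->
  x - h *: (g0 + l *: (x - z) + xi) - w =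
  h *: (h^-1 *: (x - w) - (gw + l *: (x - z) + xi) - (g0 - gw)).
Proof. by move=> h0; apply/rowP => i; rewrite !mxE; field. Qed.

Lemma dual_predictorE m (y nn v gw g0 w : 'rV[R]_m) (h tau : R) : h != 0 ->
  y + h *: (g0 - tau *: y - nn + v) - w =
  - h *: (h^-1 *: (w - y) - (gw - tau *: y - nn + v) - (g0 - gw)).
Proof. by move=> h0; apply/rowP => i; rewrite !mxE; field. Qed.

Lemma primal_defect_bound m (du u N : 'rV[R]_m) (L : R) :
  edot (du + (2 * L) *: u + N) (du + (2 * L) *: u + N) <=
    2 * (3 * edot du du + 6 * L ^+ 2 * edot u u) + 2 * edot N N.
Proof.
have b1 := norm_sqD2 (du + (2 * L) *: u) N.
have b2 := edot_ge0 (2 *: du - (2 * L) *: u).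
have b5 : edot (du + (2 * L) *: u) (du + (2 * L) *: u)
    <= 3 * edot du du + 6 * (L ^+ 2 * edot u u).
  by move: b2; rewrite norm_sqB norm_sqD !edotZl !edotZr; clear; lra.
clear -b1 b5; lra.
Qed.

Lemma dual_defect_bound m (dv v N : 'rV[R]_m) (L tau k : R) :
  0 <= tau -> tau <= L -> 0 <= k -> k <= 384^-1 ->
  edot ((1 + k) *: (dv - tau *: v + N)) ((1 + k) *: (dv - tau *: v + N)) <=
    101 / 50 * (3 * edot dv dv + 6 * L ^+ 2 * edot v v) + 101 / 50 * edot N N.
Proof.
move=> t0 tL k0 k1.
have kk : (1 + k) ^+ 2 <= 101 / 100.
  by have := ler_wpM2l k0 k1; rewrite expr2; lra.
have t2 : tau ^+ 2 <= L ^+ 2 by rewrite ler_sqr ?nnegrE // (le_trans t0).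
rewrite edotZl edotZr mulrA -expr2.
apply: le_trans (ler_wpM2r (edot_ge0 _) kk) _.
have b1 := norm_sqD2 (dv - tau *: v) N.
have b2 := edot_ge0 (2 *: dv + tau *: v).
have b3 := ler_wpM2r (edot_ge0 v) t2.
have b4 := mulr_ge0 (sqr_ge0 tau) (edot_ge0 v).
have b5 : edot (dv - tau *: v) (dv - tau *: v) <= 3 * edot dv dv + 6 * (L ^+ 2 * edot v v).
  move: b2 b3 b4; rewrite (norm_sqB dv) norm_sqD !edotZl !edotZr; clear; lra.
clear -b1 b5; lra.
Qed.

(** The predictor is a step of size [h] from the same point, so it differs from
    the corrector by [h] times the change of velocity; the Lipschitz constant and
    the small value of [h * L] make the defects a small fraction of that change. *)
Lemma defect_bound_core m p (du u N0 N1 Dx : 'rV[R]_m) (dv v M0 M1 Dy : 'rV[R]_p)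
    (L tau k h : R) :
  0 <= tau -> tau <= L -> 0 <= k -> k <= h * L / 2 -> 0 < h -> h * L <= 192^-1 ->
  edot du du + edot dv dv <= L ^+ 2 * (edot u u + edot v v) ->
  edot u u <= h ^+ 2 * edot (Dx - N0) (Dx - N0) ->
  edot v v <= h ^+ 2 * edot (Dy - M0) (Dy - M0) ->
  edot (du + (2 * L) *: u + N1) (du + (2 * L) *: u + N1) +
  edot ((1 + k) *: (dv - tau *: v + M1)) ((1 + k) *: (dv - tau *: v + M1)) <=
  (edot Dx Dx + edot Dy Dy) / 1000 + (edot N0 N0 + edot M0 M0) / 1000
  + 3 * (edot N1 N1 + edot M1 M1).
Proof.
move=> t0 tL k0 k1 h0 hL lip gu gv.
have L0 := le_trans t0 tL.
have k2 : k <= 384^-1 by clear -k1 hL; lra.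
have i1 := primal_defect_bound du u N1 L.
have i2 := dual_defect_bound dv v M1 t0 tL k0 k2.
have j1 := le_trans gu (ler_wpM2l (sqr_ge0 h) (norm_sqB2 Dx N0)).
have j2 := le_trans gv (ler_wpM2l (sqr_ge0 h) (norm_sqB2 Dy M0)).
have hh : (h * L) ^+ 2 <= 192^-1 * 192^-1.
  have : (h * L) ^+ 2 <= (192^-1) ^+ 2.
    by rewrite ler_sqr ?nnegrE ?invr_ge0 // mulr_ge0 // ltW.
  by rewrite [leRHS]expr2.
set S := edot Dx Dx + edot Dy Dy; set M := edot N0 N0 + edot M0 M0.
have S0 : 0 <= S by rewrite addr_ge0 // edot_ge0.
have S1 : 0 <= M by rewrite addr_ge0 // edot_ge0.
have j3 : L ^+ 2 * (edot u u + edot v v) <= 2 * (192^-1 * 192^-1) * (S + M).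
  have l1 : edot u u + edot v v <= h ^+ 2 * (2 * (S + M)).
    by rewrite /S /M; clear -j1 j2; lra.
  have := ler_wpM2l (sqr_ge0 L) l1; have := ler_wpM2r (addr_ge0 S0 S1) hh.
  rewrite exprMn; clear; lra.
have e1 := edot_ge0 N1; have e2 := edot_ge0 M1; have e3 := edot_ge0 dv.
have e4 := edot_ge0 du.
have e5 := mulr_ge0 (sqr_ge0 L) (edot_ge0 v).
have e6 := mulr_ge0 (sqr_ge0 L) (edot_ge0 u).
clear -i1 i2 j3 e1 e2 e3 e4 e5 e6 lip S0 S1; lra.
Qed.

Lemma velocity_shiftE m (g x z xi : 'rV[R]_m) (L b : R) :
  g + (2 * L) *: (x - (z + b *: (x - z))) + xi
  = g + (2 * L) *: (x - z) + xi - (2 * b) *: (L *: (x - z)).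
Proof. by apply/rowP => i; rewrite !mxE; ring. Qed.

Lemma next_velyE m (V G v gw g2 w nn : 'rV[R]_m) (tau al k : R) :
  G = gw - tau *: w - nn ->
  G + (al *: v + k *: (g2 - tau *: w - nn)) =
  V - (V - G - (al *: v + k *: G)) + k *: (g2 - gw).
Proof. by move=> ->; apply/rowP => i; rewrite !mxE; ring. Qed.

Lemma next_momentumE m (G v gw g2 w nn ys ys' : 'rV[R]_m) (tau al k gm : R) :
  G = gw - tau *: w - nn ->
  al *: v + k *: (g2 - tau *: w - nn) + gm *: (w - ys') =
  al *: v + k *: G + gm *: (w - ys) + k *: (g2 - gw) - gm *: (ys' - ys).
Proof. by move=> ->; apply/rowP => i; rewrite !mxE; ring. Qed.

(** The damping and the gain of the dual velocity are matched so that the momentum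
    changes by a multiple of the force, up to the defect. *)
Lemma momentumE m (G v y w ys : 'rV[R]_m) (a g k h gm : R) :
  h != 0 -> 1 + g != 0 -> g = h * gm -> k * (1 + g) = a / 2 - g ->
  v + gm *: (y - ys) =
  ((1 + g)^-1 *: v + k *: G + gm *: (w - ys))
  - g *: (h^-1 *: (w - y) - G - ((1 + g)^-1 *: v + k *: G)) - (a / 2) *: G.
Proof.
move=> h0 g1 gE kE; have -> : a / 2 = k * (1 + g) + g by rewrite kE subrK.
have -> : gm = g / h by rewrite gE mulrAC divff // mul1r.
by apply/rowP => i; rewrite !mxE; field; rewrite h0 g1.
Qed.

(** The same matching cancels the dual velocity: the change of velocity, corrected
    by friction, is the increment of the force alone, to which monotonicity
    applies. *)
Lemma force_incrementE m (V G G' v N : 'rV[R]_m) (a g k : R) :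
  1 + g != 0 -> k * (1 + g) = a / 2 - g ->
  let e := V - G' - ((1 + g)^-1 *: v + k *: G') in
  V - (G + v) - e + k *: N
    - (- g *: (V - e + k *: N) + (a / 2) *: G' + (a / 2 - g) *: N) = G' - G.
Proof.
move=> g1 kE /=; have -> : a / 2 = k * (1 + g) + g by rewrite kE subrK.
by apply/rowP => i; rewrite !mxE; field.
Qed.

End Algebra.

(** * Parameters, iteration and potential *)

Section Params.
Context {R : realType}.
Variables (L tau : R).
Local Notation pr := (choose_params L tau).
Local Notation h := (p_h pr).
Local Notation k := (p_k pr).
Definition damping : R := Num.sqrt (2 * L * tau) / 16.
Local Notation gam := damping.

Lemma sqrt_Ltau : 0 < L -> 0 < tau -> tau <= L ->
  0 < Num.sqrt (2 * L * tau) <= 3 / 2 * L.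
Proof.
move=> L0 tau0 tauL.
have h0 : 0 < 2 * L * tau by rewrite !mulr_gt0.
rewrite sqrtr_gt0 h0 /= -ler_sqr ?nnegrE ?sqrtr_ge0 ?mulr_ge0 ?divr_ge0 ?(ltW L0) //.
rewrite sqr_sqrtr ?(ltW h0) //.
by have := ler_wpM2l (ltW L0) tauL; have := mulr_gt0 L0 L0; rewrite expr2; lra.
Qed.

Lemma h_gt0 : 0 < L -> 0 < tau -> tau <= L ->
  0 < h.
Proof. by move=> L0 tau0 tauL; rewrite /= invr_gt0; lra. Qed.

Lemma damping_gt0 : 0 < L -> 0 < tau -> tau <= L ->
  0 < gam.
Proof.
move=> L0 tau0 tauL; have /andP[s0 _] := sqrt_Ltau L0 tau0 tauL.
by rewrite /gam divr_gt0.
Qed.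

Lemma hL_bounds : 0 < L -> 0 < tau -> tau <= L ->
  256^-1 <= h * L <= 192^-1.
Proof.
move=> L0 tau0 tauL.
have d0 : 0 < 64 * (3 * L + tau) by lra.
apply/andP; split; rewrite /= mulrC.
  by rewrite ler_pdivlMr //; lra.
by rewrite ler_pdivrMr //; lra.
Qed.

Lemma hgam_le : 0 < L -> 0 < tau -> tau <= L ->
  h * gam <= h * L / 10.
Proof.
move=> L0 tau0 tauL.
have /andP[_ s1] := sqrt_Ltau L0 tau0 tauL; have h0 := h_gt0 L0 tau0 tauL.
rewrite -mulrA ler_pM2l // /gam; lra.
Qed.

Lemma damping_sqr : 0 < L -> 0 < tau -> tau <= L ->
  gam ^+ 2 = L * tau / 128.
Proof.
move=> L0 tau0 tauL.
have Lt0 : 0 <= 2 * L * tau by rewrite !mulr_ge0 // ltW.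
rewrite /gam expr_div_n sqr_sqrtr //; lra.
Qed.

Lemma betaE : 0 < L -> 0 < tau -> tau <= L ->
  p_beta pr = h * gam / 256.
Proof. by move=> L0 tau0 tauL; rewrite /= /gam; field; rewrite gt_eqF //; lra. Qed.

Lemma alphaE : 0 < L -> 0 < tau -> tau <= L ->
  p_alpha pr = (1 + h * gam)^-1.
Proof. by move=> L0 tau0 tauL; rewrite /p_alpha /= /gam mulrA. Qed.

Lemma hgam_gt0 : 0 < L -> 0 < tau -> tau <= L ->
  0 < h * gam.
Proof. by move=> L0 tau0 tauL; rewrite mulr_gt0 ?h_gt0 ?damping_gt0. Qed.

Lemma kE : 0 < L -> 0 < tau -> tau <= L ->
  k * (1 + h * gam) = h * L / 2 - h * gam.
Proof.
move=> L0 tau0 tauL.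
have g0 := hgam_gt0 L0 tau0 tauL; have /andP[s0 _] := sqrt_Ltau L0 tau0 tauL; have h0 := h_gt0 L0 tau0 tauL.
move: g0; rewrite /gam; set s := Num.sqrt _ in s0 *.
have -> : k = h * (8 * L - s) / (16 + h * s) by [].
set hh := h in h0 *; move=> g0.
have d0 : 16 + hh * s != 0 by rewrite gt_eqF //; have := mulr_gt0 h0 s0; lra.
by field.
Qed.

Lemma k_bounds : 0 < L -> 0 < tau -> tau <= L ->
  0 <= k /\ k <= h * L / 2.
Proof.
move=> L0 tau0 tauL.
have e := kE L0 tau0 tauL; have g0 := hgam_gt0 L0 tau0 tauL; have g1 := hgam_le L0 tau0 tauL.
have /andP[_ a1] := hL_bounds L0 tau0 tauL.
have aL : 0 < h * L by rewrite mulr_gt0 // h_gt0.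
move: e g0 g1 a1 aL; set g := h * gam; set a := h * L; set kk := k => e g0 g1 a1 aL.
have k0 : 0 <= kk.
  by rewrite -(pmulr_lge0 _ (_ : 0 < 1 + g)) ?e; lra.
by split => //; have := mulr_ge0 k0 (ltW g0); lra.
Qed.

End Params.

Section Step.
Context {R : realType} {n p : nat}.
Local Notation E := ('rV[R]_n * 'rV[R]_p)%type.
Variables (X : set 'rV[R]_n) (Y : set 'rV[R]_p).
Variables (F : 'rV[R]_n -> 'rV[R]_p -> R).
Variables (gx : 'rV[R]_n -> 'rV[R]_p -> 'rV[R]_n).
Variables (gy : 'rV[R]_n -> 'rV[R]_p -> 'rV[R]_p) (L tau : R).
Hypotheses (game : smooth_game X Y F gx gy L).
Hypotheses (tau0 : 0 < tau) (tauL : tau <= L).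
Let L0 : 0 < L := game_L_gt0 game.
Local Notation pr := (choose_params L tau).
Local Notation h := (p_h pr).
Local Notation k := (p_k pr).
Local Notation alpha := (p_alpha pr).
Local Notation beta := (p_beta pr).
Local Notation gam := (damping L tau).
Local Notation state := (@spde_state R n p).

Variable sad : 'rV[R]_n -> E.
Hypothesis sadP : forall z, is_saddle X Y F L tau z (sad z).

Definition predictor (s : state) (g0 : E) : E :=
  (eproj X (st_x s - h *: (g0.1 + (2 * L) *: (st_x s - st_z s) + st_xi s)),
   eproj Y (st_y s + h *: (g0.2 - tau *: st_y s - st_n s + st_v s))).

Definition corrector (s : state) (wt g1 : E) : E :=
  (eproj X (st_x s - h *: (g1.1 + (2 * L) *: (wt.1 - st_z s))),
   eproj Y (st_y s + h *: (g1.2 - tau *: wt.2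
     + (alpha *: st_v s + k *: (g1.2 - tau *: wt.2))))).

Definition next_xi (s : state) (wt g1 : E) : 'rV[R]_n :=
  h^-1 *: (st_x s - (corrector s wt g1).1) - g1.1 - (2 * L) *: (wt.1 - st_z s).

Definition next_n (s : state) (wt g1 : E) : 'rV[R]_p :=
  (1 + k)^-1 *: (h^-1 *: (st_y s - (corrector s wt g1).2) + g1.2 - tau *: wt.2
     + (alpha *: st_v s + k *: (g1.2 - tau *: wt.2))).

Definition next_state (s : state) (wt g1 g2 : E) (c : nat) : state :=
  let w' := corrector s wt g1 in
  let nn' := next_n s wt g1 in
  SpdeState w'.1 w'.2 (st_z s + beta *: (w'.1 - st_z s)) (next_xi s wt g1) nn'
    (alpha *: st_v s + k *: (g2.2 - tau *: w'.2 - nn')) c.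

Definition state_inv (s : state) : Prop :=
  [/\ X (st_x s), Y (st_y s), normal_cone X (st_x s) (st_xi s)
    & normal_cone Y (st_y s) (st_n s)].

Definition velx (s : state) : 'rV[R]_n :=
  gx (st_x s) (st_y s) + (2 * L) *: (st_x s - st_z s) + st_xi s.
Definition forcey (s : state) : 'rV[R]_p :=
  gy (st_x s) (st_y s) - tau *: st_y s - st_n s.
Definition vely (s : state) : 'rV[R]_p := forcey s + st_v s.
Definition momentum (s : state) : 'rV[R]_p :=
  st_v s + gam *: (st_y s - (sad (st_z s)).2).
Definition saddle_value (z : 'rV[R]_n) : R :=
  reg F L tau z (sad z).1 (sad z).2.

(** The changes of the dual velocity and of the momentum contain 1/2 and 1/4 of the
    work of the dual force along the step; the gap, of weight 3/4, returns it. The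
    weight is below 1, so that the energy of the primal velocity dominates the
    gap in [lyapunov_lb]. *)
Definition lyapunov (s : state) : R :=
  L * saddle_value (st_z s)
  + edot (velx s) (velx s) / 2 + edot (vely s) (vely s) / 2
  + 3 / 4 * (L * (saddle_value (st_z s) - reg F L tau (st_z s) (st_x s) (st_y s)))
  + edot (momentum s) (momentum s) / 4.

(** The direction paired with the noise of the third batch in [one_step]; it only
    depends on the first two batches, so the pairing has mean zero. *)
Definition noise_pairing (s : state) (wt g1 : E) : 'rV[R]_p :=
  let w' := corrector s wt g1 in
  let G' := gy w'.1 w'.2 - tau *: w'.2 - next_n s wt g1 in
  k *: (h^-1 *: (w'.2 - st_y s)) +
  (k / 2) *: (alpha *: st_v s + k *: G' + gam *: (w'.2 - (sad (st_z s)).2)).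

Lemma normal_coneZ m (C : set 'rV[R]_m) x (c : R) v : 0 <= c ->
  normal_cone C x v -> normal_cone C x (c *: v).
Proof. by move=> c0 Nv y Cy; rewrite edotZl mulr_ge0_le0 // Nv. Qed.

(** [xi] and [n] are the residuals of the projections of the corrector, up to a
    positive factor. *)
Lemma next_inv s wt g1 g2 c : state_inv (next_state s wt g1 g2 c).
Proof.
have h0 := h_gt0 L0 tau0 tauL; have [k0 _] := k_bounds L0 tau0 tauL.
have hn : h != 0 by rewrite gt_eqF.
split => /=.
- exact: eproj_in (game_X_closed game) (game_X_convex game) (game_X_nonempty game) _.
- exact: eproj_in (game_Y_closed game) (game_Y_convex game) (game_Y_nonempty game) _.
- have -> : next_xi s wt g1 = h^-1 *: ((st_x s - h *: (g1.1 + (2 * L) *: (wt.1 - st_z s)))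
      - (corrector s wt g1).1).
    by apply/rowP => i; rewrite !mxE; field.
  apply: normal_coneZ; first by rewrite invr_ge0 ltW.
  exact: eproj_normal (game_X_closed game) (game_X_convex game) (game_X_nonempty game) _.
rewrite /next_n; apply: normal_coneZ; first by rewrite invr_ge0; lra.
set y' := (corrector s wt g1).2.
have -> : h^-1 *: (st_y s - y') + g1.2 - tau *: wt.2
     + (alpha *: st_v s + k *: (g1.2 - tau *: wt.2)) = h^-1 *: ((st_y s + h *: (g1.2 - tau *: wt.2
     + (alpha *: st_v s + k *: (g1.2 - tau *: wt.2)))) - y').
  by apply/rowP => i; rewrite !mxE; field.
apply: normal_coneZ; first by rewrite invr_ge0 ltW.
exact: eproj_normal (game_Y_closed game) (game_Y_convex game) (game_Y_nonempty game) _.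
Qed.

(** The proximal term compensates the lack of monotonicity in [x], and the normal
    vectors are monotone. *)
Lemma velocity_monotone x y x' y' z xi xi' nn nn' :
  X x -> Y y -> X x' -> Y y' ->
  normal_cone X x xi -> normal_cone X x' xi' ->
  normal_cone Y y nn -> normal_cone Y y' nn' ->
  edot (h^-1 *: (x - x'))
    ((gx x' y' + (2 * L) *: (x' - z) + xi') - (gx x y + (2 * L) *: (x - z) + xi))
  + edot (h^-1 *: (y' - y)) ((gy x' y' - tau *: y' - nn') - (gy x y - tau *: y - nn))
  <= - (h * L) * edot (h^-1 *: (x - x')) (h^-1 *: (x - x')).
Proof.
move=> Xx Yy Xx' Yy' nx nx' ny ny'.
have h0 := h_gt0 L0 tau0 tauL.
have hn : h != 0 by rewrite gt_eqF.
have m := game_monotone game Xx Yy Xx' Yy'.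
have q1 := nx _ Xx'; have q2 := nx' _ Xx; have q3 := ny _ Yy'; have q4 := ny' _ Yy.
rewrite !edotZl !edotZr.
have -> : - (h * L) * (h^-1 * (h^-1 * edot (x - x') (x - x')))
  = h^-1 * (- L * edot (x - x') (x - x')) by field.
have hi0 : 0 < h^-1 by rewrite invr_gt0; exact: h0.
rewrite -mulrDr (ler_pM2l hi0).
have t0 := mulr_ge0 (ltW tau0) (edot_ge0 (y' - y)).
have -> : gx x' y' + (2 * L) *: (x' - z) + xi' - (gx x y + (2 * L) *: (x - z) + xi)
  = (gx x' y' - gx x y) - (2 * L) *: (x - x') + (xi' - xi).
  by apply/rowP => i; rewrite !mxE; ring.
have -> : gy x' y' - tau *: y' - nn' - (gy x y - tau *: y - nn)
  = (gy x' y' - gy x y) - tau *: (y' - y) - (nn' - nn).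
  by apply/rowP => i; rewrite !mxE; ring.
move: m q1 q2 q3 q4 t0; rewrite -(opprB x x') -(opprB y' y).
move: (gx x' y' - gx x y) (gy x' y' - gy x y) (x - x') (y' - y) => du dv u v.
rewrite !edotNl !edotNr.
rewrite !(edotDr, edotNr, edotZr) (edotC u xi) (edotC u xi') (edotC v nn) (edotC v nn').
rewrite (edotC u du) (edotC v dv) !opprK.
by lra.
Qed.

(** Convexity in [x] at the old dual point, then concavity in [y] at the new primal
    point. *)
Lemma reg_increase x y x' y' z xi nn' :
  X x -> Y y -> X x' -> Y y' ->
  normal_cone X x xi -> normal_cone Y y' nn' ->
  edot (gy x' y' - tau *: y' - nn') (y' - y)
    + edot (gx x y + (2 * L) *: (x - z) + xi) (x' - x)
  <= reg F L tau z x' y' - reg F L tau z x y.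
Proof.
move=> Xx Yy Xx' Yy' nx ny'.
have q1 := nx _ Xx'; have q2 := ny' _ Yy.
have r1 := reg_strong_x tau game z Xx Xx' Yy.
have r2 := reg_strong_y tau game z Xx' Yy' Yy.
have r3 := mulr_ge0 (ltW L0) (edot_ge0 (x' - x)).
have r4 := mulr_ge0 (ltW tau0) (edot_ge0 (y - y')).
rewrite [edot (_ - nn') _]edotDl [edot (_ + xi) _]edotDl
  -/(regx gx L z x y) -/(regy gy tau x' y').
move: q2 r2 r4; rewrite -(opprB y' y) !edotNr !edotNl => q2 r2 r4.
by lra.
Qed.

(** Concavity bounds the work of the dual force by a difference of values of the
    saddle function, which the growth at the saddle point and the primal velocity
    bound in turn. *)
Lemma force_to_saddle x' y' z xi' nn' A :
  X x' -> Y y' -> normal_cone X x' xi' -> normal_cone Y y' nn' ->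
  A = gx x' y' + (2 * L) *: (x' - z) + xi' ->
  L * edot (gy x' y' - tau *: y' - nn') (y' - (sad z).2) <=
    edot A A / 2 - edot (L *: (x' - (sad z).1)) (L *: (x' - (sad z).1)) / 2
    - L * tau / 2 * edot (y' - (sad z).2) (y' - (sad z).2).
Proof.
move=> Xx' Yy' nx ny AE.
have [Xs Ys sx sy] := sadP z.
set xs := (sad z).1 in Xs sx sy *; set ys := (sad z).2 in Ys sx sy *.
have q1 := nx _ Xs; have q2 := ny _ Ys.
have r1 := reg_strong_x tau game z Xx' Xs Yy'.
have r2 := reg_strong_y tau game z Xx' Yy' Ys.
have r3 := sx _ Xx'; have r4 := sy _ Yy'.
have r5 := edot_ge0 (A + L *: (xs - x')).
have t0 := mulr_ge0 (ltW tau0) (edot_ge0 (y' - ys)).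
have e1 : edot A (xs - x') = edot (regx gx L z x' y') (xs - x') + edot xi' (xs - x').
  by rewrite AE edotDl.
have e2 : edot (gy x' y' - tau *: y' - nn') (y' - ys) =
   - edot (regy gy tau x' y') (ys - y') + edot nn' (ys - y').
  by rewrite [LHS]edotDl -(opprB ys y') !edotNr !edotNl opprK.
rewrite e2.
have s1 : edot (ys - y') (ys - y') = edot (y' - ys) (y' - ys).
  by rewrite -(opprB y' ys) edotNl edotNr opprK.
have s2 : edot (x' - xs) (x' - xs) = edot (xs - x') (xs - x').
  by rewrite -(opprB xs x') edotNl edotNr opprK.
rewrite edotZl edotZr s2.
rewrite s1 in r2; rewrite s2 in r3.
move: r5; rewrite norm_sqD edotZl !edotZr e1.
move: q1 q2 r1 r2 r3 r4 t0.
set k1 := reg _ _ _ _ _ _; set k2 := reg _ _ _ _ _ _.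
set k3 := reg _ _ _ _ _ _; set k4 := reg _ _ _ _ _ _.
move=> q1 q2 r1 r2 r3 r4 t0 r5.
have b1 : - edot (regy gy tau x' y') (ys - y') + edot nn' (ys - y') <=
   - edot (regx gx L z x' y') (xs - x') - edot xi' (xs - x')
   - L * edot (xs - x') (xs - x') - tau / 2 * edot (y' - ys) (y' - ys).
  by lra.
have := ler_wpM2l (ltW L0) b1.
move: r5; lra.
Qed.

End Step.

(** * Decrease of the potential along one iteration *)

Section OneStep.
Context {R : realType} {n p : nat}.
Local Notation E := ('rV[R]_n * 'rV[R]_p)%type.
Variables (X : set 'rV[R]_n) (Y : set 'rV[R]_p).
Variables (F : 'rV[R]_n -> 'rV[R]_p -> R).
Variables (gx : 'rV[R]_n -> 'rV[R]_p -> 'rV[R]_n).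
Variables (gy : 'rV[R]_n -> 'rV[R]_p -> 'rV[R]_p) (L tau : R).
Local Notation pr := (choose_params L tau).
Local Notation h := (p_h pr).
Local Notation k := (p_k pr).
Local Notation alpha := (p_alpha pr).
Local Notation beta := (p_beta pr).
Local Notation gam := (damping L tau).
Local Notation state := (@spde_state R n p).
Variable sad : 'rV[R]_n -> E.
Local Notation lyap := (lyapunov F gx gy L tau sad).

Definition sq_norm (u : E) : R := edot u.1 u.1 + edot u.2 u.2.

Lemma sq_norm_ge0 u : 0 <= sq_norm u.
Proof. by rewrite addr_ge0 // edot_ge0. Qed.

Lemma step_arith (b l a1 e1 e2 e3 e4 e5 e6 e7 e8 e9 e10 e11 m0 m1 P' P K1 K' K : R) :
  l * K1 = l * K' - (2 * b - b ^+ 2) * e1 -> 0 <= a1 ->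
  l * (P' - P) + e2 / 2 - e3 / 2 + e4 / 2 - e5 / 2
    + 3 / 4 * (l * (P' - P) - l * (K' - K) + (2 * b - b ^+ 2) * e1)
    + e6 / 4 - e7 / 4 <= - (b / 64) * (e8 + 2 * e9) + 10 * (m0 + m1 + e10) + e11 ->
  l * P' + e2 / 2 + e4 / 2 + 3 / 4 * (l * (P' - K1)) + e6 / 4 <=
  l * P + e3 / 2 + e5 / 2 + 3 / 4 * (l * (P - K)) + e7 / 4
    - b / 64 * (e8 + 2 * e9) + 10 * (m0 + m1 + (a1 + e10)) + e11.
Proof. lra. Qed.

(** The defects [VX - A'] and [e] turn the iteration into an implicit step with
    perturbations; [H1] to [H6] are the hypotheses of [lyapunov_core] for it. *)
Lemma one_step (s s' : state) (wt w' g0 g1 g2 : E) (c : nat) :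
  smooth_game X Y F gx gy L -> 0 < tau -> tau <= L ->
  (forall z, is_saddle X Y F L tau z (sad z)) ->
  state_inv X Y s ->
  wt = predictor X Y L tau s g0 ->
  w' = corrector X Y L tau s wt g1 ->
  s' = next_state X Y L tau s wt g1 g2 c ->
  lyap s' <= lyap s
   - beta / 64 * (edot (gx w'.1 w'.2 + st_xi s') (gx w'.1 w'.2 + st_xi s')
                  + 2 * edot (forcey gy tau s') (forcey gy tau s'))
   + 10 * (sq_norm (g0 - (gx (st_x s) (st_y s), gy (st_x s) (st_y s)))
           + sq_norm (g1 - (gx wt.1 wt.2, gy wt.1 wt.2))
           + sq_norm (g2 - (gx w'.1 w'.2, gy w'.1 w'.2)))
   + edot (g2.2 - gy w'.1 w'.2) (noise_pairing X Y gy L tau sad s wt g1).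
Proof.
move=> game tau0 tauL sadP inv wtE w'E s'E.
have [Xx Yy nx ny] := inv.
have [Xw' Yw' nx' ny'] : state_inv X Y s' by rewrite s'E; exact: (next_inv game).
have sx : st_x s' = w'.1 by rewrite s'E w'E.
have sz : st_z s' = st_z s + beta *: (w'.1 - st_z s) by rewrite s'E w'E.
have sxi : st_xi s' = next_xi X Y L tau s wt g1 by rewrite s'E.
have sn : st_n s' = next_n X Y L tau s wt g1 by rewrite s'E.
have vE : st_v s' = alpha *: st_v s + k *: (g2.2 - tau *: w'.2 - st_n s').
  by rewrite s'E w'E.
have sy : st_y s' = w'.2 by rewrite s'E w'E.
rewrite sx in Xw' nx'; rewrite sy in Yw' ny'.
have L0 := game_L_gt0 game.
have h0 := h_gt0 L0 tau0 tauL.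
have /andP[_ hL1] := hL_bounds L0 tau0 tauL.
have hL0 : 0 < h * L by rewrite mulr_gt0.
have [k0 k1] := k_bounds L0 tau0 tauL.
have g0' := hgam_gt0 L0 tau0 tauL.
have g1' := hgam_le L0 tau0 tauL.
have kE := kE L0 tau0 tauL.
have bE := betaE L0 tau0 tauL.
have aE := alphaE L0 tau0 tauL.
have gE := damping_sqr L0 tau0 tauL.
have Xwt : X wt.1 by rewrite wtE; exact: eproj_in (game_X_closed game) (game_X_convex game) (game_X_nonempty game) _.
have Ywt : Y wt.2 by rewrite wtE; exact: eproj_in (game_Y_closed game) (game_Y_convex game) (game_Y_nonempty game) _.
have hn : h != 0 by rewrite gt_eqF.
have kn : 1 + k != 0 by rewrite gt_eqF // ltr_wpDr.
have gn : 1 + h * gam != 0 by rewrite gt_eqF // addr_gt0.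
pose VX := h^-1 *: (st_x s - w'.1).
pose VY := h^-1 *: (w'.2 - st_y s).
pose A' := gx w'.1 w'.2 + (2 * L) *: (w'.1 - st_z s) + st_xi s'.
pose G' := gy w'.1 w'.2 - tau *: w'.2 - st_n s'.
pose u := alpha *: st_v s + k *: G'.
pose e := VY - G' - u.
pose r := L *: (w'.1 - st_z s).
pose cc := L *: (w'.1 - (sad (st_z s)).1).
pose q := gam *: (w'.2 - (sad (st_z s)).2).
pose ze := gam *: ((sad (st_z s')).2 - (sad (st_z s)).2).
pose N := g2.2 - gy w'.1 w'.2.
pose kap := L * (reg F L tau (st_z s) w'.1 w'.2 - reg F L tau (st_z s) (st_x s) (st_y s)).
pose pi := L * (saddle_value F L tau sad (st_z s') - saddle_value F L tau sad (st_z s)).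
pose n0 := sq_norm (g0 - (gx (st_x s) (st_y s), gy (st_x s) (st_y s))).
pose n1 := sq_norm (g1 - (gx wt.1 wt.2, gy wt.1 wt.2)).
have uE : u + q = VY - e - G' + q.
  by rewrite /e opprB [VY - G']addrC !addrA; apply/rowP => i; rewrite !mxE; ring.
have core := @lyapunov_core R n p VX (VX - velx gx L s) (VX - A') cc r
  VY (VY - vely gy tau s) e G' N q ze (u + q) (h * L) (h * gam) beta k kap pi n0 n1
  hL0 hL1 g0' g1' bE k0 k1 kE (sq_norm_ge0 _) (sq_norm_ge0 _).
(* monotonicity between the two ends of the step *)
have H1 : edot VX (VX - velx gx L s - (VX - A')) +
    edot VY (VY - vely gy tau s - e + k *: N -
       (- (h * gam) *: (VY - e + k *: N) + (h * L / 2) *: G' +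
       (h * L / 2 - h * gam) *: N)) <= - (h * L) * edot VX VX.
  have -> : VX - velx gx L s - (VX - A') = A' - velx gx L s.
    by rewrite opprB addrC addrA subrK.
  rewrite /e /u aE (force_incrementE VY (forcey gy tau s) G' (st_v s) N gn kE).
  by have := velocity_monotone game tau0 tauL (st_z s) Xx Yy Xw' Yw' nx nx' ny ny'.
have H2 : h * L * (edot G' VY - edot (VX - (VX - velx gx L s)) VX) <= kap.
  have := reg_increase game tau0 (st_z s) Xx Yy Xw' Yw' nx ny'.
  rewrite -/(velx gx L s) -/G' => hh.
  rewrite /kap (mulrC h) -mulrA ler_pM2l //; apply: le_trans hh.
  rewrite subKr /VX /VY -[st_x s - w'.1]opprB scalerN edotNr opprK !edotZr.
  by rewrite mulrDr !mulrA mulfV // !mul1r.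
have H3 : h * L * edot G' q <= h * gam * (edot (VX - (VX - A')) (VX - (VX - A')) / 2
    - edot cc cc / 2 - 64 * edot q q).
  have := force_to_saddle game tau0 sadP Xw' Yw' nx' ny' (erefl A').
  rewrite -/G' -/cc subKr /q !edotZr edotZl => hh.
  have e1 : 64 * (gam * (gam * edot (w'.2 - (sad (st_z s)).2) (w'.2 - (sad (st_z s)).2)))
     = L * tau / 2 * edot (w'.2 - (sad (st_z s)).2) (w'.2 - (sad (st_z s)).2).
    by rewrite [gam * (gam * _)]mulrA -expr2 gE; field.
  rewrite e1 (_ : h * L * (gam * _) = h * gam * (L * edot G' (w'.2 - (sad (st_z s)).2))).
    by rewrite ler_pM2l.
  by rewrite mulrACA.
have zE : st_z s' - st_z s = beta *: (w'.1 - st_z s) by rewrite sz addrC addKr.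
have b0 : 0 < beta by rewrite bE; exact: divr_gt0 g0' (ltr0Sn _ _).
(* moving the centre to the iterate lowers the saddle value, except for [cc] *)
have H4 : pi <= 2 * beta * edot (cc - r) r + beta ^+ 2 * edot r r.
  have := saddle_value_ub game tau0 (sadP (st_z s)) (sadP (st_z s')).
  rewrite -/(saddle_value F L tau sad (st_z s)) -/(saddle_value F L tau sad (st_z s')).
  rewrite -lerBlDl => /(ler_wpM2l (ltW L0)); rewrite -/pi => /le_trans; apply.
  have -> : cc - r = L *: (st_z s - (sad (st_z s)).1).
    by apply/rowP => i; rewrite !mxE; ring.
  have -> : (sad (st_z s)).1 - st_z s' =
      ((sad (st_z s)).1 - st_z s) - beta *: (w'.1 - st_z s).
    by rewrite -zE opprB addrA subrK.
  rewrite /r -[st_z s - _]opprB (norm_sqB _ (beta *: _)).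
  set d := (sad (st_z s)).1 - _; set d' := w'.1 - _.
  rewrite !(edotZl, edotZr, edotNl).
  by rewrite le_eqVlt; apply/orP; left; apply/eqP; ring.
have H5 : edot ze ze <= beta ^+ 2 / 128 * edot r r.
  have := saddle_lipschitz game (sadP (st_z s')) (sadP (st_z s)).
  rewrite zE !(edotZl, edotZr) => hh.
  rewrite [gam * (gam * _)]mulrA -expr2 gE.
  set d := edot (w'.1 - _) _ in hh *.
  set dd := edot _ _ in hh *.
  rewrite (_ : L * tau / 128 * dd = 128^-1 * (L * (tau * dd))); last by field.
  rewrite (_ : beta ^+ 2 / 128 * (L * (L * d)) = 128^-1 * (L * (L * (beta * (beta * d))))); last by field.
  by rewrite ler_pM2l ?invr_gt0 // ler_pM2l.
(* projecting the predictor does not increase its distance to the corrected point *)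
have H6 : edot (VX - A') (VX - A') + edot e e <=
   (edot (VX - velx gx L s) (VX - velx gx L s)
    + edot (VY - vely gy tau s) (VY - vely gy tau s)) / 1000 + n0 / 1000 + 3 * n1.
  have lip := game_lip game Xwt Ywt Xw' Yw'.
  have gapx : edot (wt.1 - w'.1) (wt.1 - w'.1) <=
      h ^+ 2 * edot (VX - velx gx L s - (g0.1 - gx (st_x s) (st_y s)))
                    (VX - velx gx L s - (g0.1 - gx (st_x s) (st_y s))).
    have := eproj_dist (game_X_closed game) (game_X_convex game) (game_X_nonempty game)
      (st_x s - h *: (g0.1 + (2 * L) *: (st_x s - st_z s) + st_xi s)) Xw'.
    rewrite (primal_predictorE _ _ _ (gx (st_x s) (st_y s)) _ _ _ hn).
    by rewrite (edotZl h) (edotZr h) (mulrA h) -expr2 wtE.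
  have gapy : edot (wt.2 - w'.2) (wt.2 - w'.2) <=
      h ^+ 2 * edot (VY - vely gy tau s - (g0.2 - gy (st_x s) (st_y s)))
                    (VY - vely gy tau s - (g0.2 - gy (st_x s) (st_y s))).
    have := eproj_dist (game_Y_closed game) (game_Y_convex game) (game_Y_nonempty game)
      (st_y s + h *: (g0.2 - tau *: st_y s - st_n s + st_v s)) Yw'.
    rewrite (dual_predictorE _ _ _ (gy (st_x s) (st_y s)) _ _ _ hn).
    by rewrite (edotZl (- h)) (edotZr (- h)) (mulrA (- h)) mulrNN -expr2 wtE.
  have := @defect_bound_core R n p (gx wt.1 wt.2 - gx w'.1 w'.2) (wt.1 - w'.1)
    (g0.1 - gx (st_x s) (st_y s)) (g1.1 - gx wt.1 wt.2) (VX - velx gx L s)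
    (gy wt.1 wt.2 - gy w'.1 w'.2) (wt.2 - w'.2)
    (g0.2 - gy (st_x s) (st_y s)) (g1.2 - gy wt.1 wt.2) (VY - vely gy tau s)
    L tau k h (ltW tau0) tauL k0 k1 h0 hL1 lip gapx gapy.
  rewrite -(primal_defectE VX _ _ _ _ (st_z s)).
  rewrite -(dual_defectE VY (gy w'.1 w'.2) (gy wt.1 wt.2) w'.2 wt.2 (st_v s) g1.2 tau alpha kn).
  have -> : VX - g1.1 - (2 * L) *: (wt.1 - st_z s) = st_xi s'.
    by rewrite sxi /next_xi -w'E.
  have -> : (1 + k)^-1 *: (- VY + g1.2 - tau *: wt.2
      + (alpha *: st_v s + k *: (g1.2 - tau *: wt.2))) = st_n s'.
    by rewrite sn /next_n -w'E /VY -scalerN opprB.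
  rewrite -/A' -/G' -/u -/e => /le_trans; apply.
  by rewrite /n0 /n1 /sq_norm.
have := core H1 H2 H3 H4 H5 H6 uE; clear core H1 H2 H3 H4 H5 H6.
(* the potential and the stationarity measure in the variables of the core *)
have xi'E : velx gx L s' = VX - (VX - A') - (2 * beta) *: r.
  by rewrite subKr /A' /r -velocity_shiftE -sz -sx -sy.
have nE : G' = gy w'.1 w'.2 - tau *: w'.2 - st_n s' by [].
have yE : vely gy tau s' = VY - e + k *: N.
  by rewrite /vely /forcey sx sy -/G' vE /e (next_velyE VY (st_v s) _ _ _ nE).
have pE : momentum L tau sad s' = u + q + k *: N - ze.
  by rewrite /momentum sy vE (next_momentumE (st_v s) g2.2 (sad (st_z s)).2 _ alpha k gam nE).
have p0 : momentum L tau sad s = u + q - (h * gam) *: e - (h * L / 2) *: G'.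
  rewrite /e /u aE; exact: (momentumE G' (st_v s) (st_y s) w'.2 _ hn gn (erefl _) kE).
have x0 : velx gx L s = VX - (VX - velx gx L s) by rewrite subKr.
have y0 : vely gy tau s = VY - (VY - vely gy tau s) by rewrite subKr.
have rE : VX - (VX - A') - 2 *: r = gx w'.1 w'.2 + st_xi s'.
  by rewrite subKr /A' /r scalerA addrAC addrK.
have fE : forcey gy tau s' = G' by rewrite /forcey sx sy.
have KE : L * reg F L tau (st_z s') w'.1 w'.2 =
    L * reg F L tau (st_z s) w'.1 w'.2 - (2 * beta - beta ^+ 2) * edot r r.
  have e1 : w'.1 - st_z s' = (1 - beta) *: (w'.1 - st_z s).
    by rewrite sz opprD addrA scalerBl scale1r.
  rewrite /reg e1 /r !(edotZl, edotZr); ring.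
have npE : noise_pairing X Y gy L tau sad s wt g1 = k *: VY + (k / 2) *: (u + q).
  by rewrite /noise_pairing -w'E -sn -/G'.
rewrite -xi'E -yE -pE -p0 rE -x0 -y0 -fE npE.
rewrite /lyapunov sx sy /kap /pi.
rewrite -/n0 -/n1 [sq_norm (g2 - _)]/sq_norm /= -/N.
move: KE (edot_ge0 (g2.1 - gx w'.1 w'.2)).
move: (edot (g2.1 - _) _) (edot N N) (edot N (_ + _)) n0 n1 => N1x e10 e11 m0 m1.
move: (edot (velx _ _ s') _) (edot (velx _ _ s) _) => e2 e3.
move: (edot (vely _ _ s') _) (edot (vely _ _ s) _) => e4 e5.
move: (edot (momentum _ _ _ s') _) (edot (momentum _ _ _ s) _) => e6 e7.
move: (edot (gx _ _ + _) _) (edot (forcey _ _ _) _) (edot r r) => e8 e9 e1.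
move: (saddle_value _ _ _ _ (st_z s')) (saddle_value _ _ _ _ (st_z s)) => P' P.
move: (reg _ _ _ _ w'.1 _) (reg _ _ _ (st_z s) w'.1 _) (reg _ _ _ _ (st_x s) _) => K'' K' K.
exact: step_arith.
Qed.

End OneStep.

(** * Bounds for the potential and the residual *)

Section Bounds.
Context {R : realType} {n p : nat}.
Local Notation E := ('rV[R]_n * 'rV[R]_p)%type.
Context {dW : measure_display} {W : measurableType dW}.
Variables (X : set 'rV[R]_n) (Y : set 'rV[R]_p).
Variables (D : probability W R) (f : E -> W -> R) (L : R).
Hypothesis SA : standing_assumptions X Y D f L.
Local Notation F := (fun x y => meanF D f (x, y)).
Local Notation gx := (fun x y => (grad (meanF D f) (x, y)).1).
Local Notation gy := (fun x y => (grad (meanF D f) (x, y)).2).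
Local Notation DY := (max_norm Y).

Lemma enorm_le_max y : Y y -> enorm y <= DY.
Proof.
move=> Yy; apply: ub_le_sup; last by exists y.
have /compact_bounded [M [_ HM]] := Y_compact SA.
exists (Num.sqrt (p%:R * (M + 1) ^+ 2)) => _ [u Yu <-].
rewrite /enorm ler_sqrt; last by rewrite mulr_ge0 // sqr_ge0.
apply: le_trans (edot_le_mx_norm _) _; rewrite ler_wpM2l //.
have : `|u| <= M + 1 by apply: (HM (M + 1)) => //; rewrite ltrDl.
by move=> uM; rewrite ler_sqr ?nnegrE // (le_trans _ uM).
Qed.

Lemma edot_le_max y : Y y -> edot y y <= DY ^+ 2.
Proof.
move=> Yy; rewrite -enorm_sqr ler_sqr ?nnegrE ?enorm_ge0 ?enorm_le_max //.
exact: ltW (max_norm_gt0 SA).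
Qed.

Lemma diff_le_max y y' : Y y -> Y y' -> edot (y - y') (y - y') <= 4 * DY ^+ 2.
Proof.
move=> Yy Yy'; have := norm_sqB2 y y'; have := edot_le_max Yy; have := edot_le_max Yy'.
lra.
Qed.

Lemma enorm_diff_le y y' : Y y -> Y y' -> enorm (y - y') <= 2 * DY.
Proof.
move=> Yy Yy'; have d0 := max_norm_gt0 SA.
rewrite -ler_sqr ?nnegrE ?enorm_ge0 ?mulr_ge0 ?(ltW d0) //.
by rewrite enorm_sqr exprMn -natrX diff_le_max.
Qed.

Lemma F_le_phi x y : X x -> Y y -> F x y <= phi Y D f x.
Proof.
move=> Xx Yy; apply: ub_le_sup; last by exists y.
have game := meanF_smooth_game SA.
exists (F x y + enorm (gy x y) * (2 * DY)) => _ [u Yu <-].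
apply: le_trans (game_concave game Xx Yy Yu) _; rewrite lerD2l.
apply: le_trans (edot_CS _ _) _; rewrite ler_wpM2l ?enorm_ge0 //.
exact: enorm_diff_le.
Qed.

Lemma phi_inf_le x : X x -> phi_inf X Y D f <= phi Y D f x.
Proof. by move=> Xx; apply: ge_inf; [exact: phi_bounded_below SA|exists x]. Qed.

Variable tau : R.
Hypotheses (tau0 : 0 < tau) (tauL : tau <= L).
Local Notation state := (@spde_state R n p).
Variable sad : 'rV[R]_n -> E.
Hypothesis sadP : forall z, is_saddle X Y F L tau z (sad z).
Local Notation lyap := (lyapunov F gx gy L tau sad).
Local Notation value := (saddle_value F L tau sad).

(** The saddle value is at least the regularized value at any dual point, and the
    regularization is bounded on [Y]. *)
Lemma saddle_value_lb z : phi_inf X Y D f - tau / 2 * DY ^+ 2 <= value z.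
Proof.
have L0 := L_gt0 SA; have [Xs Ys sx sy] := sadP z.
rewrite lerBlDr; apply: le_trans (phi_inf_le Xs) _.
apply: ge_sup; first by case: (Y_nonempty SA) => y Yy; exists (F (sad z).1 y); exists y.
move=> _ [y Yy <-]; have := sy _ Yy; rewrite -/(value z) /reg.
have := mulr_ge0 (ltW L0) (edot_ge0 ((sad z).1 - z)).
have := mulr_ge0 (ltW tau0) (edot_ge0 (y - (sad z).2)).
have := ler_wpM2l (ltW tau0) (edot_le_max Yy); lra.
Qed.

(** The excess of the saddle function over its value is at most half the squared
    primal velocity divided by [L], by strong convexity in [x]. *)
Lemma lyapunov_lb s : state_inv X Y s ->
  L * (phi_inf X Y D f - tau / 2 * DY ^+ 2) <= lyap s.
Proof.
move=> [Xx Yy nx ny]; have L0 := L_gt0 SA; have game := meanF_smooth_game SA.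
have := ler_wpM2l (ltW L0) (saddle_value_lb (st_z s)).
have [Xs Ys sx sy] := sadP (st_z s).
have r1 := reg_strong_x tau game (st_z s) Xx Xs Yy.
have r2 := sy _ Yy.
have q1 := nx _ Xs.
have r3 := mulr_ge0 (ltW tau0) (edot_ge0 (st_y s - (sad (st_z s)).2)).
have r4 := edot_ge0 (velx gx L s + L *: ((sad (st_z s)).1 - st_x s)).
have e1 : edot (velx gx L s) ((sad (st_z s)).1 - st_x s) =
  edot (regx gx L (st_z s) (st_x s) (st_y s)) ((sad (st_z s)).1 - st_x s)
  + edot (st_xi s) ((sad (st_z s)).1 - st_x s) by rewrite /velx edotDl.
move: r4; rewrite norm_sqD edotZl !edotZr e1 => r4.
have b1 : reg F L tau (st_z s) (st_x s) (st_y s) - value (st_z s) <=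
   - edot (regx gx L (st_z s) (st_x s) (st_y s)) ((sad (st_z s)).1 - st_x s)
   - edot (st_xi s) ((sad (st_z s)).1 - st_x s)
   - L / 2 * edot ((sad (st_z s)).1 - st_x s) ((sad (st_z s)).1 - st_x s).
  rewrite -/(value (st_z s)) in r2; lra.
have b2 := ler_wpM2l (ltW L0) b1.
rewrite /lyapunov.
have := edot_ge0 (velx gx L s); have := edot_ge0 (vely gy tau s).
have := edot_ge0 (momentum L tau sad s); lra.
Qed.

(** At the start the centre is [x0] and the normal vectors vanish, so that every term
    is controlled by the gradient at the initial point; [3 + 64^-1] collects what
    the regularization and the initial momentum contribute. *)
Lemma lyapunov_init x0 y0 : X x0 -> Y y0 ->
  lyap (SpdeState x0 y0 x0 0 0 0 0%N) - L * (phi_inf X Y D f - tau / 2 * DY ^+ 2)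
  <= L * initial_quantity X Y D f L x0 y0.
Proof.
move=> Xx Yy; have L0 := L_gt0 SA; have game := meanF_smooth_game SA.
have [Xs Ys sx sy] := sadP x0.
have d0 := max_norm_gt0 SA.
rewrite /lyapunov /vely /forcey /velx /momentum /= !subrr !scaler0 !addr0 !subr0 add0r.
set ys := (sad x0).2 in Ys sx sy *; set xs := (sad x0).1 in Xs sx sy *.
have v1 : value x0 <= F x0 ys - tau / 2 * edot ys ys.
  have := sx _ Xx; rewrite -/(value x0) /reg subrr edot0l mulr0 addr0.
  by have := mulr_ge0 (ltW L0) (edot_ge0 (x0 - xs)); lra.
have v2 : F x0 ys <= phi Y D f x0 by exact: F_le_phi.
have v3 : reg F L tau x0 x0 y0 = F x0 y0 - tau / 2 * edot y0 y0.
  by rewrite /reg subrr edot0l mulr0 addr0.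
have v4 := game_concave game Xx Yy Ys.
have v5 : edot (gy x0 y0) (ys - y0) <= 2 * DY * enorm (gy x0 y0).
  rewrite [leRHS]mulrC; apply: le_trans (edot_CS _ _) _; rewrite ler_wpM2l ?enorm_ge0 //.
  exact: enorm_diff_le.
have v6 := ler_wpM2l (ltW tau0) (edot_le_max Yy).
have v7 := mulr_ge0 (ltW tau0) (edot_ge0 ys).
have v8 := norm_sqB2 (gy x0 y0) (tau *: y0).
rewrite edotZl edotZr in v8.
have v9 : tau * (tau * DY ^+ 2) <= L * (L * DY ^+ 2).
  have D20 : 0 <= DY ^+ 2 by exact: sqr_ge0.
  apply: ler_pM; [exact: ltW| |exact: tauL|by rewrite ler_wpM2r].
  by rewrite mulr_ge0 // ltW.
have v10 : tau * (L * DY ^+ 2) <= L * (L * DY ^+ 2).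
  by rewrite ler_wpM2r // mulr_ge0 ?(ltW L0) // sqr_ge0.
have v11 := ler_wpM2l (ltW tau0) v6.
have v12 : edot (damping L tau *: (y0 - ys)) (damping L tau *: (y0 - ys)) <=
   L * tau / 128 * (4 * DY ^+ 2).
  rewrite edotZl edotZr mulrA -expr2 damping_sqr // ler_wpM2l ?diff_le_max //.
  by rewrite divr_ge0 // mulr_ge0 // ltW.
have -> : L * initial_quantity X Y D f L x0 y0 =
   L * (phi Y D f x0 - phi_inf X Y D f) + 2 * L * DY * enorm (gy x0 y0)
   + edot (gx x0 y0) (gx x0 y0) + 2 * edot (gy x0 y0) (gy x0 y0)
   + (3 + 64^-1) * (L * (L * DY ^+ 2)).
  rewrite /initial_quantity -!enorm_sqr; by field; rewrite gt_eqF.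
have w1 := edot_ge0 (gx x0 y0); have w2 := edot_ge0 (gy x0 y0).
have w3 := mulr_ge0 (mulr_ge0 (ltW L0) (ltW d0)) (enorm_ge0 (gy x0 y0)).
have w4 : L * value x0 <= L * phi Y D f x0.
  by rewrite ler_pM2l // (le_trans v1) // lerBlDr (le_trans v2) // lerDl; lra.
have w5 : L * (value x0 - reg F L tau x0 x0 y0) <=
    L * (2 * DY * enorm (gy x0 y0) + tau / 2 * DY ^+ 2).
  by rewrite ler_pM2l // v3; lra.
have D20 : 0 <= L * (L * DY ^+ 2) by rewrite !mulr_ge0 ?sqr_ge0 // ltW.
move: v8 v9 v10 v11 v12 w1 w2 w3 w4 w5 D20.
move: (phi Y D f x0) (phi_inf X Y D f) (edot (gx x0 y0) _) (edot (gy x0 y0) _).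
move: (edot (_ *: (y0 - ys)) _) (edot (gy x0 y0 - _) _) (edot y0 y0) (enorm _).
move: (L * value x0) (L * (value x0 - _)) (DY) => *.
lra.
Qed.

(** The vectors [xi] and [n] of the state are normal at the iterate, so they are
    candidates in the two distances; removing the regularization costs
    [tau * y]. *)
Lemma residual_bound s : state_inv X Y s ->
  residual X Y D f (st_x s, st_y s) ^+ 2 <=
    edot (gx (st_x s) (st_y s) + st_xi s) (gx (st_x s) (st_y s) + st_xi s)
    + 2 * edot (forcey gy tau s) (forcey gy tau s) + 2 * (tau * DY) ^+ 2.
Proof.
move=> [Xx Yy nx ny].
have dist0_le m (S : set 'rV[R]_m) v : S v -> dist0 S ^+ 2 <= edot v v.
  move=> Sv; rewrite -enorm_sqr.
  have lb : has_lbound [set enorm v | v in S].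
    by exists 0 => _ [w _ <-]; exact: enorm_ge0.
  have h0 : 0 <= dist0 S.
    by apply: lb_le_inf => [|_ [w _ <-]]; [exists (enorm v); exists v|exact: enorm_ge0].
  rewrite ler_sqr ?nnegrE ?enorm_ge0 //; apply: ge_inf => //; by exists v.
rewrite /residual sqr_sqrtr; last by rewrite addr_ge0 // sqr_ge0.
rewrite -addrA; apply: lerD; first by apply: dist0_le; exists (st_xi s).
apply: le_trans (dist0_le _ _ (- gy (st_x s) (st_y s) + st_n s) _) _.
  by exists (st_n s).
have -> : - gy (st_x s) (st_y s) + st_n s = - (forcey gy tau s + tau *: st_y s).
  by rewrite /forcey; apply/rowP => i; rewrite ?mxE; ring.
rewrite edotNl edotNr opprK.
apply: le_trans (norm_sqD2 _ _) _; rewrite mulrDr lerD2l ler_pM2l //.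
rewrite edotZl edotZr mulrA -expr2 exprMn ler_wpM2l ?sqr_ge0 //.
exact: edot_le_max.
Qed.

End Bounds.

(** * Conditional expectation as orthogonality *)

Section PullOut.
Local Open Scope ereal_scope.
Context {R : realType} {d : measure_display} {Om : measurableType d}.
Variable P : probability Om R.
Variable G : set (set Om).
Hypothesis sG : Defs.sub_sigma_algebra G.
Local Notation OmG := (g_sigma_algebraType G).

Definition rmeas (u : Om -> R) := measurable_fun setT (u : OmG -> R).

Lemma sub_measurableE (A : set Om) : measurable (A : set OmG) <-> G A.
Proof.
have [sg _] := sG; split => [mA|GA].
  by have := sigma_algebra_id sg; rewrite /measurable /= in mA * => <-.
exact: sub_sigma_algebra.
Qed.

Lemma sub_measurable_fun d' (T : measurableType d') (u : Om -> T) :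
  measurable_fun setT (u : OmG -> T) -> measurable_fun setT u.
Proof.
move=> mu _ B mB; have := mu measurableT B mB.
by rewrite !setTI => /sub_measurableE /(sG.2).
Qed.

Import HBNNSimple.

Lemma pull_out_nnsfun (Z : Om -> R) (U : {nnsfun OmG >-> R}) :
  measurable_fun setT Z -> (forall o, 0 <= Z o)%R ->
  \int[P]_o (U o * Z o)%:E =
  \sum_(k \in range U) k%:E * \int[P]_(o in U @^-1` [set k]) (Z o)%:E.
Proof.
move=> mZ Z0.
have mA k : measurable (U @^-1` [set k] : set Om).
  by apply: sG.2; apply/sub_measurableE.
have -> : \int[P]_o (U o * Z o)%:E =
  \int[P]_o (\sum_(k \in range U) (k * \1_(U @^-1` [set k]) o * Z o)%:E).
  apply: eq_integral => o _; rewrite fsumEFin //; congr EFin.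
  rewrite {1}fimfunE [RHS]fsbig_finite // fsbig_finite //=.
  by rewrite mulr_suml.
rewrite ge0_integral_fsum //; last 2 first.
- move=> k; apply/measurable_EFinP; apply: measurable_funM => //.
  by apply: measurable_funM => //; exact: measurable_indic.
- by move=> k o _; rewrite lee_fin mulr_ge0 //; have := nnfun_muleindic_ge0 U k o; rewrite -EFinM lee_fin.
apply: eq_fsbigr => k; rewrite inE => -[w _ <-].
rewrite [in RHS]integral_mkcond -ge0_integralZl //; last 3 first.
- by apply/(measurable_restrictT _ _).1 => //; apply: measurable_funTS; exact/measurable_EFinP.
- by move=> x _; apply: erestrict_ge0 => // y _; rewrite lee_fin.
- by rewrite lee_fin.
apply: eq_integral => x _; rewrite /patch indicE.
case: ifPn => _ /=; first by rewrite mulr1 EFinM.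
by rewrite mulr0 mul0r mule0.
Qed.

(** Monotone approximation of the weight by simple functions of [G]. *)
Lemma pull_out (Z V U : Om -> R) :
  measurable_fun setT Z -> measurable_fun setT V ->
  (forall o, 0 <= Z o)%R -> (forall o, 0 <= V o)%R ->
  (forall A, G A -> \int[P]_(o in A) (Z o)%:E = \int[P]_(o in A) (V o)%:E) ->
  rmeas U -> (forall o, 0 <= U o)%R ->
  \int[P]_o (U o * Z o)%:E = \int[P]_o (U o * V o)%:E.
Proof.
move=> mZ mV Z0 V0 ZV mU U0.
have mfU : measurable_fun [set: OmG] (EFin \o U) by exact/measurable_EFinP.
pose U_ := nnsfun_approx measurableT mfU.
have step (W : Om -> R) : measurable_fun setT W -> (forall o, 0 <= W o)%R ->
    \int[P]_o (U o * W o)%:E = limn (fun n => \int[P]_o (U_ n o * W o)%:E).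
  move=> mW W0; rewrite -monotone_convergence //; last 3 first.
  - move=> n; apply/measurable_EFinP; apply: measurable_funM => //.
    by apply: sub_measurable_fun; exact: measurable_funP.
  - by move=> n o _; rewrite lee_fin mulr_ge0.
  - move=> o _ a b ab; rewrite lee_fin ler_wpM2r //.
    by have /lefP := nd_nnsfun_approx measurableT mfU ab; apply.
  apply: eq_integral => o _; apply/esym/cvg_lim => //.
  under eq_fun do rewrite EFinM.
  rewrite EFinM; apply: cvgeMr => //.
  by apply: (@cvg_nnsfun_approx _ _ _ _ measurableT _ mfU) => // x _; rewrite lee_fin.
rewrite !step //; congr (limn _); apply/funext => n.
rewrite !pull_out_nnsfun //; apply: eq_fsbigr => k _; congr (_ * _).
by apply: ZV; apply/sub_measurableE.
Qed.

End PullOut.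

Section L2.
Context {R : realType} {d : measure_display} {Om : measurableType d}.
Variable P : probability Om R.
Implicit Types u v w : Om -> R.

Definition integ u := P.-integrable setT (EFin \o u).
Definition Ex u : R := \int[P]_o u o.
Definition sqint u := measurable_fun setT u /\ integ (fun o => u o ^+ 2).

Lemma integ_meas u : integ u -> measurable_fun setT u.
Proof. by move=> /integrableP[/measurable_EFinP]. Qed.

Lemma integ_cst c : integ (cst c).
Proof. exact: finite_measure_integrable_cst. Qed.

Lemma integD u v : integ u -> integ v -> integ (fun o => u o + v o).
Proof. by move=> iu iv; apply: eq_integrable (integrableD measurableT iu iv). Qed.

Lemma integZ c u : integ u -> integ (fun o => c * u o).
Proof. by move=> iu; apply: eq_integrable (integrableZl measurableT c iu). Qed.

Lemma integB u v : integ u -> integ v -> integ (fun o => u o - v o).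
Proof. by move=> iu iv; apply: eq_integrable (integrableB measurableT iu iv). Qed.

Lemma integ_sum I (s : seq I) (u : I -> Om -> R) :
  (forall i, integ (u i)) -> integ (fun o => \sum_(i <- s) u i o).
Proof.
move=> iu; elim: s => [|a s ih].
  by under eq_fun do rewrite big_nil; exact: integ_cst.
under eq_fun do rewrite big_cons; exact: integD.
Qed.

Lemma integ_dom u v : measurable_fun setT u -> (forall o, `|u o| <= v o) ->
  integ v -> integ u.
Proof.
move=> mu uv; apply: le_integrable => //; first exact/measurable_EFinP.
by move=> o _ /=; rewrite lee_fin (le_trans (uv o)) // ler_norm.
Qed.

Lemma ExD u v : integ u -> integ v -> Ex (fun o => u o + v o) = Ex u + Ex v.
Proof. by move=> iu iv; rewrite /Ex RintegralD. Qed.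

Lemma ExB u v : integ u -> integ v -> Ex (fun o => u o - v o) = Ex u - Ex v.
Proof. by move=> iu iv; rewrite /Ex RintegralB. Qed.

Lemma ExZ c u : integ u -> Ex (fun o => c * u o) = c * Ex u.
Proof. by move=> iu; rewrite /Ex RintegralZl. Qed.

Lemma Ex_cst c : Ex (cst c) = c.
Proof.
rewrite /Ex Rintegral_cst //.
have -> : fine (P setT) = 1 by rewrite probability_setT.
by rewrite mulr1.
Qed.

Lemma Ex_le u v : integ u -> integ v -> (forall o, u o <= v o) -> Ex u <= Ex v.
Proof. by move=> iu iv uv; rewrite /Ex le_Rintegral. Qed.

Lemma Ex_sum I (s : seq I) (u : I -> Om -> R) : (forall i, integ (u i)) ->
  Ex (fun o => \sum_(i <- s) u i o) = \sum_(i <- s) Ex (u i).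
Proof.
move=> iu; elim: s => [|a s ih].
  by under eq_fun do rewrite big_nil; rewrite big_nil Ex_cst.
under eq_fun do rewrite big_cons.
by rewrite ExD ?big_cons ?ih //; exact: integ_sum.
Qed.

Lemma EFin_Ex u : integ u -> (\int[P]_o (u o)%:E)%E = (Ex u)%:E.
Proof. by move=> iu; rewrite /Ex /Rintegral fineK // integrable_fin_num. Qed.

Lemma sqint_mul u v : sqint u -> sqint v -> integ (fun o => u o * v o).
Proof.
move=> [mu iu] [mv iv]; apply: (integ_dom _ _ (integD iu iv)).
  exact: measurable_funM.
move=> o; rewrite normrM -(real_normK (num_real (u o))) -(real_normK (num_real (v o))).
have := sqr_ge0 (`|u o| - `|v o|).
have := mulr_ge0 (normr_ge0 (u o)) (normr_ge0 (v o)); rewrite sqrrB; lra.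
Qed.

Lemma sqint_cst c : sqint (cst c).
Proof. by split; [exact: measurable_cst|exact: (integ_cst (c ^+ 2))]. Qed.

Lemma sqint_dom u w : measurable_fun setT u -> integ w ->
  (forall o, u o ^+ 2 <= w o) -> sqint u.
Proof.
move=> mu iw uw; split=> //; apply: integ_dom iw; first exact: measurable_funX.
by move=> o; rewrite ger0_norm ?sqr_ge0.
Qed.

Lemma sqintD u v : sqint u -> sqint v -> sqint (fun o => u o + v o).
Proof.
move=> [mu iu] [mv iv]; apply: (sqint_dom _ (integZ 2 (integD iu iv))).
  exact: measurable_funD.
move=> o /=; have := sqr_ge0 (u o - v o); rewrite sqrrB sqrrD; lra.
Qed.

Lemma sqintZ c u : sqint u -> sqint (fun o => c * u o).
Proof.
move=> [mu iu]; split; first exact: measurable_funM.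
by have := integZ (c ^+ 2) iu; congr integ; apply/funext => o; rewrite exprMn.
Qed.

Lemma sqintB u v : sqint u -> sqint v -> sqint (fun o => u o - v o).
Proof.
move=> su sv; have := sqintD su (sqintZ (-1) sv).
by congr sqint; apply/funext => o; rewrite mulN1r.
Qed.

Section Orthogonality.
Variable G : set (set Om).
Hypothesis sG : Defs.sub_sigma_algebra G.
Local Notation OmG := (g_sigma_algebraType G).

Lemma borel_rmeas u : borel_measurable G u -> rmeas G u.
Proof.
move=> bu; apply: (measurability _ (RGenOpens.measurableE R)).
move=> _ [B [a [b BE]] <-]; rewrite setTI; apply/(sub_measurableE sG).
by apply: bu; rewrite BE; exact: interval_open.
Qed.

Lemma rmeas_meas u : rmeas G u -> measurable_fun setT u.
Proof. exact: (sub_measurable_fun sG). Qed.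

Let orth_ge0 Z V U : cond_exp P G Z V -> sqint Z -> sqint V ->
  rmeas G U -> sqint U -> (forall o, 0 <= U o) ->
  Ex (fun o => U o * (Z o - V o)) = 0.
Proof.
move=> [mZ [Vp [Vn [[bp p0 hp] [bn n0 hn] VE]]]] sZ sV mU sU U0.
have mp := rmeas_meas (borel_rmeas bp); have mn := rmeas_meas (borel_rmeas bn).
have mUO := rmeas_meas mU.
have iUZ := sqint_mul sU sZ; have iUV := sqint_mul sU sV.
have mZp := measurable_funrpos mZ; have mZn := measurable_funrneg mZ.
have iZp : integ (fun o => U o * Z^\+ o).
  apply: (integ_dom _ _ (integrable_norm iUZ)); first exact: measurable_funM.
  move=> o /=; rewrite !normrM ler_wpM2l // ger0_norm ?funrpos_ge0 //.
  by have /(congr1 (@^~ o)) /= <- := funrposDneg Z; rewrite lerDl funrneg_ge0.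
have iZn : integ (fun o => U o * Z^\- o).
  apply: (integ_dom _ _ (integrable_norm iUZ)); first exact: measurable_funM.
  move=> o /=; rewrite !normrM ler_wpM2l // ger0_norm ?funrneg_ge0 //.
  by have /(congr1 (@^~ o)) /= <- := funrposDneg Z; rewrite lerDr funrpos_ge0.
have ep := pull_out sG mZp mp (funrpos_ge0 Z) p0 hp mU U0.
have en := pull_out sG mZn mn (funrneg_ge0 Z) n0 hn mU U0.
have fin (v : Om -> R) (e : R) : measurable_fun setT v -> (forall o, 0 <= v o) ->
    (e%:E = \int[P]_o (U o * v o)%:E)%E -> integ (fun o => U o * v o).
  move=> mv v0 ee; apply/integrableP; split.
    by apply/measurable_EFinP; exact: measurable_funM.
  under eq_integral => o _ do rewrite /= ger0_norm ?mulr_ge0 //.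
  by rewrite -ee ltry.
rewrite (EFin_Ex iZp) in ep; rewrite (EFin_Ex iZn) in en.
have iVp := fin _ _ mp p0 ep; have iVn := fin _ _ mn n0 en.
rewrite (EFin_Ex iVp) in ep; rewrite (EFin_Ex iVn) in en.
case: ep => ep; case: en => en.
have eV : Ex (fun o => U o * V o) = Ex (fun o => U o * Vp o - U o * Vn o).
  rewrite /Ex /Rintegral; congr fine; apply: ae_eq_integral => //.
  - exact/measurable_EFinP/integ_meas.
  - by apply/measurable_EFinP/integ_meas; exact: integB.
  - by apply: filterS VE => o VE _ /=; rewrite VE mulrBr.
have eZ : Ex (fun o => U o * Z o) = Ex (fun o => U o * Z^\+ o - U o * Z^\- o).
  congr Ex; apply/funext => o; rewrite -mulrBr; congr (_ * _).
  by have /(congr1 (@^~ o)) /= <- := funrposBneg Z.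
under [X in Ex X]eq_fun do rewrite mulrBr.
by rewrite ExB // eV eZ !ExB // ep en subrr.
Qed.

(** The defining property of [cond_exp] concerns positive and negative parts, hence
    the splitting of both factors; square integrability makes the resulting
    products integrable. *)
Lemma condexp_orth Z V U : cond_exp P G Z V -> sqint Z -> sqint V ->
  rmeas G U -> sqint U -> Ex (fun o => U o * (Z o - V o)) = 0.
Proof.
move=> cZ sZ sV mU sU.
have mUO := rmeas_meas mU.
have mp : rmeas G (U^\+) by exact: measurable_funrpos.
have mn : rmeas G (U^\-) by exact: measurable_funrneg.
have np o : `|U o| = U^\+ o + U^\- o.
  by have /(congr1 (@^~ o)) /= <- := funrposDneg U.
have sp : sqint (U^\+).
  apply: (sqint_dom (rmeas_meas mp) sU.2) => o.
  rewrite -(real_normK (num_real (U o))) ler_sqr ?nnegrE ?funrpos_ge0 // np.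
  by rewrite lerDl funrneg_ge0.
have sn : sqint (U^\-).
  apply: (sqint_dom (rmeas_meas mn) sU.2) => o.
  rewrite -(real_normK (num_real (U o))) ler_sqr ?nnegrE ?funrneg_ge0 // np.
  by rewrite lerDr funrpos_ge0.
have e1 := orth_ge0 cZ sZ sV mp sp (funrpos_ge0 U).
have e2 := orth_ge0 cZ sZ sV mn sn (funrneg_ge0 U).
have -> : (fun o => U o * (Z o - V o)) =
   (fun o => U^\+ o * (Z o - V o) - U^\- o * (Z o - V o)).
  apply/funext => o; rewrite -mulrBl; congr (_ * _).
  by have /(congr1 (@^~ o)) /= <- := funrposBneg U.
rewrite ExB ?e1 ?e2 ?subrr //; apply: sqint_mul => //; exact: sqintB.
Qed.

(** The conditional expectation of the negative part integrates to 0, so it vanishes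
    almost everywhere; the bound on the positive part is integrated over the
    whole space. *)
Lemma condexp_bound Z c : (forall o, 0 <= Z o) ->
  (exists V, cond_exp P G Z V /\ {ae P, forall o, V o <= c}) ->
  integ Z /\ Ex Z <= c.
Proof.
move=> Z0 [V [[mZ [Vp [Vn [[bp p0 hp] [bn n0 hn] VE]]]] Vc]].
have [sG1 sG2] := sG.
have GT : G setT.
  by rewrite -(setD0 setT); case: sG1 => h0 hD _; exact: hD.
have ZpE : Z^\+ = Z by apply/funext => o; apply: (ge0_funrposE (D := setT)) => //; rewrite inE.
have ZnE : Z^\- = cst 0 by apply/funext => o; apply: (ge0_funrnegE (D := setT)) => //; rewrite inE.
have mp := rmeas_meas (borel_rmeas bp); have mn := rmeas_meas (borel_rmeas bn).
have Vn0 : ae_eq P setT (EFin \o Vn) (cst 0%E).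
  apply/ae_eq_integral_abs => //; first exact/measurable_EFinP.
  under eq_integral => o _ do rewrite /= ger0_norm ?n0 //.
  rewrite -(hn _ GT) ZnE; exact: integral0.
have Vpc : {ae P, forall o, setT o -> ((Vp o)%:E <= (Num.max 0 c)%:E)%E}.
  apply: filterS3 VE Vc Vn0 => o e1 e2 e3 _; rewrite lee_fin le_max.
  by have [e3'] := e3 Logic.I; rewrite e1 e3' subr0 in e2; rewrite e2 orbT.
have c0 : 0 <= c.
  have : {ae P, forall o : Om, 0 <= c}.
    apply: filterS3 VE Vc Vn0 => o e1 e2 e3.
    by have [e3'] := e3 Logic.I; rewrite e1 e3' subr0 in e2; exact: le_trans e2.
  move=> [A [mA A0 sub]]; rewrite leNgt; apply/negP => clt.
  have : A = setT by rewrite -subTset => o _; apply: sub => /=; apply/negP; rewrite -ltNge.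
  move=> AT; move: A0; have PT : P setT = 1%E := probability_setT P.
  rewrite AT PT => /eqP.
  by rewrite onee_eq0.
have bd : (\int[P]_o (Z o)%:E <= c%:E)%E.
  rewrite -[X in (\int[P]_o (X o)%:E)%E]ZpE (hp _ GT).
  apply: (@le_trans _ _ (\int[P]_o (c%:E))%E).
    apply: ae_ge0_le_integral => //.
    - by move=> o _; rewrite lee_fin.
    - exact/measurable_EFinP.
    - by apply: filterS Vpc => o /(_ Logic.I); rewrite (max_idPr c0).
  have PT : P setT = 1%E := probability_setT P.
  by rewrite integral_cst //= PT mule1.
have iZ : integ Z.
  apply/integrableP; split; first exact/measurable_EFinP.
  under eq_integral => o _ do rewrite /= ger0_norm ?Z0 //.
  by rewrite (le_lt_trans bd) // ltry.
by split => //; rewrite -lee_fin -EFin_Ex.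
Qed.

End Orthogonality.

End L2.

(** * Measurability of random vectors *)

Section Borel.
Context {R : realType} {d : measure_display} {Om : measurableType d}.
Variable G : set (set Om).
Hypothesis sG : Defs.sub_sigma_algebra G.
Local Notation OmG := (g_sigma_algebraType G).

Definition vmeas n (u : Om -> 'rV[R]_n) := forall i, rmeas G (fun o => u o 0 i).

(** Passing from the preimage of an open set to its interior loses no value of [u],
    because [h] is continuous there. *)
Lemma borel_comp (T T' : topologicalType) (S : set T) (u : Om -> T) (h : T -> T') :
  borel_measurable G u -> (forall o, S (u o)) ->
  (forall z, S z -> {for z, continuous h}) -> borel_measurable G (h \o u).
Proof.
move=> bu Su ch U oU.
have -> : (h \o u) @^-1` U = u @^-1` ((h @^-1` U)^°).
  apply/seteqP; split => o /=; last exact: (@interior_subset _ (h @^-1` U)).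
  move=> Uh; apply: (ch _ (Su o)); exact: open_nbhs_nbhs.
by apply: bu; exact: open_interior.
Qed.

Lemma borel_vmeas n (u : Om -> 'rV[R]_n) : borel_measurable G u -> vmeas u.
Proof.
move=> bu i; apply: (borel_rmeas sG).
apply: (@borel_comp _ _ setT u (fun z : 'rV[R]_n => z 0 i)) => // z _.
exact: coord_continuous.
Qed.

Lemma borel_fst (T T' : topologicalType) (u : Om -> T * T') :
  borel_measurable G u -> borel_measurable G (fun o => (u o).1).
Proof. by move=> bu; apply: (@borel_comp _ _ setT u fst) => // z _; exact: cvg_fst. Qed.

Lemma borel_snd (T T' : topologicalType) (u : Om -> T * T') :
  borel_measurable G u -> borel_measurable G (fun o => (u o).2).
Proof. by move=> bu; apply: (@borel_comp _ _ setT u snd) => // z _; exact: cvg_snd. Qed.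

(** Rational boxes form a countable base, so measurability may be checked
    coordinate by coordinate. *)
Lemma vmeas_borel n p (u : Om -> 'rV[R]_n) (v : Om -> 'rV[R]_p) :
  vmeas u -> vmeas v -> borel_measurable G (fun o => (u o, v o)).
Proof.
move=> mu mv U oU; apply/(sub_measurableE sG).
pose box (q : 'rV[rat]_n * 'rV[rat]_p * nat) (z : 'rV[R]_n * 'rV[R]_p) :=
  (forall l, `|z.1 0 l - ratr (q.1.1 0 l)| < q.2.+1%:R^-1) /\
  (forall l, `|z.2 0 l - ratr (q.1.2 0 l)| < q.2.+1%:R^-1).
pose w o := (u o, v o).
have -> : w @^-1` U = \bigcup_(q in [set q | box q `<=` U]) (w @^-1` box q).
  apply/seteqP; split => o /=; last by move=> [q /= qU] /qU.
  move=> Uw; have /nbhs_ballP[e /= e0 eU] := open_nbhs_nbhs (conj oU Uw).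
  have [k ke] : exists k : nat, k.+1%:R^-1 < e / 2.
    have e2 : 0 < e / 2 by rewrite divr_gt0.
    have [k _ /(_ _ (leqnn _)) hk] := near_infty_natSinv_lt (PosNum e2).
    by exists k.
  have kp : (0 : R) < k.+1%:R^-1 by rewrite invr_gt0.
  have near_rat (x : R) : exists q : rat, `|x - ratr q| < k.+1%:R^-1.
    move: kp; set r := _^-1 => kp.
    have [q] := @rat_in_itvoo R (x - r) (x + r) ltac:(lra).
    rewrite in_itv /= => /andP[q1 q2]; exists q; rewrite ltr_norml; apply/andP; split; lra.
  have [a ha] : exists a : 'rV[rat]_n, forall l, `|u o 0 l - ratr (a 0 l)| < k.+1%:R^-1.
    have [a ha] := choice (fun l => near_rat (u o 0 l)).
    by exists (\row_l a l) => l; rewrite mxE.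
  have [b hb] : exists b : 'rV[rat]_p, forall l, `|v o 0 l - ratr (b 0 l)| < k.+1%:R^-1.
    have [b hb] := choice (fun l => near_rat (v o 0 l)).
    by exists (\row_l b l) => l; rewrite mxE.
  move: ke kp ha hb; set r := _^-1 => ke kp ha hb.
  exists (a, b, k) => //= z [za zb]; apply: eU; split => /=; split => // i j; rewrite !ord1.
    have := za j; have := ha j; rewrite -/r -ball_normE /= => h1 h2.
    rewrite (_ : _ - _ = (u o 0 j - ratr (a 0 j)) - (z.1 0 j - ratr (a 0 j))); last by ring.
    by apply: le_lt_trans (ler_normB _ _) _; lra.
  have := zb j; have := hb j; rewrite -/r -ball_normE /= => h1 h2.
  rewrite (_ : _ - _ = (v o 0 j - ratr (b 0 j)) - (z.2 0 j - ratr (b 0 j))); last by ring.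
  by apply: le_lt_trans (ler_normB _ _) _; lra.
have mstrip m (x : Om -> 'rV[R]_m) (c : 'rV[rat]_m) (e : R) l : vmeas x ->
    measurable ([set o | `|x o 0 l - ratr (c 0 l)| < e] : set OmG).
  move=> mx.
  have mf : measurable_fun [set: OmG] (fun o => `|x o 0 l - ratr (c 0 l)|).
    apply: measurableT_comp => //; apply: measurable_funB => //; exact: mx.
  have := mf measurableT _ (measurable_itv `]-oo, e[); rewrite setTI.
  by congr measurable; apply/seteqP; split => o /=; rewrite in_itv.
have mbox q : measurable (w @^-1` box q : set OmG).
  have -> : w @^-1` box q =
    (\bigcap_(l in [set: 'I_n]) [set o | `|u o 0 l - ratr (q.1.1 0 l)| < q.2.+1%:R^-1]) `&`
    (\bigcap_(l in [set: 'I_p]) [set o | `|v o 0 l - ratr (q.1.2 0 l)| < q.2.+1%:R^-1]).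
    apply/seteqP; split => o /= [h1 h2]; split => l; [move=> _| move=> _| |];
      by [exact: h1|exact: h2|apply: h1|apply: h2].
  apply: measurableI; apply: fin_bigcap_measurable => // l _; exact: mstrip.
rewrite bigcup_mkcond; apply: countable_bigcupT_measurable => [|q]; first exact: countableP.
by case: ifP.
Qed.

(** The squared Euclidean norm is at most [n] times the squared sup norm, which
    defines the topology. *)
Lemma lip_continuous n m (h : 'rV[R]_n -> 'rV[R]_m) (c : R) : 0 <= c ->
  (forall x y, edot (h x - h y) (h x - h y) <= c * edot (x - y) (x - y)) ->
  continuous h.
Proof.
move=> c0 hl x; apply/(@cvgrPdist_lt _ _ _ (nbhs x) (nbhs_filter x)) => e e0.
pose K := c * n%:R + 1.
have K0 : 0 < K by rewrite ltr_wpDl // mulr_ge0.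
have e2 : 0 < Num.sqrt (e ^+ 2 / K) by rewrite sqrtr_gt0 divr_gt0 // exprn_gt0.
near=> y.
have xy : `|x - y| < Num.sqrt (e ^+ 2 / K).
  near: y; apply/nbhs_ballP; exists (Num.sqrt (e ^+ 2 / K)) => //= y.
  by rewrite -ball_normE.
rewrite -ltr_sqr ?nnegrE ?(ltW e0) //.
apply: (@le_lt_trans _ _ (c * (n%:R * `|x - y| ^+ 2))).
  apply: (@le_trans _ _ (edot (h x - h y) (h x - h y))).
    by rewrite -enorm_sqr ler_sqr ?nnegrE ?enorm_ge0 // mx_norm_le_enorm.
  by apply: le_trans (hl _ _) _; rewrite ler_wpM2l // edot_le_mx_norm.
have : `|x - y| ^+ 2 < e ^+ 2 / K.
  rewrite -[ltRHS]sqr_sqrtr; last by rewrite divr_ge0 ?sqr_ge0 // ltW.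
  by rewrite ltr_sqr ?nnegrE // ltW.
rewrite ltr_pdivlMr // => lt; apply: le_lt_trans lt.
rewrite mulrA [leRHS]mulrC ler_wpM2r ?sqr_ge0 // /K lerDl; lra.
Unshelve. all: by end_near. Qed.

End Borel.

(** * Independence from the past *)

Section Filtration.
Context {R : realType} {d : measure_display} {Om : measurableType d}.
Variable P : probability Om R.
Context {dW : measure_display} {W : measurableType dW}.
Context {I : finType}.
Variables (Z : I -> {RV P >-> W}) (rk : I -> nat).

(** The rank is the position of a sample in the order of the queries, so this is the
    information available before the query of rank [k]. *)
Definition past (k : nat) : set (set Om) :=
  <<s \bigcup_(i in [set i | (rk i < k)%N]) sigma_of (Z i : Om -> W) >>.

Lemma sigma_of_measurable (i : I) : sigma_of (Z i : Om -> W) `<=` measurable.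
Proof.
move=> _ [B mB <-]; have := @measurable_funPTI _ _ _ _ (Z i) B mB.
by rewrite setTI.
Qed.

Lemma past_sub k : Defs.sub_sigma_algebra (past k).
Proof.
split; first exact: smallest_sigma_algebra.
apply: smallest_sub; first exact: sigma_algebra_measurable.
by move=> A [i _] /sigma_of_measurable.
Qed.

Lemma past_mono k l : (k <= l)%N -> past k `<=` past l.
Proof.
move=> kl; apply: sub_sigma_algebra2 => A [i /= ik Ai]; exists i => //=.
exact: leq_trans kl.
Qed.

Lemma past_step k i (G : set (set Om)) : (rk i < k)%N -> G `<=` past k ->
  <<s G `|` sigma_of (Z i : Om -> W) >> `<=` past k.
Proof.
move=> ik Gk; apply: smallest_sub; first exact: smallest_sigma_algebra.
by move=> A [/Gk//|Ai]; apply: sub_sigma_algebra; exists i.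
Qed.

Hypothesis ind : mutually_independent P (fun i => Z i : Om -> W).

(** The product rule holds for the cylinders over the earlier samples by mutual
    independence; they are stable under intersection and generate the past, so
    Dynkin's lemma extends it. *)
Lemma past_independent k i : (k <= rk i)%N ->
  Defs.independent P (sigma_of (Z i : Om -> W)) (past k).
Proof.
move=> ki A C [B mB <-] pC; rewrite setTI.
have mZ j (S : set W) : measurable S -> measurable (Z j @^-1` S).
  by move=> mS; have := @measurable_funPTI _ _ _ _ (Z j) S mS; rewrite ?setTI.
pose cyl : set (set Om) := [set E | exists S : I -> set W,
  [/\ forall j, measurable (S j), forall j, (k <= rk j)%N -> S j = setT &
      E = \bigcap_j (Z j @^-1` S j)]].
have cylI : setI_closed cyl.
  move=> _ _ [S [mS S1 ->]] [S' [mS' S1' ->]]; exists (fun j => S j `&` S' j); split.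
  - by move=> j; apply: measurableI.
  - by move=> j kj; rewrite S1 // S1' // setTI.
  - by rewrite -bigcapI.
have cylm : cyl `<=` measurable.
  move=> _ [S [mS _ ->]]; apply: fin_bigcap_measurable => // j _; exact: mZ.
have past_cyl : past k `<=` <<s cyl >>.
  apply: sub_sigma_algebra2 => E [j /= jk [S mS <-]].
  exists (fun l => if l == j then S else setT); split.
  - by move=> l; case: ifP.
  - by move=> l kl; case: eqP => // lj; move: jk; rewrite -lj ltnNge kl.
  - rewrite setTI; apply/seteqP; split => o /=.
      by move=> So l _ /=; case: eqP => // ->.
    by move=> /(_ j Logic.I) /=; rewrite eqxx.
pose good : set (set Om) := [set E | measurable E /\
   P (Z i @^-1` B `&` E) = (P (Z i @^-1` B) * P E)%E].
suff : past k `<=` good by move=> /(_ _ pC) [].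
apply: subset_trans past_cyl _.
apply: lambda_system_subset => //; last first.
  move=> _ [S [mS S1 ->]]; split; first by apply: cylm; exists S.
  pose S' j := if j == i then B else S j.
  have -> : Z i @^-1` B `&` \bigcap_j Z j @^-1` S j = \bigcap_j Z j @^-1` S' j.
    apply/seteqP; split => o /=.
      by move=> [Bo So] j _; rewrite /S' /=; case: eqP => [->//|_]; exact: So.
    move=> h; split; first by have := h i Logic.I; rewrite /S' /= eqxx.
    move=> j _; have := h j Logic.I; rewrite /S' /=; case: eqP => // -> _.
    by rewrite S1.
  rewrite !ind //; last by move=> j; rewrite /S'; case: ifP.
  rewrite (bigD1 i) //= [in RHS](bigD1 i) //= /S' eqxx S1 // preimage_setT.
  have PT : P setT = 1%E := probability_setT P.
  rewrite PT mul1e; congr (_ * _)%E; apply: eq_bigr => j /negbTE ji.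
  by rewrite ji.
have mB' := mZ i _ mB.
have fin A' : measurable A' -> P A' \is a fin_num by move=> mA'; exact: fin_num_measure.
apply/dynkin_lambda_system; split => /=.
- have PT : P setT = 1%E := probability_setT P.
  by split; [exact: measurableT|rewrite setIT PT mule1].
- move=> E [mE PE]; split; first exact: measurableC.
  have mAE := measurableI _ _ mB' mE.
  have fB := fin _ mB'.
  have e1 : P (Z i @^-1` B `\` E) = (P (Z i @^-1` B) - P (Z i @^-1` B `&` E))%E.
    by apply: measureD => //; rewrite -ge0_fin_numE.
  have e2 : P (~` E) = (1 - P E)%E by exact: probability_setC.
  by rewrite -setDE e1 PE e2 muleBr ?mule1 // fin_num_adde_defl // fin_numN fin.
- move=> F tF HF.
  have mF j : measurable (F j) by case: (HF j).
  split; first exact: bigcupT_measurable.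
  have e1 : P (\bigcup_j F j) = (\sum_(j <oo) P (F j))%E.
    rewrite [LHS](measure_bigcup P) //; apply: eq_eseriesl => j.
    by rewrite in_setT.
  have e2 : P (\bigcup_j (Z i @^-1` B `&` F j)) = (\sum_(j <oo) P (Z i @^-1` B `&` F j))%E.
    rewrite [LHS](measure_bigcup P) //; last 2 first.
    - by move=> j _; exact: measurableI.
    - exact: trivIset_setIl.
    by apply: eq_eseriesl => j; rewrite in_setT.
  rewrite setI_bigcupr e1 e2 -(fineK (fin _ mB')) -nneseriesZl //.
  by apply: eq_eseriesr => j _; rewrite fineK ?fin //; case: (HF j).
Qed.

End Filtration.

(** * Square integrable random vectors and oracle answers *)

Section VectorL2.
Context {R : realType} {d : measure_display} {Om : measurableType d}.
Variable P : probability Om R.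
Implicit Types (G : set (set Om)).

Definition vL2 G n (u : Om -> 'rV[R]_n) :=
  forall i, rmeas G (fun o => u o 0 i) /\ sqint P (fun o => u o 0 i).

Definition pL2 G n p (u : Om -> 'rV[R]_n * 'rV[R]_p) :=
  vL2 G (fun o => (u o).1) /\ vL2 G (fun o => (u o).2).

Lemma vL2_mono G G' n (u : Om -> 'rV[R]_n) : Defs.sub_sigma_algebra G ->
  Defs.sub_sigma_algebra G' -> G `<=` G' -> vL2 G u -> vL2 G' u.
Proof.
move=> sG sG' GG' uL i; have [mu su] := uL i; split => // mT B mB.
have := mu measurableT B mB; rewrite !setTI => /(sub_measurableE sG) h.
by apply/(sub_measurableE sG'); exact: GG'.
Qed.

Lemma vL2D G n (u v : Om -> 'rV[R]_n) : vL2 G u -> vL2 G v ->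
  vL2 G (fun o => u o + v o).
Proof.
move=> uL vL i; have [mu su] := uL i; have [mv sv] := vL i.
under eq_fun do rewrite mxE.
by split; [exact: measurable_funD|exact: sqintD].
Qed.

Lemma vL2Z G n c (u : Om -> 'rV[R]_n) : vL2 G u -> vL2 G (fun o => c *: u o).
Proof.
move=> uL i; have [mu su] := uL i; under eq_fun do rewrite mxE.
by split; [exact: measurable_funM|exact: sqintZ].
Qed.

Lemma vL2N G n (u : Om -> 'rV[R]_n) : vL2 G u -> vL2 G (fun o => - u o).
Proof. by move=> /(vL2Z (-1)); under eq_fun do rewrite scaleN1r. Qed.

Lemma vL2B G n (u v : Om -> 'rV[R]_n) : vL2 G u -> vL2 G v ->
  vL2 G (fun o => u o - v o).
Proof. by move=> uL /vL2N; exact: vL2D. Qed.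

Lemma vL2_cst G n (c : 'rV[R]_n) : vL2 G (fun=> c).
Proof. by move=> i; split; [exact: measurable_cst|exact: (sqint_cst _ (c 0 i))]. Qed.

Lemma integ_edot G n (u v : Om -> 'rV[R]_n) : vL2 G u -> vL2 G v ->
  integ P (fun o => edot (u o) (v o)).
Proof.
move=> uL vL; rewrite /edot; apply: integ_sum => i.
by apply: sqint_mul; [case: (uL i)|case: (vL i)].
Qed.

Lemma coord_sq n (x : 'rV[R]_n) i : x 0 i ^+ 2 <= edot x x.
Proof.
by rewrite /edot (bigD1 i) //= expr2 lerDl sumr_ge0 // => l _; rewrite -expr2 sqr_ge0.
Qed.

Lemma vL2_dom G n (u : Om -> 'rV[R]_n) (b : Om -> R) :
  Defs.sub_sigma_algebra G -> vmeas G u -> integ P b ->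
  (forall o, edot (u o) (u o) <= b o) -> vL2 G u.
Proof.
move=> sG mu ib ub i; split; first exact: mu.
apply: (sqint_dom _ ib); first exact: (rmeas_meas sG).
by move=> o; exact: le_trans (coord_sq _ _) (ub o).
Qed.

Lemma vL2_vmeas G n (u : Om -> 'rV[R]_n) : vL2 G u -> vmeas G u.
Proof. by move=> uL i; case: (uL i). Qed.

Lemma vL2_borel G n (u : Om -> 'rV[R]_n) : Defs.sub_sigma_algebra G ->
  vL2 G u -> borel_measurable G u.
Proof.
move=> sG /vL2_vmeas mu.
have b := vmeas_borel sG mu (fun i : 'I_0 => vL2_vmeas (vL2_cst G (0 : 'rV[R]_0)) i).
exact: (borel_fst b).
Qed.

(** This covers the projections and the dependence of the saddle point on the
    centre. *)
Lemma vL2_lip G n m (h : 'rV[R]_n -> 'rV[R]_m) (c : R) (u : Om -> 'rV[R]_n) :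
  Defs.sub_sigma_algebra G -> 0 <= c ->
  (forall x y, edot (h x - h y) (h x - h y) <= c * edot (x - y) (x - y)) ->
  vL2 G u -> vL2 G (fun o => h (u o)).
Proof.
move=> sG c0 hl uL.
apply: (@vL2_dom _ _ _ (fun o => 2 * (c * edot (u o) (u o) + edot (h 0) (h 0)))) => //.
- apply: (borel_vmeas sG).
  apply: (borel_comp (S := setT) (h := h) (vL2_borel sG uL)) => // z _.
  exact: (lip_continuous c0 hl).
- apply: integZ; apply: integD; last exact: (integ_cst P (edot (h 0) (h 0))).
  apply: integZ; exact: (integ_edot uL uL).
- move=> o; have := norm_sqD2 (h (u o) - h 0) (h 0); rewrite subrK.
  by have := hl (u o) 0; rewrite subr0; lra.
Qed.

Section Pair.
Context {n p : nat}.
Local Notation E := ('rV[R]_n * 'rV[R]_p)%type.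
Implicit Types u v : Om -> E.

Lemma pL2_mono G G' u : Defs.sub_sigma_algebra G ->
  Defs.sub_sigma_algebra G' -> G `<=` G' -> pL2 G u -> pL2 G' u.
Proof. by move=> sG sG' GG' [u1 u2]; split; exact: (vL2_mono sG sG' GG'). Qed.

Lemma pL2D G u v : pL2 G u -> pL2 G v -> pL2 G (fun o => u o + v o).
Proof. by move=> [u1 u2] [v1 v2]; split; exact: vL2D. Qed.

Lemma pL2B G u v : pL2 G u -> pL2 G v -> pL2 G (fun o => u o - v o).
Proof. by move=> [u1 u2] [v1 v2]; split; exact: vL2B. Qed.

Lemma pL2Z G c u : pL2 G u -> pL2 G (fun o => c *: u o).
Proof. by move=> [u1 u2]; split; exact: vL2Z. Qed.

Lemma pL2_borel G u : Defs.sub_sigma_algebra G -> pL2 G u -> borel_measurable G u.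
Proof.
move=> sG [u1 u2]; have := vmeas_borel sG (vL2_vmeas u1) (vL2_vmeas u2).
by congr borel_measurable; apply/funext => o; rewrite -surjective_pairing.
Qed.

Lemma integ_sq_norm G u : pL2 G u -> integ P (fun o => sq_norm (u o)).
Proof. by move=> [u1 u2]; apply: integD; [exact: (integ_edot u1 u1)|exact: (integ_edot u2 u2)]. Qed.

End Pair.

End VectorL2.

Lemma coord_subl {R : realType} n p (u v : 'rV[R]_n * 'rV[R]_p) i :
  (u - v).1 0 i = u.1 0 i - v.1 0 i.
Proof. by rewrite !mxE. Qed.

Lemma coord_subr {R : realType} n p (u v : 'rV[R]_n * 'rV[R]_p) i :
  (u - v).2 0 i = u.2 0 i - v.2 0 i.
Proof. by rewrite !mxE. Qed.

Section Oracle.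
Context {R : realType} {n p : nat}.
Local Notation E := ('rV[R]_n * 'rV[R]_p)%type.
Context {dW : measure_display} {W : measurableType dW}.
Variables (X : set 'rV[R]_n) (Y : set 'rV[R]_p).
Variables (D : probability W R) (f : E -> W -> R) (L sigma : R).
Context {d : measure_display} {Om : measurableType d}.
Variable P : probability Om R.
Hypothesis SA : standing_assumptions X Y D f L.
Hypothesis oracle : stochastic_oracle P X Y D f sigma.
Local Notation gF := (grad (meanF D f)).

Lemma grad_continuous z : (X `*` Y) z -> {for z, continuous gF}.
Proof. by have [U [_ XYU HU]] := F_C1 SA; move=> /XYU /HU []. Qed.

(** The gradient is bounded by its value at a fixed point plus [L] times the
    distance to it. *)
Lemma grad_pL2 (G : set (set Om)) (u : Om -> E) : Defs.sub_sigma_algebra G ->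
  (forall o, (X `*` Y) (u o)) -> pL2 P G u -> pL2 P G (fun o => gF (u o)).
Proof.
move=> sG XYu uL.
have [x0 Xx0] := X_nonempty SA; have [y0 Yy0] := Y_nonempty SA.
have bg : borel_measurable G (fun o => gF (u o)).
  by apply: (borel_comp (pL2_borel sG uL) XYu) => z; exact: grad_continuous.
pose z0 : E := (x0, y0).
pose b o := 2 * (L ^+ 2 * sq_norm (u o - z0) + sq_norm (gF z0)).
have ib : integ P b.
  apply: integZ; apply: integD; last exact: (integ_cst P (sq_norm (gF z0))).
  apply: integZ; apply: (@integ_sq_norm _ _ _ _ _ _ G); apply: pL2B => //.
  by split; exact: vL2_cst.
have key o : sq_norm (gF (u o)) <= b o.
  have := grad_lip_edot SA (XYu o) (conj Xx0 Yy0 : (X `*` Y) z0).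
  have := norm_sqD2 ((gF (u o)).1 - (gF z0).1) (gF z0).1.
  have := norm_sqD2 ((gF (u o)).2 - (gF z0).2) (gF z0).2.
  rewrite !subrK /b /sq_norm /=.
  move: (edot (gF (u o)).1 _) (edot (gF (u o)).2 _) (edot (gF z0).1 _) (edot (gF z0).2 _).
  move: (edot ((gF (u o)).1 - _) _) (edot ((gF (u o)).2 - _) _).
  by move: (_ + edot ((u o).2 - _) _) => *; lra.
split.
  apply: (vL2_dom sG (borel_vmeas sG (borel_fst bg)) ib) => o.
  by apply: le_trans (key o); rewrite lerDl edot_ge0.
apply: (vL2_dom sG (borel_vmeas sG (borel_snd bg)) ib) => o.
by apply: le_trans (key o); rewrite lerDr edot_ge0.
Qed.

(** Only the error is known to be square integrable at first; adding the gradient at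
    the query, which is square integrable by [grad_pL2], gives the same for the
    answer, and the conditional statements of the oracle can be integrated. *)
Lemma sample_noise (G : set (set Om)) (u : Om -> E) (w : {RV P >-> W}) :
  Defs.sub_sigma_algebra G -> (forall o, (X `*` Y) (u o)) -> pL2 P G u ->
  has_law D w -> Defs.independent P (sigma_of w) G ->
  let N := fun o => sgrad f (w o) (u o) - gF (u o) in
  let G' := <<s G `|` sigma_of w >> in
  [/\ Defs.sub_sigma_algebra G' -> pL2 P G' N,
      Ex P (fun o => sq_norm (N o)) <= sigma ^+ 2,
      forall U, vL2 P G U -> Ex P (fun o => edot (U o) (N o).1) = 0 &
      forall U, vL2 P G U -> Ex P (fun o => edot (U o) (N o).2) = 0].
Proof.
move=> sG XYu uL lw iw N G'.
have [bg c1 c2 cV] := oracle sG (pL2_borel sG uL) XYu lw iw.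
have gL := grad_pL2 sG XYu uL.
have sq0 o : 0 <= enorm2 (N o) ^+ 2 by exact: sqr_ge0.
have [iN EN] := condexp_bound sG sq0 cV.
have NE : (fun o => enorm2 (N o) ^+ 2) = (fun o => sq_norm (N o)).
  by apply/funext => o; rewrite enorm2_sqr.
rewrite NE in iN EN.
have mg1 i : measurable_fun setT (fun o => (sgrad f (w o) (u o)).1 0 i) by case: (c1 i).
have mg2 j : measurable_fun setT (fun o => (sgrad f (w o) (u o)).2 0 j) by case: (c2 j).
have sN1 i : sqint P (fun o => (N o).1 0 i).
  apply: (sqint_dom _ iN).
    have [mF _] := gL.1 i; have := measurable_funB (mg1 i) (rmeas_meas sG mF).
    by congr measurable_fun; apply/funext => o; rewrite /N (coord_subl, coord_subr).
  by move=> o; apply: le_trans (coord_sq _ _) _; rewrite lerDl edot_ge0.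
have sN2 i : sqint P (fun o => (N o).2 0 i).
  apply: (sqint_dom _ iN).
    have [mF _] := gL.2 i; have := measurable_funB (mg2 i) (rmeas_meas sG mF).
    by congr measurable_fun; apply/funext => o; rewrite /N (coord_subl, coord_subr).
  by move=> o; apply: le_trans (coord_sq _ _) _; rewrite lerDr edot_ge0.
split => //.
- move=> sG'.
  have GG' : G `<=` G' by move=> A GA; apply: sub_sigma_algebra; left.
  have gL' := pL2_mono sG sG' GG' gL.
  split=> i; (split; last by []).
    have := measurable_funB (borel_vmeas sG' (borel_fst bg) i) (vL2_vmeas gL'.1 i).
    by congr measurable_fun; apply/funext => o; rewrite /N (coord_subl, coord_subr).
  have := measurable_funB (borel_vmeas sG' (borel_snd bg) i) (vL2_vmeas gL'.2 i).
  by congr measurable_fun; apply/funext => o; rewrite /N (coord_subl, coord_subr).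
- move=> U UL; rewrite /edot Ex_sum; last by move=> i; apply: sqint_mul => //; case: (UL i).
  apply: big1 => i _; have [mU sU] := UL i; have [_ sF] := gL.1 i.
  have sZ : sqint P (fun o => (sgrad f (w o) (u o)).1 0 i).
    have := sqintD (sN1 i) sF; congr sqint; apply/funext => o.
    by rewrite /N (coord_subl, coord_subr) subrK.
  have := condexp_orth sG (c1 i) sZ sF mU sU.
  by congr (Ex _ _ = 0); apply/funext => o; rewrite /N (coord_subl, coord_subr).
- move=> U UL; rewrite /edot Ex_sum; last by move=> i; apply: sqint_mul => //; case: (UL i).
  apply: big1 => i _; have [mU sU] := UL i; have [_ sF] := gL.2 i.
  have sZ : sqint P (fun o => (sgrad f (w o) (u o)).2 0 i).
    have := sqintD (sN2 i) sF; congr sqint; apply/funext => o.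
    by rewrite /N (coord_subl, coord_subr) subrK.
  have := condexp_orth sG (c2 i) sZ sF mU sU.
  by congr (Ex _ _ = 0); apply/funext => o; rewrite /N (coord_subl, coord_subr).
Qed.

End Oracle.

(** * Batches *)

Definition estimate {R : realType} {n p : nat} {W : Type}
    (g : W -> 'rV[R]_n * 'rV[R]_p -> 'rV[R]_n * 'rV[R]_p) (m : nat) (ws : nat -> W)
    (u : 'rV[R]_n * 'rV[R]_p) : 'rV[R]_n * 'rV[R]_p :=
  m%:R^-1 *: \sum_(i < m) g (ws i) u.

Section Batch.
Context {R : realType} {n p : nat}.
Local Notation E := ('rV[R]_n * 'rV[R]_p)%type.
Context {dW : measure_display} {W : measurableType dW}.
Variables (X : set 'rV[R]_n) (Y : set 'rV[R]_p).
Variables (D : probability W R) (f : E -> W -> R) (L sigma : R).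
Context {d : measure_display} {Om : measurableType d}.
Variable P : probability Om R.
Hypothesis SA : standing_assumptions X Y D f L.
Hypothesis oracle : stochastic_oracle P X Y D f sigma.
Local Notation gF := (grad (meanF D f)).
Context {I : finType}.
Variables (Z : I -> {RV P >-> W}) (rk : I -> nat).
Hypothesis ind : mutually_independent P (fun i => Z i : Om -> W).
Hypothesis law : forall i, has_law D (Z i).

Lemma sq_normD (u v : E) :
  sq_norm (u + v) = sq_norm u + sq_norm v + 2 * (edot u.1 v.1 + edot u.2 v.2).
Proof. by rewrite /sq_norm !norm_sqD; ring. Qed.

Lemma sq_normZ c (u : E) : sq_norm (c *: u) = c ^+ 2 * sq_norm u.
Proof. by rewrite /sq_norm !edotZl !edotZr; ring. Qed.

Variables (r0 m : nat) (ws : nat -> {RV P >-> W}) (u : Om -> E).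
Hypothesis ws_rank : forall i, (i < m)%N -> exists q, Z q = ws i /\ rk q = (r0 + i)%N.
Hypothesis uL : pL2 P (past Z rk r0) u.
Hypothesis XYu : forall o, (X `*` Y) (u o).

Let N i o := sgrad f (ws i o) (u o) - gF (u o).

(** Each error has mean zero given the previous ones, so the errors are orthogonal
    and their variances add up. *)
Let partial_noise l : (l <= m)%N ->
  [/\ pL2 P (past Z rk (r0 + l)) (fun o => \sum_(i < l) N i o),
      Ex P (fun o => sq_norm (\sum_(i < l) N i o)) <= l%:R * sigma ^+ 2 &
      forall U, vL2 P (past Z rk r0) U ->
        Ex P (fun o => edot (U o) (\sum_(i < l) N i o).2) = 0].
Proof.
elim: l => [_|l IH lm].
  have e0 o : \sum_(i < 0) N i o = 0 by rewrite big_ord0.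
  under eq_fun do rewrite e0.
  split; first by split; exact: vL2_cst.
    under [X in Ex P X]eq_fun do rewrite e0 /sq_norm /= !edot0l addr0.
    by rewrite Ex_cst mul0r.
  move=> U _; under [X in Ex P X]eq_fun do rewrite e0 /= edot0r.
  exact: Ex_cst.
have [SL SE SU] := IH (ltnW lm).
have [q [qw qr]] := ws_rank lm.
have sG k := past_sub Z rk k.
have uL' : pL2 P (past Z rk (r0 + l)) u.
  by apply: pL2_mono uL => //; apply: past_mono; exact: leq_addr.
have iq : Defs.independent P (sigma_of (ws l)) (past Z rk (r0 + l)).
  by rewrite -qw; apply: past_independent => //; rewrite qr.
have lq : has_law D (ws l) by rewrite -qw.
have [NL NE N1 N2] := sample_noise SA oracle (sG _) XYu uL' lq iq.
have sub : <<s past Z rk (r0 + l) `|` sigma_of (ws l) >> `<=` past Z rk (r0 + l.+1).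
  rewrite -qw; apply: past_step; first by rewrite qr addnS.
  by apply: past_mono; rewrite addnS.
have sG' : Defs.sub_sigma_algebra <<s past Z rk (r0 + l) `|` sigma_of (ws l) >>.
  split; first exact: smallest_sigma_algebra.
  by apply: subset_trans sub _; case: (sG (r0 + l.+1)%N).
have NL' := pL2_mono sG' (sG _) sub (NL sG').
have SL' : pL2 P (past Z rk (r0 + l.+1)) (fun o => \sum_(i < l) N i o).
  by apply: pL2_mono SL => //; apply: past_mono; rewrite addnS.
have eS o : \sum_(i < l.+1) N i o = \sum_(i < l) N i o + N l o.
  by rewrite big_ord_recr.
under eq_fun do rewrite eS.
split; first exact: pL2D.
  under [X in Ex P X]eq_fun do rewrite eS sq_normD.
  have i1 := integ_sq_norm SL'; have i2 := integ_sq_norm NL'.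
  have i3 := integ_edot SL'.1 NL'.1; have i4 := integ_edot SL'.2 NL'.2.
  rewrite ExD; [|exact: integD|by apply: integZ; exact: integD].
  rewrite ExD // ExZ; last exact: integD.
  rewrite ExD // (N1 _ SL.1) (N2 _ SL.2) addr0 mulr0 addr0.
  by rewrite -natr1 mulrDl mul1r lerD.
move=> U UL; under [X in Ex P X]eq_fun do rewrite eS edotDr.
have UL0 : vL2 P (past Z rk (r0 + l)) U.
  by apply: vL2_mono UL => //; apply: past_mono; exact: leq_addr.
have UL' : vL2 P (past Z rk (r0 + l.+1)) U.
  by apply: vL2_mono UL => //; apply: past_mono; exact: leq_addr.
rewrite ExD; [|exact: (integ_edot UL' SL'.2)|exact: (integ_edot UL' NL'.2)].
by rewrite SU // N2 // addr0.
Qed.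

Local Notation batch_mean :=
  (fun o => estimate (sgrad f) m (fun i => ws i o) (u o)).

(** The factor [m^-2] of the average against the [m] variances that add up. *)
Lemma batch_noise : (0 < m)%N ->
  [/\ pL2 P (past Z rk (r0 + m)) batch_mean,
      pL2 P (past Z rk (r0 + m)) (fun o => batch_mean o - gF (u o)),
      Ex P (fun o => sq_norm (batch_mean o - gF (u o))) <= sigma ^+ 2 / m%:R &
      forall U, vL2 P (past Z rk r0) U ->
        Ex P (fun o => edot (batch_mean o - gF (u o)).2 (U o)) = 0].
Proof.
move=> m0; have [SL SE SU] := partial_noise (leqnn m).
have mn0 : m%:R != 0 :> R by rewrite pnatr_eq0 -lt0n.
have eN o : batch_mean o - gF (u o) = m%:R^-1 *: \sum_(i < m) N i o.
  rewrite /estimate /N sumrB scalerBr; congr (_ - _).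
  by rewrite sumr_const card_ord -[gF (u o) *+ m]scaler_nat scalerA mulVf // scale1r.
have sG k := past_sub Z rk k.
have NL : pL2 P (past Z rk (r0 + m)) (fun o => batch_mean o - gF (u o)).
  by under eq_fun do rewrite eN; exact: pL2Z.
have gL : pL2 P (past Z rk (r0 + m)) (fun o => gF (u o)).
  apply: (grad_pL2 SA (sG _) XYu); apply: pL2_mono uL => //.
  by apply: past_mono; exact: leq_addr.
split => //.
- by have := pL2D NL gL; congr pL2; apply/funext => o; rewrite subrK.
- under [X in Ex P X]eq_fun do rewrite eN sq_normZ.
  rewrite ExZ; last exact: integ_sq_norm SL.
  have -> : sigma ^+ 2 / m%:R = m%:R^-1 ^+ 2 * (m%:R * sigma ^+ 2) by field.
  by rewrite ler_wpM2l // sqr_ge0.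
- move=> U UL; under [X in Ex P X]eq_fun do rewrite eN edotC edotZr.
  have UL' : vL2 P (past Z rk (r0 + m)) U.
    by apply: vL2_mono UL => //; apply: past_mono; exact: leq_addr.
  by rewrite ExZ ?SU ?mulr0 //; exact: (integ_edot UL' SL.2).
Qed.

End Batch.

(** * Adaptedness of the iterates *)

Section Unfolding.
Context {R : realType} {n p : nat} {W : Type}.
Local Notation E := ('rV[R]_n * 'rV[R]_p)%type.
Variables (X : set 'rV[R]_n) (Y : set 'rV[R]_p) (g : W -> E -> E).

Lemma batchE u (ws : seq W) c :
  batch g u ws c = ((size ws)%:R^-1 *: \sum_(w <- ws) g w u, (c + size ws)%N).
Proof.
rewrite /batch.
have foldE acc : foldl (sfo_call g u) acc ws =
    (acc.1 + \sum_(w <- ws) g w u, (acc.2 + size ws)%N).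
  elim: ws acc => [|w ws IH] acc /=; first by rewrite big_nil addr0 addn0; case: acc.
  by rewrite IH big_cons /= addrA addSnnS.
by rewrite foldE /= add0r.
Qed.

Lemma batch_mkseq u m (ws : nat -> W) c :
  batch g u (mkseq ws m) c = (estimate g m ws u, (c + m)%N).
Proof.
rewrite batchE size_mkseq /mkseq big_map /estimate.
by rewrite -(big_mkord xpredT (fun i => g (ws i) u)) /index_iota subn0.
Qed.

Variables (L tau : R) (m : nat).

Lemma spde_stepE (w : nat -> nat -> W) s :
  spde_step X Y g L (choose_params L tau) m w s =
  let g0 := estimate g m (w 0) (st_x s, st_y s) in
  let wt := predictor X Y L tau s g0 in
  let g1 := estimate g m (w 1) wt in
  let w' := corrector X Y L tau s wt g1 in
  next_state X Y L tau s wt g1 (estimate g m (w 2) w') (st_calls s + m + m + m).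
Proof.
case: s => x y z xi nn v c; rewrite /spde_step /choose_params.
have bE u ws c' : batch g u (mkseq ws m) c' =
    ((estimate g m ws u).1, (estimate g m ws u).2, (c' + m)%N).
  by rewrite batch_mkseq -surjective_pairing.
by do 3 (rewrite bE; cbv beta iota zeta).
Qed.

End Unfolding.

Section Trajectory.
Context {R : realType} {n p : nat}.
Local Notation E := ('rV[R]_n * 'rV[R]_p)%type.
Context {dW : measure_display} {W : measurableType dW}.
Variables (X : set 'rV[R]_n) (Y : set 'rV[R]_p).
Variables (D : probability W R) (f : E -> W -> R) (L sigma : R).
Context {d : measure_display} {Om : measurableType d}.
Variable P : probability Om R.
Hypothesis SA : standing_assumptions X Y D f L.
Hypothesis oracle : stochastic_oracle P X Y D f sigma.
Local Notation F := (fun x y => meanF D f (x, y)).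
Local Notation gF := (grad (meanF D f)).
Local Notation gx := (fun x y => (grad (meanF D f) (x, y)).1).
Local Notation gy := (fun x y => (grad (meanF D f) (x, y)).2).
Variable tau : R.
Hypotheses (tau0 : 0 < tau) (tauL : tau <= L).
Variable sad : 'rV[R]_n -> E.
Hypothesis sadP : forall z, is_saddle X Y F L tau z (sad z).
Local Notation state := (@spde_state R n p).
Local Notation pr := (choose_params L tau).

Variables (T m : nat) (w : nat -> nat -> nat -> {RV P >-> W}).
Hypothesis m0 : (0 < m)%N.
Hypothesis fresh : fresh_samples D T m w.

Definition sample (q : 'I_T * 'I_3 * 'I_m) : {RV P >-> W} := w q.1.1 q.1.2 q.2.
Definition sample_rank (q : 'I_T * 'I_3 * 'I_m) : nat :=
  ((q.1.1 * 3 + q.1.2) * m + q.2)%N.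
Local Notation hist := (past sample sample_rank).

Definition adapted (G : set (set Om)) (s : Om -> state) :=
  [/\ vL2 P G (fun o => st_x (s o)), vL2 P G (fun o => st_y (s o)),
      vL2 P G (fun o => st_z (s o)), vL2 P G (fun o => st_xi (s o)) &
      vL2 P G (fun o => st_n (s o)) /\ vL2 P G (fun o => st_v (s o))].

Lemma adapted_mono (k l : nat) s : (k <= l)%N -> adapted (hist k) s -> adapted (hist l) s.
Proof.
move=> kl [a1 a2 a3 a4 [a5 a6]].
have mono r (u : Om -> 'rV[R]_r) := @vL2_mono _ _ _ P _ _ _ u
  (past_sub sample sample_rank k) (past_sub sample sample_rank l) (past_mono kl).
by split; [exact: mono|exact: mono|exact: mono|exact: mono|split; exact: mono].
Qed.

Lemma eproj_vL2 G r (C : set 'rV[R]_r) (u : Om -> 'rV[R]_r) :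
  Defs.sub_sigma_algebra G -> closed C -> segment_closed C -> C !=set0 ->
  vL2 P G u -> vL2 P G (fun o => eproj C (u o)).
Proof.
move=> sG cl cv ne uL; apply: (vL2_lip sG ler01 _ uL) => a b.
by rewrite mul1r; exact: eproj_contraction.
Qed.

Lemma saddle_vL2 G (u : Om -> 'rV[R]_n) : Defs.sub_sigma_algebra G ->
  vL2 P G u -> vL2 P G (fun o => (sad (u o)).2).
Proof.
move=> sG uL; apply: (@vL2_lip _ _ _ P G _ _ (fun z => (sad z).2) (L / tau)) => //.
  by rewrite divr_ge0 ?ltW // (L_gt0 SA).
move=> a b; rewrite mulrAC ler_pdivlMr // mulrC.
exact: (saddle_lipschitz (meanF_smooth_game SA) (sadP a) (sadP b)).
Qed.

Definition step_wt t (s : Om -> state) o : E :=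
  predictor X Y L tau (s o)
    (estimate (sgrad f) m (fun i => w t 0 i o) (st_x (s o), st_y (s o))).
Definition step_w' t (s : Om -> state) o : E :=
  corrector X Y L tau (s o) (step_wt t s o)
    (estimate (sgrad f) m (fun i => w t 1 i o) (step_wt t s o)).

Lemma hist_batch t j : (t < T)%N -> (j < 3)%N -> forall i, (i < m)%N ->
  exists q, sample q = w t j i /\ sample_rank q = ((t * 3 + j) * m + i)%N.
Proof.
by move=> tT j3 i im; exists (Ordinal tT, Ordinal j3, Ordinal im).
Qed.

Lemma sample_law q : has_law D (sample q).
Proof. by case: fresh => + _; apply. Qed.

Lemma predictor_in s g0 : (X `*` Y) (predictor X Y L tau s g0).
Proof.
have game := meanF_smooth_game SA; split.
  exact: eproj_in (game_X_closed game) (game_X_convex game) (game_X_nonempty game) _.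
exact: eproj_in (game_Y_closed game) (game_Y_convex game) (game_Y_nonempty game) _.
Qed.

Lemma corrector_in s wt g1 : (X `*` Y) (corrector X Y L tau s wt g1).
Proof.
have game := meanF_smooth_game SA; split.
  exact: eproj_in (game_X_closed game) (game_X_convex game) (game_X_nonempty game) _.
exact: eproj_in (game_Y_closed game) (game_Y_convex game) (game_Y_nonempty game) _.
Qed.

(** Each batch is queried at a point that only depends on the previous samples, so
    [batch_noise] applies three times; the direction [U] paired with the noise of
    the third batch is known before that batch, too. *)
Lemma step_adapted t s : (t < T)%N -> (forall o, state_inv X Y (s o)) ->
  adapted (hist ((t * 3) * m)) s ->
  let e0 o := estimate (sgrad f) m (fun i => w t 0 i o) (st_x (s o), st_y (s o)) in
  let e1 o := estimate (sgrad f) m (fun i => w t 1 i o) (step_wt t s o) in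
  let e2 o := estimate (sgrad f) m (fun i => w t 2 i o) (step_w' t s o) in
  let N0 o := e0 o - gF (st_x (s o), st_y (s o)) in
  let N1 o := e1 o - gF (step_wt t s o) in
  let N2 o := e2 o - gF (step_w' t s o) in
  let U o := noise_pairing X Y gy L tau sad (s o) (step_wt t s o) (e1 o) in
  let B := sigma ^+ 2 / m%:R in
  [/\ adapted (hist ((t.+1 * 3) * m))
        (fun o => next_state X Y L tau (s o) (step_wt t s o) (e1 o) (e2 o)
                    (st_calls (s o) + m + m + m)),
      integ P (fun o => sq_norm (N0 o)) /\ Ex P (fun o => sq_norm (N0 o)) <= B,
      integ P (fun o => sq_norm (N1 o)) /\ Ex P (fun o => sq_norm (N1 o)) <= B,
      integ P (fun o => sq_norm (N2 o)) /\ Ex P (fun o => sq_norm (N2 o)) <= B &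
      integ P (fun o => edot (N2 o).2 (U o)) /\ Ex P (fun o => edot (N2 o).2 (U o)) = 0].
Proof.
move=> tT inv ad e0 e1 e2 N0 N1 N2 U B.
have game := meanF_smooth_game SA.
have [_ ind] := fresh.
have sG k := past_sub sample sample_rank k.
have XYs o : (X `*` Y) (st_x (s o), st_y (s o)) by have [] := inv o.
have hb j (j3 : (j < 3)%N) := hist_batch tT j3.
have r1 : ((t * 3 + 0) * m + m = (t * 3 + 1) * m)%N by rewrite addn0 addn1 mulSn addnC.
have r2 : ((t * 3 + 1) * m + m = (t * 3 + 2) * m)%N by rewrite !addnS addn0 [in RHS]mulSn addnC.
have r3 : ((t * 3 + 2) * m + m = (t.+1 * 3) * m)%N by rewrite mulSn addnC !addnS addn0 [in RHS]mulSn addnC.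
have lift j (jm : (0 <= j)%N) : adapted (hist ((t * 3 + j) * m)) s.
  by apply: adapted_mono ad; rewrite leq_mul2r leq_addr orbT.
have [a1 a2 a3 a4 [a5 a6]] := lift 0%N isT.
have uL0 : pL2 P (hist ((t * 3 + 0) * m)) (fun o => (st_x (s o), st_y (s o))) by split.
have [g0L N0L E0 _] := batch_noise SA oracle ind sample_law (hb 0%N isT) uL0 XYs m0.
rewrite r1 in g0L N0L.
have [b1 b2 b3 b4 [b5 b6]] := lift 1%N isT.
have wtL : pL2 P (hist ((t * 3 + 1) * m)) (step_wt t s).
  split.
    apply: eproj_vL2; [exact: sG|exact: game_X_closed game|exact: game_X_convex game
      |exact: game_X_nonempty game|].
    apply: vL2B => //; apply: vL2Z; apply: vL2D => //; apply: vL2D; first exact: g0L.1.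
    by apply: vL2Z; exact: vL2B.
  apply: eproj_vL2; [exact: sG|exact: game_Y_closed game|exact: game_Y_convex game
      |exact: game_Y_nonempty game|].
  apply: vL2D => //; apply: vL2Z; apply: vL2D => //; apply: vL2B => //.
  by apply: vL2B; [exact: g0L.2|exact: vL2Z].
have [g1L N1L E1 _] := batch_noise SA oracle ind sample_law (hb 1%N isT) wtL
  (fun o => predictor_in _ _) m0.
rewrite r2 in g1L N1L.
have [c1 c2 c3 c4 [c5 c6]] := lift 2%N isT.
have wtL2 : pL2 P (hist ((t * 3 + 2) * m)) (step_wt t s).
  by apply: pL2_mono wtL => //; apply: past_mono; rewrite leq_mul2r leq_add2l orbT.
have fyL : vL2 P (hist ((t * 3 + 2) * m)) (fun o => (e1 o).2 - tau *: (step_wt t s o).2).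
  by apply: vL2B; [exact: g1L.2|apply: vL2Z; exact: wtL2.2].
have vbL : vL2 P (hist ((t * 3 + 2) * m)) (fun o => p_alpha pr *: st_v (s o)
    + p_k pr *: ((e1 o).2 - tau *: (step_wt t s o).2)).
  by apply: vL2D; exact: vL2Z.
have wL : pL2 P (hist ((t * 3 + 2) * m)) (step_w' t s).
  split.
    apply: eproj_vL2; [exact: sG|exact: game_X_closed game|exact: game_X_convex game
      |exact: game_X_nonempty game|].
    apply: vL2B => //; apply: vL2Z; apply: vL2D; first exact: g1L.1.
    by apply: vL2Z; apply: vL2B => //; exact: wtL2.1.
  apply: eproj_vL2; [exact: sG|exact: game_Y_closed game|exact: game_Y_convex game
      |exact: game_Y_nonempty game|].
  by apply: vL2D => //; apply: vL2Z; exact: vL2D.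
have XYw o : (X `*` Y) (step_w' t s o) by exact: corrector_in.
have xiL : vL2 P (hist ((t * 3 + 2) * m)) (fun o => next_xi X Y L tau (s o) (step_wt t s o) (e1 o)).
  apply: vL2B; last by apply: vL2Z; apply: vL2B => //; exact: wtL2.1.
  apply: vL2B; last exact: g1L.1.
  by apply: vL2Z; apply: vL2B => //; exact: wL.1.
have nL : vL2 P (hist ((t * 3 + 2) * m)) (fun o => next_n X Y L tau (s o) (step_wt t s o) (e1 o)).
  apply: vL2Z; apply: vL2D => //.
  apply: vL2B; last by apply: vL2Z; exact: wtL2.2.
  apply: vL2D; last exact: g1L.2.
  by apply: vL2Z; apply: vL2B => //; exact: wL.2.
have [g2L N2L E2 O2] := batch_noise SA oracle ind sample_law (hb 2%N isT) wL XYw m0.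
rewrite r3 in g2L N2L.
have gwL := grad_pL2 SA (sG _) XYw wL.
have UL : vL2 P (hist ((t * 3 + 2) * m)) U.
  apply: vL2D; first by apply: vL2Z; apply: vL2Z; apply: vL2B => //; exact: wL.2.
  apply: vL2Z; apply: vL2D.
    apply: vL2D; first by apply: vL2Z; exact: c6.
    apply: vL2Z; apply: vL2B; last exact: nL.
    apply: vL2B; last by apply: vL2Z; exact: wL.2.
    have -> : (fun o => gy (corrector X Y L tau (s o) (step_wt t s o) (e1 o)).1
        (corrector X Y L tau (s o) (step_wt t s o) (e1 o)).2) =
        (fun o => (gF (step_w' t s o)).2).
      by apply/funext => o; rewrite /step_w' -/(e1 o) -surjective_pairing.
    exact: gwL.2.
  apply: vL2Z; apply: vL2B; first exact: wL.2.
  exact: (saddle_vL2 (sG _) c3).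
have r23 : ((t * 3 + 2) * m <= (t.+1 * 3) * m)%N by rewrite -r3 leq_addr.
have up r (u : Om -> 'rV[R]_r) : vL2 P (hist ((t * 3 + 2) * m)) u ->
    vL2 P (hist ((t.+1 * 3) * m)) u by exact: (vL2_mono (sG _) (sG _) (past_mono r23)).
split.
- split.
  + exact: (up _ _ wL.1).
  + exact: (up _ _ wL.2).
  + by apply: vL2D; [exact: up|apply: vL2Z; apply: vL2B; [exact: (up _ _ wL.1)|exact: up]].
  + exact: up.
  + split; first exact: up.
    apply: vL2D; first by apply: vL2Z; exact: up.
    apply: vL2Z; apply: vL2B; last exact: up.
    by apply: vL2B; [exact: g2L.2|apply: vL2Z; exact: (up _ _ wL.2)].
- by split; [exact: (integ_sq_norm N0L)|exact: E0].
- by split; [exact: (integ_sq_norm N1L)|exact: E1].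
- by split; [exact: (integ_sq_norm N2L)|exact: E2].
- split; first exact: (integ_edot N2L.2 (up _ _ UL)).
  exact: O2.
Qed.

End Trajectory.

(** * Summation over the iterations *)

Section Arithmetic.
Context {R : realType}.

Lemma noise_arith (B e0 e1 e2 : R) : e0 <= B -> e1 <= B -> e2 <= B ->
  10 * (e0 + e1 + e2) <= 30 * B.
Proof. lra. Qed.

Lemma decrease_arith (b l l' q e c : R) : l' <= l - b / 64 * q + e + c ->
  b / 64 * q <= l - l' + (e + c).
Proof. lra. Qed.

Lemma telescope_arith (a b u e l l1 l2 : R) : a <= l - l1 + b -> u <= l1 - l2 + e ->
  a + u <= l - l2 + (b + e).
Proof. lra. Qed.

End Arithmetic.

Section PairForm.
Context {R : realType} {n p : nat}.
Local Notation E := ('rV[R]_n * 'rV[R]_p)%type.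
Variables (G : E -> E).
Local Notation gx := (fun x y => (G (x, y)).1).
Local Notation gy := (fun x y => (G (x, y)).2).

Lemma one_step_pair (X : set 'rV[R]_n) (Y : set 'rV[R]_p) F (L tau : R)
    (sad : 'rV[R]_n -> E) s s' (wt w' g0 g1 g2 : E) (c : nat) :
  smooth_game X Y F gx gy L -> 0 < tau -> tau <= L ->
  (forall z, is_saddle X Y F L tau z (sad z)) ->
  state_inv X Y s ->
  wt = predictor X Y L tau s g0 ->
  w' = corrector X Y L tau s wt g1 ->
  s' = next_state X Y L tau s wt g1 g2 c ->
  p_beta (choose_params L tau) / 64 *
    (edot (gx (st_x s') (st_y s') + st_xi s') (gx (st_x s') (st_y s') + st_xi s')
     + 2 * edot (forcey gy tau s') (forcey gy tau s')) <=
  lyapunov F gx gy L tau sad s - lyapunov F gx gy L tau sad s'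
  + (10 * (sq_norm (g0 - G (st_x s, st_y s)) + sq_norm (g1 - G wt) + sq_norm (g2 - G w'))
     + edot (g2 - G w').2 (noise_pairing X Y gy L tau sad s wt g1)).
Proof.
move=> game tau0 tauL sadP inv wtE w'E s'E.
have h := one_step game tau0 tauL sadP inv wtE w'E s'E.
have ex : st_x s' = w'.1 by rewrite s'E w'E.
have ey : st_y s' = w'.2 by rewrite s'E w'E.
have pairE a b : (gx a b, gy a b) = G (a, b) by case: (G (a, b)).
rewrite pairE in h; rewrite ex ey; apply: decrease_arith; move: h.
case: wt w' {wtE w'E s'E ex ey} => [a1 a2] [b1 b2] /=.
by rewrite !pairE.
Qed.

End PairForm.

Section Expectation.
Context {R : realType} {n p : nat}.
Local Notation E := ('rV[R]_n * 'rV[R]_p)%type.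
Context {dW : measure_display} {W : measurableType dW}.
Variables (X : set 'rV[R]_n) (Y : set 'rV[R]_p).
Variables (D : probability W R) (f : E -> W -> R) (L sigma : R).
Context {d : measure_display} {Om : measurableType d}.
Variable P : probability Om R.
Hypothesis SA : standing_assumptions X Y D f L.
Hypothesis oracle : stochastic_oracle P X Y D f sigma.
Local Notation F := (fun x y => meanF D f (x, y)).
Local Notation gF := (grad (meanF D f)).
Local Notation gx := (fun x y => (grad (meanF D f) (x, y)).1).
Local Notation gy := (fun x y => (grad (meanF D f) (x, y)).2).
Variable tau : R.
Hypotheses (tau0 : 0 < tau) (tauL : tau <= L).
Variable sad : 'rV[R]_n -> E.
Hypothesis sadP : forall z, is_saddle X Y F L tau z (sad z).
Local Notation state := (@spde_state R n p).
Local Notation pr := (choose_params L tau).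
Local Notation lyap := (lyapunov F gx gy L tau sad).
Variables (T m : nat) (w : nat -> nat -> nat -> {RV P >-> W}).
Hypothesis m0 : (0 < m)%N.
Hypothesis fresh : fresh_samples D T m w.
Variables (x0 : 'rV[R]_n) (y0 : 'rV[R]_p).
Hypotheses (Xx0 : X x0) (Yy0 : Y y0).
Local Notation hist := (past (sample w (T := T) (m := m)) (@sample_rank T m)).

Definition run t o : state :=
  spde_run X Y (sgrad f) L pr m x0 y0 (fun t j i => w t j i o) t.

Lemma runS t o : run t.+1 o =
  next_state X Y L tau (run t o) (step_wt X Y f L tau m w t (run t) o)
    (estimate (sgrad f) m (fun i => w t 1 i o) (step_wt X Y f L tau m w t (run t) o))
    (estimate (sgrad f) m (fun i => w t 2 i o) (step_w' X Y f L tau m w t (run t) o))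
    (st_calls (run t o) + m + m + m).
Proof. exact: (spde_stepE X Y (sgrad f) L tau m (fun j i => w t j i o) (run t o)). Qed.

Lemma run_inv t o : state_inv X Y (run t o).
Proof.
case: t => [|t]; first by split => // c _; rewrite edot0l.
by rewrite runS; exact: next_inv (meanF_smooth_game SA) tau0 tauL _ _ _ _ _.
Qed.

Lemma run_adapted t : (t <= T)%N -> adapted P (hist ((t * 3) * m)) (run t).
Proof.
elim: t => [_|t IH tT].
  by split; [exact: vL2_cst|exact: vL2_cst|exact: vL2_cst|exact: vL2_cst|split; exact: vL2_cst].
have [ad _ _ _ _] := step_adapted SA oracle tau0 sadP m0 fresh tT
  (run_inv t) (IH (ltnW tT)).
by move: ad; congr adapted; apply/funext => o; rewrite runS.
Qed.

(** By [residual_bound] this dominates the squared residual up to the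
    regularization; in contrast to the residual, it is clearly measurable. *)
Definition stationarity (s : state) : R :=
  edot (gx (st_x s) (st_y s) + st_xi s) (gx (st_x s) (st_y s) + st_xi s)
  + 2 * edot (forcey gy tau s) (forcey gy tau s).

Lemma stationarity_ge0 s : 0 <= stationarity s.
Proof. by rewrite addr_ge0 ?mulr_ge0 ?edot_ge0. Qed.

Lemma rmeas_edot G k (u : Om -> 'rV[R]_k) : vL2 P G u -> rmeas G (fun o => edot (u o) (u o)).
Proof.
by move=> uL; apply: measurable_sum => i; apply: measurable_funM; case: (uL i).
Qed.

Lemma stationarity_run t : (t <= T)%N ->
  rmeas (hist ((t * 3) * m)) (fun o => stationarity (run t o)) /\
  integ P (fun o => stationarity (run t o)).
Proof.
move=> tT; have [a1 a2 a3 a4 [a5 a6]] := run_adapted tT.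
have sG := past_sub (sample w (T := T) (m := m)) (@sample_rank T m) ((t * 3) * m).
have XYs o : (X `*` Y) (st_x (run t o), st_y (run t o)) by have [] := run_inv t o.
have xyL : pL2 P (hist ((t * 3) * m)) (fun o => (st_x (run t o), st_y (run t o))) by split.
have [g1 g2] := grad_pL2 SA sG XYs xyL.
have uL := vL2D g1 a4.
have vL : vL2 P (hist ((t * 3) * m)) (fun o => forcey gy tau (run t o)).
  by apply: vL2B; [apply: vL2B; [exact: g2|exact: vL2Z]|exact: a5].
split.
  apply: measurable_funD; first exact: rmeas_edot uL.
  by apply: measurable_funM; [exact: measurable_cst|exact: rmeas_edot vL].
by apply: integD; [exact: (integ_edot uL uL)|apply: integZ; exact: (integ_edot vL vL)].
Qed.

Let step_error t o : R :=
  10 * (sq_norm (estimate (sgrad f) m (fun i => w t 0 i o) (st_x (run t o), st_y (run t o))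
                 - gF (st_x (run t o), st_y (run t o)))
        + sq_norm (estimate (sgrad f) m (fun i => w t 1 i o) (step_wt X Y f L tau m w t (run t) o)
                 - gF (step_wt X Y f L tau m w t (run t) o))
        + sq_norm (estimate (sgrad f) m (fun i => w t 2 i o) (step_w' X Y f L tau m w t (run t) o)
                 - gF (step_w' X Y f L tau m w t (run t) o)))
  + edot (estimate (sgrad f) m (fun i => w t 2 i o) (step_w' X Y f L tau m w t (run t) o)
                 - gF (step_w' X Y f L tau m w t (run t) o)).2
      (noise_pairing X Y gy L tau sad (run t o) (step_wt X Y f L tau m w t (run t) o)
        (estimate (sgrad f) m (fun i => w t 1 i o) (step_wt X Y f L tau m w t (run t) o))).

Let step_error_mean t : (t < T)%N ->
  integ P (step_error t) /\ Ex P (step_error t) <= 30 * (sigma ^+ 2 / m%:R).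
Proof.
move=> tT.
have [_ [i0 E0] [i1 E1] [i2 E2] [i3 E3]] := step_adapted SA oracle tau0 sadP m0 fresh tT
  (run_inv t) (run_adapted (ltnW tT)).
have i01 := integD i0 i1; have i012 := integD i01 i2; have i10 := integZ 10 i012.
split; first exact: (integD i10 i3).
rewrite /step_error ExD; [|exact: i10|exact: i3].
rewrite E3 addr0 ExZ; last exact: i012.
rewrite ExD; [|exact: i01|exact: i2].
rewrite ExD; [|exact: i0|exact: i1].
exact: noise_arith E0 E1 E2.
Qed.

Let step_decrease t o :
  p_beta pr / 64 * stationarity (run t.+1 o) <=
    lyap (run t o) - lyap (run t.+1 o) + step_error t o.
Proof.
exact: (one_step_pair (G := gF) (meanF_smooth_game SA) tau0 tauL sadP (run_inv t o)
  (erefl _) (erefl _) (runS t o)).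
Qed.

(** The decrease of the potential telescopes; the linear noise terms have mean zero
    and the quadratic ones are bounded by the variance of a batch. *)
Lemma stationarity_sum :
  p_beta pr / 64 * \sum_(t < T) Ex P (fun o => stationarity (run t.+1 o)) <=
    L * initial_quantity X Y D f L x0 y0 + T%:R * (30 * (sigma ^+ 2 / m%:R)).
Proof.
have is_ t : (t < T)%N -> integ P (fun o => stationarity (run t.+1 o)).
  by move=> tT; case: (@stationarity_run t.+1 tT).
pose c0 := L * initial_quantity X Y D f L x0 y0.
have path_sum o k : (k <= T)%N ->
    \sum_(t < k) p_beta pr / 64 * stationarity (run t.+1 o) <=
    lyap (run 0 o) - lyap (run k o) + \sum_(t < k) step_error t o.
  elim: k => [_|k IH kT]; first by rewrite !big_ord0 subrr addr0.
  rewrite !big_ord_recr /=.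
  exact: telescope_arith (IH (ltnW kT)) (step_decrease k o).
have path o : \sum_(t < T) p_beta pr / 64 * stationarity (run t.+1 o) <=
    c0 + \sum_(t < T) step_error t o.
  apply: le_trans (path_sum o _ (leqnn T)) _; rewrite lerD2r.
  have h1 := lyapunov_init SA tau0 tauL sadP Xx0 Yy0.
  have h2 := lyapunov_lb SA tau0 sadP (run_inv T o).
  by apply: le_trans h1; rewrite lerD2l lerN2.
have ibs (t : 'I_T) : integ P (fun o => p_beta pr / 64 * stationarity (run t.+1 o)).
  by apply: integZ; exact: is_.
have ie (t : 'I_T) : integ P (step_error t) by case: (step_error_mean (ltn_ord t)).
have := Ex_le (integ_sum (index_enum _) ibs)
  (integD (integ_cst P c0) (integ_sum (index_enum _) ie)) path.
rewrite Ex_sum // ExD; [|exact: integ_cst|exact: integ_sum].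
rewrite Ex_cst Ex_sum //.
rewrite mulr_sumr => h.
apply: (@le_trans _ _ (\sum_(t < T) Ex P (fun o => p_beta pr / 64 * stationarity (run t.+1 o)))).
  by apply: ler_sum => t _; rewrite ExZ //; exact: is_.
apply: le_trans h _; rewrite lerD2l.
have -> : T%:R * (30 * (sigma ^+ 2 / m%:R)) = \sum_(t < T) 30 * (sigma ^+ 2 / m%:R) :> R.
  by rewrite sumr_const card_ord mulr_natl.
by apply: ler_sum => t _; case: (step_error_mean (ltn_ord t)).
Qed.

End Expectation.

(** * The random output index *)

Section Output.
Context {R : realType} {d : measure_display} {Om : measurableType d}.
Variable P : probability Om R.

(** The integral of a nonnegative function is a supremum over the simple functions
    below it. The residual at the random index is compared to a measurable bound
    in this way. *)
Lemma ge0_le_integral_nomeas (a b : Om -> \bar R) : (forall o, 0 <= a o)%E ->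
  (forall o, a o <= b o)%E -> (\int[P]_o a o <= \int[P]_o b o)%E.
Proof.
move=> a0 ab; have b0 o : (0 <= b o)%E := le_trans (a0 o) (ab o).
rewrite !ge0_integralTE //; apply: le_ereal_sup => _ [h hf <-].
by exists h => // x; exact: le_trans (hf x) (ab x).
Qed.

Variables (T : nat) (J : {RV P >-> nat}) (G : set (set Om)).
Hypothesis sG : Defs.sub_sigma_algebra G.
Hypothesis T0 : (0 < T)%N.
Hypothesis unifJ : forall t, (t < T)%N -> P (J @^-1` [set t]) = (T%:R^-1)%:E.
Hypothesis indJ : Defs.independent P (sigma_of (J : Om -> nat)) G.

Let mJ t : measurable (J @^-1` [set t]).
Proof. by have := @measurable_funPTI _ _ _ _ J [set t] I; rewrite ?setTI; apply. Qed.

(** Conditionally on [G], the event [J = t] has the constant probability [T^-1]. *)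
Lemma uniform_pick t (U : Om -> R) : (t < T)%N -> rmeas G U -> integ P U ->
  (forall o, 0 <= U o) ->
  (\int[P]_o (U o * \1_(J @^-1` [set t]) o)%:E = (T%:R^-1 * Ex P U)%:E)%E.
Proof.
move=> tT mU iU U0.
rewrite (pull_out sG (Z := \1_(J @^-1` [set t])) (V := cst T%:R^-1)) //.
- by rewrite -ExZ // -EFin_Ex; [under eq_integral do rewrite mulrC|exact: integZ].
- by move=> o /=; rewrite invr_ge0.
- move=> A GA; have mA := sG.2 _ GA.
  have -> : (\int[P]_(o in A) (cst T%:R^-1 o : R)%:E = T%:R^-1%:E * P A)%E.
    have h := integral_cst P mA T%:R^-1%:E.
    exact: h.
  have e : (P (J @^-1` [set t] `&` A) = (T%:R^-1)%:E * P A)%E.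
    by rewrite indJ ?unifJ //; exists [set t] => //; rewrite setTI.
  by rewrite integral_indic.
Qed.

Let J_lt : P [set o | ~~ (J o < T)%N] = 0%E.
Proof.
have mlt : measurable [set o | (J o < T)%N].
  have := @measurable_funPTI _ _ _ _ J [set k | (k < T)%N] I.
  by rewrite ?setTI; apply.
have e : (\int[P]_o (\1_[set o | (J o < T)%N] o)%:E = 1)%E.
  transitivity (\sum_(t < T) \int[P]_o (1 * \1_(J @^-1` [set nat_of_ord t]) o)%:E)%E.
    rewrite -ge0_integral_sum //; last first.
      by move=> t; apply/measurable_EFinP; apply: measurable_funM.
    apply: eq_integral => o _; rewrite sumEFin; congr EFin.
    rewrite indicE; case: (ltnP (J o) T) => [lt|ge].
      rewrite mem_set //= (bigD1 (Ordinal lt)) //= mul1r indicE mem_set //=.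
      rewrite big1 ?addr0 // => t tJ; rewrite mul1r indicE memNset //= => e.
      by move: tJ; rewrite -val_eqE /= -e eqxx.
    rewrite memNset //=; last by rewrite ltnNge ge.
    rewrite big1 // => t _; rewrite mul1r indicE memNset //= => e.
    by move: (ltn_ord t); rewrite -e ltnNge ge.
  transitivity (\sum_(t < T) (T%:R^-1 : R)%:E)%E.
    apply: eq_bigr => t _.
    have := uniform_pick (ltn_ord t) (measurable_cst (1 : R)) (integ_cst P 1) (fun=> ler01).
    by rewrite Ex_cst mulr1.
  rewrite sumEFin sumr_const card_ord -[_ *+ T]mulr_natl divff //.
  by rewrite pnatr_eq0 -lt0n.
have -> : [set o | ~~ (J o < T)%N] = ~` [set o | (J o < T)%N].
  by apply/seteqP; split => o /= /negP.
have e1 : P [set o | (J o < T)%N] = 1%E.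
  by rewrite -e integral_indic // setIT.
have e2 : (P (~` [set o | (J o < T)%N]) = 1 - P [set o | (J o < T)%N])%E.
  exact: probability_setC.
by rewrite e2 e1 subee.
Qed.

(** The events [J = t] for [t < T] exhaust the space up to the null set [bad], on
    which the bound is infinite; each of them contributes the mean of [Q t] with
    weight [T^-1]. *)
Lemma uniform_expectation (h : Om -> R) (Q : nat -> Om -> R) :
  (forall o, 0 <= h o) -> (forall t o, 0 <= Q t o) ->
  (forall t, (t < T)%N -> rmeas G (Q t)) -> (forall t, (t < T)%N -> integ P (Q t)) ->
  (forall t o, (t < T)%N -> J o = t -> h o <= Q t o) ->
  (\int[P]_o (h o)%:E <= (T%:R^-1 * \sum_(t < T) Ex P (Q t))%:E)%E.
Proof.
move=> h0 Q0 mQ iQ hQ.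
pose bad : set Om := [set o | ~~ (J o < T)%N].
have mbad : measurable bad.
  have := @measurable_funPTI _ _ _ _ J [set k | ~~ (k < T)%N] I.
  by rewrite ?setTI; apply.
pose g1 o := (\sum_(t < T) (Q t o * \1_(J @^-1` [set nat_of_ord t]) o)%:E)%E.
pose g2 o := ((+oo : \bar R) * (\1_bad o)%:E)%E.
have g10 o : (0 <= g1 o)%E.
  by apply: sume_ge0 => t _; rewrite lee_fin mulr_ge0.
have g20 o : (0 <= g2 o)%E by rewrite mule_ge0 // lee_fin.
have mQ' (t : 'I_T) : measurable_fun setT (fun o => Q t o * \1_(J @^-1` [set nat_of_ord t]) o).
  by apply: measurable_funM => //; exact: (rmeas_meas sG (mQ _ (ltn_ord t))).
apply: (@le_trans _ _ (\int[P]_o (g1 o + g2 o))%E).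
  apply: ge0_le_integral_nomeas => o; first by rewrite lee_fin.
  case: (ltnP (J o) T) => [lt|ge].
    rewrite /g2 indicE memNset /=; last by move/negP; apply.
    rewrite mule0 adde0 /g1 sumEFin lee_fin (bigD1 (Ordinal lt)) //= indicE mem_set //= mulr1.
    apply: le_trans (hQ _ _ lt erefl) _; rewrite lerDl; apply: sumr_ge0 => t _.
    by rewrite mulr_ge0.
  rewrite /g2 indicE mem_set /=; last by rewrite /bad /= -leqNgt.
  by rewrite mule1 addey ?leey // gt_eqF // (lt_le_trans _ (g10 o)) // ltNyr.
rewrite ge0_integralD //; last 2 first.
- apply: emeasurable_sum => t; exact/measurable_EFinP.
- by apply: emeasurable_funM => //; exact/measurable_EFinP.
have -> : (\int[P]_o g2 o = 0)%E.
  rewrite ge0_integralZl //; last first.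
    by apply/measurable_EFinP; exact: measurable_indic.
  have -> : (\int[P]_o (\1_bad o)%:E = 0)%E.
    by rewrite integral_indic // setIT; exact: J_lt.
  by rewrite mule0.
rewrite adde0 ge0_integral_sum //; last 2 first.
- by move=> t; exact/measurable_EFinP.
- by move=> t o _; rewrite lee_fin mulr_ge0.
rewrite mulr_sumr -sumEFin; apply: lee_sum => t _.
by rewrite uniform_pick //; [exact: mQ|exact: iQ].
Qed.

End Output.

(** * Schedule and accuracy *)

Section Schedule.
Context {R : realType}.

(** The choice of [T] leaves [64 / 256 = 1 / 4] of [e ^+ 2], that of [m] leaves
    [64 * 30 / 76800 = 1 / 40], and the regularization takes one half. *)
Lemma schedule_arith (L b e T m s2 B Bb S q : R) :
  0 < L -> 0 < b -> 0 < e -> 1 <= T -> 1 <= m ->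
  256 * L * Bb / (b * e ^+ 2) <= T -> (768 * 100) * s2 / (b * e ^+ 2) <= m ->
  B <= Bb -> b / 64 * S <= L * B + T * (30 * (s2 / m)) ->
  0 <= q -> q <= e / 2 ->
  T^-1 * (S + T * (2 * q ^+ 2)) <= e ^+ 2.
Proof.
move=> L0 b0 e0 T1 m1 hT hm hB hS q0 qe.
have T0 : 0 < T by exact: lt_le_trans T1.
have m0 : 0 < m by exact: lt_le_trans m1.
have be : 0 < b * e ^+ 2 by rewrite mulr_gt0 ?exprn_gt0.
rewrite ler_pdivrMr // in hT; rewrite ler_pdivrMr // in hm.
have h1 : (768 * 100) * (s2 / m) <= b * e ^+ 2.
  by rewrite mulrA ler_pdivrMr // [leRHS]mulrC.
have h2 : L * B <= L * Bb by rewrite ler_pM2l.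
have h3 : q ^+ 2 <= e ^+ 2 / 4.
  have := ler_pM q0 q0 qe qe; rewrite -!expr2; lra.
have h4 : T * ((768 * 100) * (s2 / m)) <= T * (b * e ^+ 2) by rewrite ler_pM2l.
have h5 : b * S <= b * (T * (e ^+ 2 * (11 / 40))).
  have -> : b * (T * (e ^+ 2 * (11 / 40))) = T * (b * e ^+ 2) * (11 / 40) by ring.
  move: hS h2 h4 hT; clear; set x := s2 / m; set y := T * (b * e ^+ 2).
  have -> : T * (30 * x) = 30 * (T * x) by ring.
  have -> : T * (768 * 100 * x) = 768 * 100 * (T * x) by ring.
  have -> : 256 * L * Bb = 256 * (L * Bb) by ring.
  set a := L * Bb; set c := L * B; set z := T * x.
  have -> : b / 64 * S = b * S / 64 by ring.
  set w := b * S; lra.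
rewrite ler_pM2l // in h5.
rewrite mulrC ler_pdivrMr //.
have h6 : T * (2 * q ^+ 2) <= T * (e ^+ 2 / 2) by rewrite ler_pM2l //; lra.
have h7 : 0 <= T * e ^+ 2 by rewrite mulr_ge0 ?ltW // exprn_gt0.
have -> : e ^+ 2 * T = T * e ^+ 2 by ring.
move: h5 h6 h7; clear.
have -> : T * (e ^+ 2 * (11 / 40)) = T * e ^+ 2 * (11/40) by ring.
have -> : T * (e ^+ 2 / 2) = T * e ^+ 2 / 2 by ring.
lra.
Qed.

Lemma ceil_count (r : R) : let N := absz (Num.max 1 (Num.ceil r)) in
  [/\ (0 < N)%N, r <= N%:R & (0 <= r -> N%:R <= 1 + r)].
Proof.
set c : int := Num.max 1 (Num.ceil r) => N.
have c1 : (1 <= c)%R by rewrite le_max lexx.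
have Nc : N%:R = c%:~R :> R by rewrite natr_absz ger0_norm // (le_trans _ c1).
split.
- by rewrite absz_gt0 gt_eqF // (lt_le_trans _ c1).
- by rewrite Nc (le_trans (ceil_ge r)) // ler_int le_max lexx orbT.
- move=> r0; rewrite Nc /c maxEle; case: ifP => _; last by rewrite lerDl.
  by have /andP[+ _] := ceil_itv r; rewrite intrB => /ltW; rewrite lerBlDl.
Qed.

Lemma beta_gt0 (L tau : R) : 0 < L -> 0 < tau -> tau <= L ->
  0 < p_beta (choose_params L tau).
Proof.
move=> L0 tau0 tauL; have -> := betaE L0 tau0 tauL.
have := hgam_gt0 L0 tau0 tauL.
set x := _ * _.
move=> x0.
lra.
Qed.

Variables (L DY eps : R).
Hypotheses (L0 : 0 < L) (DY0 : 0 < DY) (eps0 : 0 < eps).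
Local Notation tau := (Num.min L (eps / (2 * DY))).

Lemma eps_tau : [/\ 0 < tau, tau <= L & tau * DY <= eps / 2].
Proof.
split.
- by rewrite lt_min L0 divr_gt0 // mulr_gt0.
- by rewrite ge_min lexx.
- have -> : eps / 2 = eps / (2 * DY) * DY by field; rewrite gt_eqF.
  by apply: ler_wpM2r; [exact: ltW|rewrite ge_min lexx orbT].
Qed.

End Schedule.

Section Conclusion.
Context {R : realType} {n p : nat}.
Local Notation E := ('rV[R]_n * 'rV[R]_p)%type.
Context {dW : measure_display} {W : measurableType dW}.
Variables (X : set 'rV[R]_n) (Y : set 'rV[R]_p).
Variables (D : probability W R) (f : E -> W -> R) (L sigma : R).
Context {d : measure_display} {Om : measurableType d}.
Variable P : probability Om R.
Hypothesis SA : standing_assumptions X Y D f L.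
Hypothesis oracle : stochastic_oracle P X Y D f sigma.
Variables (x0 : 'rV[R]_n) (y0 : 'rV[R]_p) (Bbar : R).
Hypotheses (Xx0 : X x0) (Yy0 : Y y0).
Hypothesis Bbar_ub : initial_quantity X Y D f L x0 y0 <= Bbar.
Local Notation DY := (max_norm Y).

Lemma initial_quantity_gt0 : 0 < initial_quantity X Y D f L x0 y0.
Proof.
have L0 := L_gt0 SA; have d0 := max_norm_gt0 SA.
have h := phi_inf_le SA Xx0.
rewrite /initial_quantity; apply: ltr_wpDl; last first.
  by rewrite !mulr_gt0 ?exprn_gt0 //; lra.
apply: addr_ge0; [apply: addr_ge0|].
- by rewrite subr_ge0.
- by apply: mulr_ge0 (enorm_ge0 _); rewrite mulr_ge0 // ltW.
- apply: divr_ge0; last exact: ltW.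
  by apply: addr_ge0; [exact: sqr_ge0|apply: mulr_ge0; [|exact: sqr_ge0]].
Qed.

Lemma expected_residual (eps : R) (w : nat -> nat -> nat -> {RV P >-> W})
    (J : {RV P >-> nat}) :
  0 < eps ->
  let T := iter_count L DY Bbar eps in let m := batch_size L DY sigma eps in
  fresh_samples D T m w -> uniform_index T m w J ->
  ('E_P[fun o => (residual X Y D f
      (spde_iterate X Y (sgrad f) L (eps_params L DY eps) m x0 y0
         (fun t j i => w t j i o) (J o).+1) ^+ 2)%R] <= (eps ^+ 2)%:E)%E.
Proof.
move=> eps0 T m fresh [unifJ indJ].
have L0 := L_gt0 SA; have d0 := max_norm_gt0 SA.
have [T0 hT _] := ceil_count (iter_ratio L DY Bbar eps).
have [m0 hm _] := ceil_count (batch_ratio L DY sigma eps).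
rewrite -/(iter_count _ _ _ _) -/T in T0 hT; rewrite -/(batch_size _ _ _ _) -/m in m0 hm.
have [tau0 tauL tauD] := eps_tau L0 d0 eps0.
rewrite /eps_params in hT hm *; rewrite /iter_ratio /batch_ratio /eps_params in hT hm.
set tau := Num.min L _ in tau0 tauL tauD hT hm *.
have game := meanF_smooth_game SA.
have [sad sadP] := choice (fun z => saddle_exists game tau0 z).
pose r := run X Y f L tau m w x0 y0.
pose Q t o := stationarity D f tau (r t.+1 o) + 2 * (tau * DY) ^+ 2.
pose G := <<s \bigcup_(q : 'I_T * 'I_3 * 'I_m) sigma_of (w q.1.1 q.1.2 q.2 : Om -> W) >>.
have sG : Defs.sub_sigma_algebra G.
  split; first exact: smallest_sigma_algebra.
  apply: smallest_sub; first exact: sigma_algebra_measurable.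
  by move=> A [q _] /(sigma_of_measurable (Z := fun q : 'I_T * 'I_3 * 'I_m => w q.1.1 q.1.2 q.2)).
have stat t : (t < T)%N -> rmeas G (Q t) /\ integ P (Q t).
  move=> tT.
  have [mS iS] := stationarity_run SA oracle tau0 tauL sadP m0 fresh Xx0 Yy0 tT.
  split; last by apply: integD; [exact: iS|exact: integ_cst].
  apply: measurable_funD; last exact: measurable_cst.
  move=> mT B mB; have := mS measurableT B mB; rewrite !setTI.
  set sP := past_sub (sample w (T := T) (m := m)) (@sample_rank T m) ((t.+1 * 3) * m).
  move=> /(sub_measurableE sP) h; apply/(sub_measurableE sG); move: h.
  by apply: sub_sigma_algebra2 => A [q _ Aq]; exists q.
rewrite unlock.
apply: (@le_trans _ _ (T%:R^-1 * \sum_(t < T) Ex P (Q t))%:E).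
  apply: (uniform_expectation sG T0 unifJ indJ) => //.
  - by move=> o; rewrite sqr_ge0.
  - by move=> t o; rewrite addr_ge0 ?stationarity_ge0 // mulr_ge0 ?sqr_ge0.
  - by move=> t /stat[].
  - by move=> t /stat[].
  - move=> t o tT ->.
    exact: (residual_bound SA tau (run_inv SA tau0 tauL m w Xx0 Yy0 t.+1 o)).
rewrite lee_fin.
have -> : \sum_(t < T) Ex P (Q t) =
    \sum_(t < T) Ex P (fun o => stationarity D f tau (r t.+1 o)) + T%:R * (2 * (tau * DY) ^+ 2).
  set c := 2 * _; have -> : T%:R * c = \sum_(t < T) c by rewrite sumr_const card_ord mulr_natl.
  rewrite -big_split /=; apply: eq_bigr => t _.
  have [_ iS] := stationarity_run SA oracle tau0 tauL sadP m0 fresh Xx0 Yy0 (ltn_ord t).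
  rewrite /Q ExD; [|exact: iS|exact: integ_cst].
  by rewrite Ex_cst.
have b0 : 0 < p_beta (choose_params L tau).
  exact: beta_gt0.
have S := stationarity_sum SA oracle tau0 tauL sadP m0 fresh Xx0 Yy0.
apply: (schedule_arith L0 b0 eps0 _ _ hT hm Bbar_ub S _ tauD).
- by rewrite ler1n.
- by rewrite ler1n.
- by rewrite mulr_ge0 ?ltW.
Qed.

End Conclusion.

(** * Oracle complexity *)

Section Complexity.
Context {R : realType}.

Lemma spde_callsE n p (W : Type) (X : set 'rV[R]_n) (Y : set 'rV[R]_p) g (L tau : R)
    m x0 y0 (w : nat -> nat -> nat -> W) t :
  spde_calls X Y g L (choose_params L tau) m x0 y0 w t = (3 * m * t)%N.
Proof.
rewrite /spde_calls; elim: t => [|t IH]; first by rewrite muln0.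
have -> : spde_run X Y g L (choose_params L tau) m x0 y0 w t.+1 =
    spde_step X Y g L (choose_params L tau) m (w t)
      (spde_run X Y g L (choose_params L tau) m x0 y0 w t) by [].
rewrite spde_stepE [st_calls _]/= IH mulnS [RHS]addnC.
by rewrite !mulSn mul0n addn0 !addnA.
Qed.

(** The larger of the numerical factors of the two ratios, times the constant of
    [beta_K]. *)
Definition rate_const : R := (768 * 100) * (256 * 64 ^+ 2).

Lemma rate_const_ge1 : 1 <= rate_const.
Proof. by rewrite /rate_const; nra. Qed.

Variables (L DY eps : R).
Hypotheses (L0 : 0 < L) (DY0 : 0 < DY) (eps0 : 0 < eps).
Local Notation tau := (Num.min L (eps / (2 * DY))).
Local Notation K := (K_eps L DY eps).
Local Notation beta := (p_beta (eps_params L DY eps)).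

Lemma K_ge1 : 1 <= K.
Proof. by rewrite le_max lexx. Qed.

(** Either [tau = L], or [K ^+ 2] is at least [2 * L * DY / eps = L / tau]. *)
Lemma damping_K : L <= Num.sqrt (2 * L * tau) * K.
Proof.
have [tau0 tauL _] := eps_tau L0 DY0 eps0.
have K0 : 0 <= K by exact: le_trans ler01 K_ge1.
have s0 : 0 <= 2 * L * tau by rewrite !mulr_ge0 // ltW.
rewrite -ler_sqr ?nnegrE ?mulr_ge0 ?sqrtr_ge0 //; last exact: ltW.
rewrite exprMn sqr_sqrtr //.
have K1 : 1 <= K ^+ 2 by rewrite exprn_ege1 // K_ge1.
have K2 : 2 * L * DY / eps <= K ^+ 2.
  have r0 : 0 <= 2 * L * DY / eps by rewrite divr_ge0 ?mulr_ge0 // ltW.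
  rewrite -[leLHS]sqr_sqrtr // ler_sqr ?nnegrE ?sqrtr_ge0 //.
  by rewrite le_max lexx orbT.
rewrite minEle; case: ifP => _.
  have := ler_wpM2l (ltW (mulr_gt0 L0 L0)) K1; have := mulr_gt0 L0 L0; nra.
have e : 2 * L * (eps / (2 * DY)) * (2 * L * DY / eps) = 2 * L ^+ 2.
  by field; rewrite !gt_eqF.
have c0 : 0 <= 2 * L * (eps / (2 * DY)).
  by apply: mulr_ge0; [rewrite mulr_ge0 // ltW|rewrite divr_ge0 ?mulr_ge0 // ltW].
have := ler_wpM2l c0 K2; rewrite e; have := sqr_ge0 L; lra.
Qed.

(** [beta] is [h * s / 64 ^+ 2], with [h * L >= 256^-1] and [s * K >= L]. *)
Lemma beta_K : 1 <= beta * K * (256 * 64 ^+ 2).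
Proof.
have [tau0 tauL _] := eps_tau L0 DY0 eps0.
have /andP[hL _] := hL_bounds L0 tau0 tauL.
have h0 := h_gt0 L0 tau0 tauL.
have := ler_wpM2l (ltW h0) damping_K.
rewrite /p_beta /eps_params /choose_params.
move: hL h0; rewrite /p_h /choose_params.
set s := Num.sqrt _; set h := (64 * _)^-1 => hL h0 hs.
have -> : h * s / 64 ^+ 2 * K * (256 * 64 ^+ 2) = 256 * (h * (s * K)).
  by field.
lra.
Qed.

Lemma rate_bound (c q : R) : 0 <= c -> c <= 768 * 100 -> 0 <= q ->
  c * q / (beta * eps ^+ 2) <= rate_const * (q * K / eps ^+ 2).
Proof.
move=> c0 c1 q0.
have [tau0 tauL _] := eps_tau L0 DY0 eps0.
have b0 := beta_gt0 L0 tau0 tauL.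
have e0 : 0 < eps ^+ 2 by rewrite exprn_gt0.
have -> : c * q / (beta * eps ^+ 2) = (c * (q / eps ^+ 2)) / beta.
  by field; rewrite !gt_eqF.
rewrite ler_pdivrMr //.
set r := q / eps ^+ 2.
have r0 : 0 <= r by rewrite divr_ge0 // ltW.
have -> : rate_const * (q * K / eps ^+ 2) * beta =
    (768 * 100) * (r * (beta * K * (256 * 64 ^+ 2))).
  by rewrite /rate_const /r; ring.
apply: ler_pM => //.
by rewrite -[leLHS]mulr1 ler_wpM2l // beta_K.
Qed.

Lemma K_rate : eps <= 1 ->
  K / eps ^+ 2 <= (1 + Num.sqrt (2 * L * DY)) * eps `^ (- (5 / 2)).
Proof.
move=> eps1.
have q0 : 0 < Num.sqrt eps by rewrite sqrtr_gt0.
have q1 : Num.sqrt eps <= 1 by rewrite -sqrtr1 ler_wsqrtr.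
have e2 : 0 < eps ^+ 2 by rewrite exprn_gt0.
have pE : eps `^ (- (5 / 2)) = (eps ^+ 2)^-1 * (Num.sqrt eps)^-1.
  have -> : - (5 / 2) = - 2%:R + - 2^-1 :> R by lra.
  rewrite powRD; last by apply/implyP => _; rewrite gt_eqF.
  by rewrite !powRN powR_mulrn ?powR12_sqrt // ltW.
rewrite pE mulrCA mulrC ler_pM2l ?invr_gt0 //.
rewrite ler_pdivlMr //.
have rq : Num.sqrt (2 * L * DY / eps) * Num.sqrt eps = Num.sqrt (2 * L * DY).
  by rewrite -sqrtrM ?divfK ?gt_eqF // divr_ge0 ?mulr_ge0 // ltW.
have c0 := sqrtr_ge0 (2 * L * DY).
rewrite /K_eps maxEle; case: ifP => _; first by rewrite rq lerDr.
by rewrite mul1r; lra.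
Qed.

End Complexity.

Section Counts.
Context {R : realType}.

Lemma product_bound (a b A S c : R) : 1 <= c -> 0 <= a -> 0 <= b -> 0 <= A -> 0 <= S ->
  a <= c * A -> b <= c * S ->
  3 * (1 + a) * (1 + b) <= 3 * c ^+ 2 * (1 + (A + S) + A * S).
Proof.
move=> c1 a0 b0 A0 S0 aA bS.
have c0 : 0 <= c by exact: le_trans ler01 c1.
have h1 : c <= c ^+ 2 by rewrite expr2 ler_peMr.
have h2 : 1 <= c ^+ 2 by exact: (le_trans c1 h1).
have ab : a * b <= c ^+ 2 * (A * S).
  have -> : c ^+ 2 * (A * S) = c * A * (c * S) by ring.
  exact: ler_pM.
have hA := ler_wpM2r A0 h1; have hS := ler_wpM2r S0 h1.
have -> : 3 * (1 + a) * (1 + b) = 3 * (1 + a + b + a * b) by ring.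
have -> : 3 * c ^+ 2 * (1 + (A + S) + A * S) =
  3 * (c ^+ 2 + c ^+ 2 * A + c ^+ 2 * S + c ^+ 2 * (A * S)) by ring.
rewrite ler_pM2l //; move: h2 ab hA hS aA bS.
set x := c * A; set y := c * S; set z := a * b; set u := c ^+ 2 * (A * S).
lra.
Qed.

Lemma bigO_right0 (g : R -> R) (e k : R) :
  (forall eps, 0 < eps -> eps <= 1 -> 0 <= g eps <= k * eps `^ e) ->
  (g : R -> R^o) =O_ ((0 : R)^'+) (fun eps : R => eps `^ e : R^o).
Proof.
move=> gk; apply/eqO_exP; exists (1 + `|k|); first by rewrite ltr_wpDr.
near=> x.
have x0 : 0 < x by [].
have x1 : x <= 1 by near: x; exact: nbhs_right_le.
have /andP[g0 g1] := gk _ x0 x1.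
have -> : `|g x : R^o| = g x by exact: ger0_norm.
have -> : `|x `^ e : R^o| = x `^ e by apply: ger0_norm; exact: powR_ge0.
apply: (le_trans g1).
by rewrite ler_wpM2r ?powR_ge0 // (le_trans (ler_norm k)) // lerDr.
Unshelve. all: by end_near.
Qed.

Variables (L DY sigma Bbar : R).
Hypotheses (L0 : 0 < L) (DY0 : 0 < DY) (B0 : 0 < Bbar).
Local Notation T := (iter_count L DY Bbar).
Local Notation m := (batch_size L DY sigma).
Local Notation kT := (1 + rate_const * (L * Bbar * (1 + Num.sqrt (2 * L * DY)))).
Local Notation km := (1 + rate_const * (sigma ^+ 2 * (1 + Num.sqrt (2 * L * DY)))).

Section FixedEps.
Variable eps : R.
Hypothesis eps0 : 0 < eps.
Local Notation K := (K_eps L DY eps).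

Lemma iter_ratio_bounds : 0 <= iter_ratio L DY Bbar eps <=
  rate_const * (L * Bbar * K / eps ^+ 2).
Proof.
have [tau0 tauL _] := eps_tau L0 DY0 eps0.
have b0 := beta_gt0 L0 tau0 tauL.
have q0 : 0 <= L * Bbar by rewrite mulr_ge0 // ltW.
rewrite /iter_ratio -[256 * L * Bbar]mulrA; apply/andP; split; last first.
  by apply: rate_bound; [exact: L0|exact: DY0|exact: eps0|lra|lra|exact: q0].
apply: divr_ge0; first by apply: mulr_ge0; [lra|exact: q0].
by rewrite mulr_ge0 ?sqr_ge0 // ltW.
Qed.

Lemma batch_ratio_bounds : 0 <= batch_ratio L DY sigma eps <=
  rate_const * (sigma ^+ 2 * K / eps ^+ 2).
Proof.
have [tau0 tauL _] := eps_tau L0 DY0 eps0.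
have b0 := beta_gt0 L0 tau0 tauL.
rewrite /batch_ratio; apply/andP; split.
  apply: divr_ge0; first by apply: mulr_ge0; [lra|exact: sqr_ge0].
  by rewrite mulr_ge0 ?sqr_ge0 // ltW.
by apply: rate_bound; [exact: L0|exact: DY0|exact: eps0|lra|lra|exact: sqr_ge0].
Qed.

Lemma iter_count_ub : (T eps)%:R <= 1 + iter_ratio L DY Bbar eps.
Proof.
have /andP[a0 _] := iter_ratio_bounds.
by have [_ _] := ceil_count (iter_ratio L DY Bbar eps); apply.
Qed.

Lemma batch_size_ub : (m eps)%:R <= 1 + batch_ratio L DY sigma eps.
Proof.
have /andP[a0 _] := batch_ratio_bounds.
by have [_ _] := ceil_count (batch_ratio L DY sigma eps); apply.
Qed.

Lemma calls_ub : (3 * m eps * T eps)%:R <=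
  3 * (1 + iter_ratio L DY Bbar eps) * (1 + batch_ratio L DY sigma eps).
Proof.
rewrite !natrM -!mulrA ler_wpM2l // mulrC; apply: ler_pM => //.
  exact: iter_count_ub.
exact: batch_size_ub.
Qed.

Lemma calls_rate : 3 * (1 + iter_ratio L DY Bbar eps) * (1 + batch_ratio L DY sigma eps)
  <= 3 * rate_const ^+ 2 * (1 + (L * Bbar + sigma ^+ 2) * K / eps ^+ 2
       + L * Bbar * sigma ^+ 2 * K ^+ 2 / eps ^+ 4).
Proof.
have /andP[a0 a1] := iter_ratio_bounds; have /andP[b0 b1] := batch_ratio_bounds.
have K0 : 0 <= K by exact: le_trans ler01 (K_ge1 _ _ _).
have A0 : 0 <= L * Bbar * K / eps ^+ 2.
  by rewrite divr_ge0 ?sqr_ge0 // !mulr_ge0 // ltW.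
have S0 : 0 <= sigma ^+ 2 * K / eps ^+ 2.
  by rewrite divr_ge0 ?sqr_ge0 // mulr_ge0 ?sqr_ge0.
apply: le_trans (product_bound rate_const_ge1 a0 b0 A0 S0 a1 b1) _.
rewrite le_eqVlt; apply/orP; left; apply/eqP; congr (_ * (1 + _ + _)).
  by rewrite -mulrDl -mulrDl.
by field; rewrite gt_eqF.
Qed.

Hypothesis eps1 : eps <= 1.

Lemma count_rate (c q : R) : 0 <= q -> c <= 1 + rate_const * (q * K / eps ^+ 2) ->
  c <= (1 + rate_const * (q * (1 + Num.sqrt (2 * L * DY)))) * eps `^ (- (5 / 2)).
Proof.
move=> q0 hc; apply: le_trans hc _.
have r0 : 0 <= rate_const :> R by exact: le_trans ler01 rate_const_ge1.
have p1 : 1 <= eps `^ (- (5 / 2)).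
  by rewrite -[leLHS](powRr0 eps); apply: ger_powR; rewrite ?eps0 //; lra.
rewrite mulrDl mul1r; apply: lerD p1 _.
move: rate_const r0 => k r0; rewrite -[leRHS]mulrA; apply: ler_wpM2l r0 _ _ _.
by rewrite -[leLHS]mulrA -[leRHS]mulrA; apply: ler_wpM2l q0 _ _ _; exact: K_rate.
Qed.

End FixedEps.

Lemma iter_count_rate eps : 0 < eps -> eps <= 1 -> (T eps)%:R <= kT * eps `^ (- (5 / 2)).
Proof.
move=> eps0 eps1; apply: count_rate => //; first by rewrite mulr_ge0 // ltW.
have /andP[_ a1] := iter_ratio_bounds eps0.
by apply: le_trans (iter_count_ub eps0) _; rewrite lerD2l.
Qed.

Lemma batch_size_rate eps : 0 < eps -> eps <= 1 -> (m eps)%:R <= km * eps `^ (- (5 / 2)).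
Proof.
move=> eps0 eps1; apply: count_rate => //; first by rewrite sqr_ge0.
have /andP[_ a1] := batch_ratio_bounds eps0.
by apply: le_trans (batch_size_ub eps0) _; rewrite lerD2l.
Qed.

Lemma calls_count_rate eps : 0 < eps -> eps <= 1 ->
  (3 * m eps * T eps)%:R <= 3 * km * kT * eps `^ (- 5).
Proof.
move=> eps0 eps1.
have -> : eps `^ (- 5) = eps `^ (- (5 / 2)) * eps `^ (- (5 / 2)).
  by rewrite -powRD; [congr powR; lra|apply/implyP => _; rewrite gt_eqF].
have -> : 3 * km * kT * (eps `^ (- (5 / 2)) * eps `^ (- (5 / 2))) =
  3 * ((km * eps `^ (- (5 / 2))) * (kT * eps `^ (- (5 / 2)))) by ring.
rewrite !natrM -mulrA ler_wpM2l //; apply: ler_pM => //.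
  exact: batch_size_rate.
exact: iter_count_rate.
Qed.

End Counts.

Theorem theorem3 (R : realType) :
  exists C : R, 0 < C /\
  forall (n p : nat) (X : set 'rV[R]_n) (Y : set 'rV[R]_p)
    (dW : measure_display) (W : measurableType dW) (D : probability W R)
    (f : 'rV[R]_n * 'rV[R]_p -> W -> R) (L sigma : R)
    (x0 : 'rV[R]_n) (y0 : 'rV[R]_p) (Bbar : R)
    (d : measure_display) (Om : measurableType d) (P : probability Om R),
  standing_assumptions X Y D f L ->
  0 <= sigma -> stochastic_oracle P X Y D f sigma ->
  X x0 -> Y y0 ->
  initial_quantity X Y D f L x0 y0 <= Bbar ->
  let DY := max_norm Y in
  let T := iter_count L DY Bbar in
  let m := batch_size L DY sigma in
  let iterate := fun eps =>
    spde_iterate X Y (sgrad f) L (eps_params L DY eps) (m eps) x0 y0 in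
  let N := fun eps w =>
    spde_calls X Y (sgrad f) L (eps_params L DY eps) (m eps) x0 y0 w (T eps) in
  (forall eps : R, 0 < eps ->
     (forall (w : nat -> nat -> nat -> {RV P >-> W}) (J : {RV P >-> nat}),
        fresh_samples D (T eps) (m eps) w ->
        uniform_index (T eps) (m eps) w J ->
        ('E_P[fun o => (residual X Y D f
                (iterate eps (fun t j i => w t j i o) (J o).+1) ^+ 2)%R]
          <= (eps ^+ 2)%:E)%E) /\
     (forall w : nat -> nat -> nat -> W,
        [/\ (N eps w <= 3 * m eps * T eps)%N,
            (3 * m eps * T eps)%:R <=
              3 * (1 + 256 * L * Bbar
                       / (p_beta (eps_params L DY eps) * eps ^+ 2))
                * (1 + (768 * 100) * sigma ^+ 2
                       / (p_beta (eps_params L DY eps) * eps ^+ 2)) :> R &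
            (N eps w)%:R <=
              C * (1 + (L * Bbar + sigma ^+ 2) * K_eps L DY eps / eps ^+ 2
                   + L * Bbar * sigma ^+ 2 * K_eps L DY eps ^+ 2 / eps ^+ 4)]))
  /\
  (0 < sigma ->
     [/\ (fun eps : R => (T eps)%:R : R^o)
           =O_ ((0 : R)^'+) (fun eps : R => eps `^ (- (5 / 2)) : R^o),
         (fun eps : R => (m eps)%:R : R^o)
           =O_ ((0 : R)^'+) (fun eps : R => eps `^ (- (5 / 2)) : R^o) &
         forall w : R -> nat -> nat -> nat -> W,
           (fun eps : R => (N eps (w eps))%:R : R^o)
             =O_ ((0 : R)^'+) (fun eps : R => eps `^ (- 5) : R^o)]).


Proof.
have C0 : 0 < 3 * rate_const ^+ 2 :> R.
  by rewrite mulr_gt0 // exprn_gt0 // (lt_le_trans _ rate_const_ge1).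
exists (3 * rate_const ^+ 2); split => //.
move=> n p X Y dW W D f L sigma x0 y0 Bbar d Om P SA sigma0 oracle Xx0 Yy0 hB DY T m iterate N.
have L0 := L_gt0 SA; have DY0 := max_norm_gt0 SA.
have B0 : 0 < Bbar := lt_le_trans (initial_quantity_gt0 SA y0 Xx0) hB.
split=> [eps eps0|_].
  split=> [w J fresh unif|w].
    exact: (expected_residual SA oracle Xx0 Yy0 hB eps0 fresh unif).
  have NE : N eps w = (3 * m eps * T eps)%N by exact: spde_callsE.
  have c1 := calls_ub sigma L0 DY0 B0 eps0; have c2 := calls_rate sigma L0 DY0 B0 eps0.
  split; first by rewrite NE.
    exact: c1.
  by rewrite NE; exact: le_trans c1 c2.
split.
- apply: bigO_right0 => eps eps0 eps1.
  by rewrite ler0n; exact: (iter_count_rate L0 DY0 B0 eps0 eps1).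
- apply: bigO_right0 => eps eps0 eps1.
  by rewrite ler0n; exact: (batch_size_rate sigma L0 DY0 eps0 eps1).
- move=> w; apply: bigO_right0 => eps eps0 eps1.
  rewrite ler0n /N /eps_params spde_callsE.
  exact: (calls_count_rate sigma L0 DY0 B0 eps0 eps1).
Qed.
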